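(* Let $k=-9/4$. (1) For every $r\in\mathbb C$, $\mathcal M_{-1}(r)$ is a $\mathbb Z_{\ge0}$-graded $\mathcal W_k$-module with lowest conformal weight $-1/2$: $$\mathcal M_{-1}(r)=\bigoplus_{m=0}^\infty\mathcal M_{-1}(r)(m),\qquad L(0)|_{\mathcal M_{-1}(r)(m)}\equiv(-\tfrac12+m)\,\mathrm{Id}.$$ (2) Assume that $4r\notin\mathbb Z$ for some $r\in\mathbb C$. Then: (i) $\mathcal M_{-1}(r)(0)$ is an irreducible module for the Smith algebra $R(g)$, for $g(x,y)=-(3x^2-(2k+3)x-(k+3)y)$, where $y=-1/2$ (that is, $Y$ acts as $-\frac12$). (ii) The $\mathcal W_k$-module $\mathcal M_{-1}(r)$ is irreducible.
   Context: For $k\in\mathbb C$, $k\ne -3$, $\mathcal W^k=\mathcal W^k(sl_3,f_\theta)$ is the universal Bershadsky-Polyakov vertex algebra of level $k$: the universal vertex algebra strongly generated by even fields $J,T,G^+,G^-$ with OPEs $J(z)J(w)\sim \frac{2k+3}{3}(z-w)^{-2}$, $G^\pm(z)G^\pm(w)\sim 0$, $J(z)G^\pm(w)\sim \pm G^\pm(w)(z-w)^{-1}$, $T(z)T(w)\sim \frac{c_k}{2}(z-w)^{-4}+2T(w)(z-w)^{-2}+DT(w)(z-w)^{-1}$, $T(z)G^\pm(w)\sim\frac32 G^\pm(w)(z-w)^{-2}+DG^\pm(w)(z-w)^{-1}$, $T(z)J(w)\sim J(w)(z-w)^{-2}+DJ(w)(z-w)^{-1}$, $G^+(z)G^-(w)\sim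 (k+1)(2k+3)(z-w)^{-3}+3(k+1)J(w)(z-w)^{-2}+\left(3:J(w)J(w):+\frac{3(k+1)}{2}DJ(w)-(k+3)T(w)\right)(z-w)^{-1}$, where $c_k=-\frac{(3k+1)(2k+3)}{k+3}$ and $D$ is the derivative. $\mathcal W_k$ is its unique simple quotient. Modes: $T(z)=\sum L_nz^{-n-2}$, $J(z)=\sum J_nz^{-n-1}$, $G^\pm(z)=\sum G^\pm_nz^{-n-1}$. Set $J(n)=J_n$, $L(n)=L_n-\frac{n+1}{2}J_n$, $G^+(n)=G^+_n$, $G^-(n)=G^-_{n+1}$; the $L(n)$ are the modes of $\overline\omega=\omega+\frac12 DJ$, where $\omega$ is the conformal vector of $T$. Let $L=\mathbb Z\gamma+\mathbb Z\delta$ be the lattice with $\langle\gamma,\gamma\rangle=-\langle\delta,\delta\rangle=2$, $\langle\gamma,\delta\rangle=0$, $V_L=M(1)\otimes\mathbb C[L]$ its lattice vertex algebra (with trivial cocycle), where $M(1)$ is the rank two Heisenberg vertex algebra of $\mathbb C\gamma+\mathbb C\delta$. Let $\Pi(0)=M(1)\otimes\mathbb C[\mathbb Z(\gamma+\delta)]\subset V_L$. For $k=-9/4$, the simple vertex algebra $\mathcal W_k$ is realized as the vertex subalgebra of $\Pi(0)$ generated by $G^-=-\frac{\sqrt6}{8}e^{-\gamma-\delta}$, $G^+=\frac{\sqrt6}{8}\cdot\frac13\left(4\gamma(-1)^3+6\gamma(-1)\gamma(-2)+2\gamma(-3)\right)e^{\gamma+\delta}$, $J=-\frac12\delta(-1)$,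 $\omega=\frac14\gamma(-1)^2+\frac34\gamma(-2)-\frac14\delta(-1)^2$ (so $\overline\omega=\omega-\frac14\delta(-2)$). For $s\in\mathbb Z$, $r\in\mathbb C$, $\mathcal M_s(r)=\Pi(0).e^{s\delta+r(\gamma+\delta)}$ denotes the irreducible $\Pi(0)$-module $M(1)\otimes e^{s\delta+r(\gamma+\delta)}\mathbb C[\mathbb Z(\gamma+\delta)]$, regarded as a $\mathcal W_k$-module by restriction. For $g(x,y)\in\mathbb C[x,y]$, the Smith-type algebra $R(g)$ is the associative algebra generated by $E,F,X,Y$ with $Y$ central and $XE-EX=E$, $XF-FX=-F$, $EF-FE=g(X,Y)$. It acts on the lowest component $\mathcal M_{-1}(r)(0)$ by $E=G^+(0)$, $F=-G^-(0)$, $X=J(0)$, $Y=L(0)$. *)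

(* Defs.v *)
From HB Require Import structures.
From mathcomp Require Import all_boot all_order all_algebra.
From mathcomp Require Import polyXY finmap multiset.
From mathcomp.real_closed Require Import complex.
From mathcomp Require Import classical_sets fsbigop reals.
From mathcomp Require Import monalg.

Set Implicit Arguments.
Unset Strict Implicit.
Unset Printing Implicit Defensive.

Import Order.TTheory GRing.Theory Num.Theory.
Local Open Scope ring_scope.

Section Subspaces.
Variables (F : fieldType) (V : lmodType F).

Definition subspace (S : set V) : Prop :=
  S 0 /\ forall (a : F) (u v : V), S u -> S v -> S (a *: u + v).

(* V is the (internal) direct sum of the S m, m >= 0. *)
Definition direct_sum_decomposition (S : nat -> set V) : Prop :=
  [/\ forall m, subspace (S m),
      forall v, exists (N : nat) (f : nat -> V),
        (forall m, S m (f m)) /\ v = \sum_(m < N) f m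
    & forall (N : nat) (f : nat -> V), (forall m, S m (f m)) ->
        \sum_(m < N) f m = 0 -> forall m, (m < N)%N -> f m = 0].

End Subspaces.

(* Sums over [set: nat] are finite-support sums; the truncation axiom makes the
   supports finite in every use below. *)

Definition binz (F : fieldType) (z : int) (i : nat) : F :=
  (\prod_(j < i) (z%:~R - j%:R)) / (i`!)%:R.

(* [nprod a n b] is the n-th product a_(n) b, where Y(a,z) = \sum_n a_(n) z^(-n-1). *)
Record vaData (F : fieldType) := VaData {
  va_sort :> lmodType F;
  vac : va_sort;
  nprod : va_sort -> int -> va_sort -> va_sort }.

Arguments vac {F} v.
Arguments nprod {F} v _ _ _.

Section VertexAlgebras.
Variable F : fieldType.
Implicit Types V W : vaData F.

(* [act a n w] is the mode a_(n) of Y_M(a,z) = \sum_n a_(n) z^(-n-1). *)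
Definition va_module V (M : lmodType F) (act : V -> int -> M -> M) : Prop :=
  [/\ (forall a n, linear (act a n)) /\ (forall n w, linear (fun a => act a n w)),
      forall a w, exists N : int, forall n, N <= n -> act a n w = 0,
      forall n w, act (vac V) n w = if n == -1 then w else 0
    & forall (a b : V) (w : M) (l m n : int),
        \sum_(i \in [set: nat]%classic)
          binz F m i *: act (nprod V a (l + i%:Z) b) (m + n - i%:Z) w =
        \sum_(i \in [set: nat]%classic)
          ((-1) ^+ i * binz F l i) *:
            (act a (m + l - i%:Z) (act b (n + i%:Z) w)
             - (-1) ^ l *: act b (n + l - i%:Z) (act a (m + i%:Z) w))].

Definition vertex_algebra V : Prop :=
  va_module (nprod V) /\
  forall a, nprod V a (-1) (vac V) = a /\
            forall n : nat, nprod V a n%:Z (vac V) = 0.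

Definition va_D V (a : V) : V := nprod V a (-2) (vac V).

Definition va_hom V W (f : V -> W) : Prop :=
  [/\ linear f, f (vac V) = vac W &
      forall a n b, f (nprod V a n b) = nprod W (f a) n (f b)].

Definition va_ideal V (I : set V) : Prop :=
  subspace I /\
  forall a v n, I v -> I (nprod V a n v) /\ I (nprod V v n a).

Definition va_simple V : Prop :=
  (exists v : V, v <> 0) /\
  forall I : set V, va_ideal I -> (forall v, I v -> v = 0) \/ (forall v, I v).

Definition vertex_subalgebra V (S : set V) : Prop :=
  [/\ subspace S, S (vac V) & forall a n b, S a -> S b -> S (nprod V a n b)].

Definition va_generated V (G : set V) : set V :=
  fun v => forall S : set V, vertex_subalgebra S ->
    (forall x, G x -> S x) -> S v.

(* V is spanned by x1_(-n1-1) ... xl_(-nl-1) vac with the xi in G, ni >= 0. *)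
Definition strongly_generated V (G : set V) : Prop :=
  forall S : set V, subspace S -> S (vac V) ->
    (forall x (n : nat) v, G x -> S v -> S (nprod V x (Negz n) v)) ->
    forall v, S v.

(* a(z) b(w) ~ \sum_j l_j (z-w)^(-j-1). *)
Definition ope V (a b : V) (l : seq V) : Prop :=
  forall n : nat, nprod V a n%:Z b = nth 0 l n.

Definition va_submodule V (M : lmodType F) (act : V -> int -> M -> M)
    (N : set M) : Prop :=
  subspace N /\ forall a n w, N w -> N (act a n w).

Definition va_irreducible V (M : lmodType F) (act : V -> int -> M -> M) : Prop :=
  (exists w : M, w <> 0) /\
  forall N : set M, va_submodule act N ->
    (forall w, N w -> w = 0) \/ (forall w, N w).

End VertexAlgebras.

Record bpGens (F : fieldType) (V : vaData F) := BpGens {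
  bpJ : V; bpT : V; bpGp : V; bpGm : V }.

Section BershadskyPolyakov.
Variables (F : fieldType) (k : F).
Implicit Types V W : vaData F.

Definition bp_map V W (f : V -> W) (g : bpGens V) : bpGens W :=
  BpGens (f (bpJ g)) (f (bpT g)) (f (bpGp g)) (f (bpGm g)).

Definition bp_set V (g : bpGens V) : set V :=
  fun x => [\/ x = bpJ g, x = bpT g, x = bpGp g | x = bpGm g].

Definition bp_c : F := - ((3 * k + 1) * (2 * k + 3) / (k + 3)).

Definition bp_relations V (g : bpGens V) : Prop :=
  let J := bpJ g in let T := bpT g in
  let Gp := bpGp g in let Gm := bpGm g in
  let one := vac V in let D := @va_D F V in
  [/\ ope J J [:: 0; ((2 * k + 3) / 3) *: one],
      ope Gp Gp [::] /\ ope Gm Gm [::],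
      ope J Gp [:: Gp] /\ ope J Gm [:: - Gm],
      ope T T [:: D T; 2 *: T; 0; (bp_c / 2) *: one]
    & [/\ ope T Gp [:: D Gp; (3 / 2) *: Gp],
          ope T Gm [:: D Gm; (3 / 2) *: Gm],
          ope T J [:: D J; J]
        & ope Gp Gm
            [:: 3 *: nprod V J (-1) J + (3 * (k + 1) / 2) *: D J - (k + 3) *: T;
                (3 * (k + 1)) *: J;
                ((k + 1) * (2 * k + 3)) *: one]]].

Definition universal_bp V (g : bpGens V) : Prop :=
  [/\ vertex_algebra V, bp_relations g, strongly_generated (bp_set g) &
      forall W (h : bpGens W), vertex_algebra W -> bp_relations h ->
        exists f : V -> W, va_hom f /\ bp_map f g = h].

(* W is the simple quotient of the universal algebra of level k. *)
Definition simple_bp W (g : bpGens W) : Prop :=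
  [/\ vertex_algebra W, va_simple W &
      exists (V : vaData F) (h : bpGens V) (p : V -> W),
        [/\ universal_bp h, va_hom p, (forall w, exists v, p v = w)
          & bp_map p h = g]].

(* Shifted modes: J(n) = J_n, L(n) = L_n - (n+1)/2 J_n,
   G^+(n) = G^+_n, G^-(n) = G^-_(n+1), where J_n and G^+-_n are the n-th modes
   and L_n is the (n+1)-st mode of T. *)
Section Modes.
Variables (V : vaData F) (M : lmodType F) (act : V -> int -> M -> M).
Variable g : bpGens V.

Definition Jop (n : int) : M -> M := act (bpJ g) n.
Definition Lop (n : int) (w : M) : M :=
  act (bpT g) (n + 1) w - ((n + 1)%:~R / 2) *: act (bpJ g) n w.
Definition Gpop (n : int) : M -> M := act (bpGp g) n.
Definition Gmop (n : int) : M -> M := act (bpGm g) (n + 1).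

End Modes.

(* M = (+)_m Mg m as a graded module: for a of L(0)-weight d, the mode a_(n)
   maps Mg m into Mg (m + d - n - 1), where Mg is 0 in negative degrees. *)
Definition graded_module V (M : lmodType F) (act : V -> int -> M -> M)
    (g : bpGens V) (Mg : nat -> set M) : Prop :=
  [/\ va_module act, direct_sum_decomposition Mg &
      forall (a : V) (d n : int) (m : nat) (w : M),
        Lop (nprod V) g 0 a = d%:~R *: a -> Mg m w ->
        match m%:Z + d - n - 1 with
        | Posz m' => Mg m' (act a n w)
        | Negz _ => act a n w = 0
        end].

End BershadskyPolyakov.

Section Smith.
Variables (F : fieldType) (M : lmodType F).

Definition op_on (S : set M) (A : M -> M) : Prop :=
  (forall v, S v -> S (A v)) /\
  forall (a : F) u v, S u -> S v -> A (a *: u + v) = a *: A u + A v.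

(* g(X,Y) for commuting operators X, Y; g`_i`_j is the coefficient of x^i y^j. *)
Definition op_horner2 (g : {poly {poly F}}) (X Y : M -> M) (v : M) : M :=
  \sum_(i < size g) \sum_(j < size g`_i) g`_i`_j *: iter i X (iter j Y v).

(* The operators make the subspace S a module over the algebra R(g). *)
Definition smith_module (g : {poly {poly F}}) (S : set M)
    (E G X Y : M -> M) : Prop :=
  [/\ subspace S,
      [/\ op_on S E, op_on S G, op_on S X & op_on S Y],
      forall v, S v -> [/\ Y (E v) = E (Y v), Y (G v) = G (Y v)
                         & Y (X v) = X (Y v)]
    & forall v, S v -> [/\ X (E v) - E (X v) = E v,
                           X (G v) - G (X v) = - G v
                         & E (G v) - G (E v) = op_horner2 g X Y v]].

Definition smith_irreducible (g : {poly {poly F}}) (S : set M)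
    (E G X Y : M -> M) : Prop :=
  [/\ smith_module g S E G X Y, (exists2 v, S v & v <> 0) &
      forall N : set M, subspace N -> (forall v, N v -> S v) ->
        (forall v, N v -> [/\ N (E v), N (G v), N (X v) & N (Y v)]) ->
        (forall v, N v -> v = 0) \/ (forall v, S v -> N v)].

End Smith.

(* g(x,y) = -(3 x^2 - (2k+3) x - (k+3) y) *)
Definition bp_smith_poly (F : fieldType) (k : F) : {poly {poly F}} :=
  - (3 * 'X ^+ 2 - (2 * k + 3)%:P%:P * 'X - (k + 3)%:P%:P * 'Y).

Section HalfLattice.
Variable F : numClosedFieldType.

(* Vectors of the Cartan algebra in the basis gamma, delta. *)
Definition cartan : lmodType F := (F^o * F^o)%type.
Definition gam : cartan := (1, 0).
Definition del : cartan := (0, 1).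
Definition form (u v : cartan) : F := 2 * u.1 * v.1 - 2 * u.2 * v.2.

(* The basis element (j, A) stands for
     \prod_((x,n) in A) x(-n-1) (x) e^(s delta + (r + j)(gamma + delta)),
   where x = true is gamma and x = false is delta.  All the M_s(r) have this
   underlying space; s and r only enter the operators. *)
Definition fockBasis : choiceType := (int * {mset (bool * nat)%type}%mset)%type.
Definition fock : lmodType F := {malg F[fockBasis]}.

Definition expv (j : int) : fock := << ((j, mset0) : fockBasis) >>.

Definition lext (f : fockBasis -> fock) (u : fock) : fock :=
  \sum_(b <- msupp u) u@_b *: f b.

Definition hvec (x : bool) : cartan := if x then gam else del.

Section Operators.
Variables (s : int) (r : F).

Definition wt (j : int) : cartan := s%:~R *: del + (r + j%:~R) *: (gam + del).

(* The Heisenberg modes: [x(m), y(n)] = m <x,y> delta_(m+n,0). *)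
Definition heis_basis (x : bool) (n : int) (b : fockBasis) : fock :=
  match n with
  | Negz p => << ((b.1, ((x, p) +` b.2)%mset) : fockBasis) >>
  | Posz 0 => form (hvec x) (wt b.1) *: << b >>
  | Posz p.+1 => (p.+1%:R * form (hvec x) (hvec x) * (b.2 (x, p))%:R)
                   *: << ((b.1, (b.2 `\ (x, p))%mset) : fockBasis) >>
  end.

Definition heis (h : cartan) (n : int) (v : fock) : fock :=
  h.1 *: lext (heis_basis true n) v + h.2 *: lext (heis_basis false n) v.

(* [opow A l p] and [oexp A p] are the coefficients of t^p in the l-th power
   and in the exponential of \sum_(i >= 1) A i t^i. *)
Fixpoint opow (A : nat -> fock -> fock) (l p : nat) (v : fock) : fock :=
  if l is l'.+1 then \sum_(i < p) A i.+1 (opow A l' (p - i.+1) v)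
  else if p == 0%N then v else 0.

Definition oexp (A : nat -> fock -> fock) (p : nat) (v : fock) : fock :=
  \sum_(l < p.+1) (l`!)%:R^-1 *: opow A l p v.

Definition shift (j : int) : fock -> fock :=
  lext (fun b => << (((b.1 + j)%R, b.2) : fockBasis) >>).

(* The modes of, for alpha = j (gamma + delta),
     exp(\sum_(i >= 1) alpha(-i) z^i / i) exp(-\sum_(i >= 1) alpha(i) z^(-i) / i)
       e^alpha z^(alpha(0)).
   On M_s(r), alpha(0) is the scalar <alpha, s delta + ...> = -2 s j. *)
Definition exp_field (j : int) (n : int) (v : fock) : fock :=
  let alpha : cartan := j%:~R *: (gam + del) in
  \sum_(q \in [set: nat]%classic)
    match q%:Z - n - 1 + 2 * s * j with
    | Posz p =>
        oexp (fun i => heis (i%:R^-1 *: alpha) (- i%:Z)) p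
          (oexp (fun i => heis (- i%:R^-1 *: alpha) i%:Z) q (shift j v))
    | Negz _ => 0
    end.

(* The n-th mode of the p-th divided derivative of A(z) = \sum_m A_m z^(-m-1). *)
Definition div_deriv (p : nat) (A : int -> fock -> fock) (n : int) (v : fock) :
    fock := binz F (p%:Z - n - 1) p *: A (n - p%:Z) v.

(* The n-th mode of the normally ordered product :A(z)B(z):. *)
Definition normal_ord (A B : int -> fock -> fock) (n : int) (v : fock) : fock :=
  \sum_(i \in [set: nat]%classic) A (- 1 - i%:Z) (B (n + i%:Z) v) +
  \sum_(i \in [set: nat]%classic) B (n - 1 - i%:Z) (A i%:Z v).

Definition field_basis (b : fockBasis) : int -> fock -> fock :=
  foldr (fun x B => normal_ord (div_deriv x.2 (heis (hvec x.1))) B)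
        (exp_field b.1) (enum_mset b.2).

(* The action of Pi(0) on M_s(r). *)
Definition Mact (a : fock) (n : int) (v : fock) : fock :=
  \sum_(b <- msupp a) a@_b *: field_basis b n v.

End Operators.

Definition Pi0 : vaData F := @VaData F fock (expv 0) (Mact 0 0).

Definition Pi0_gens : bpGens Pi0 :=
  let gm := heis 0 0 gam in let dl := heis 0 0 del in
  let one := expv 0 in let e := expv 1 in
  @BpGens F Pi0
    (- (1 / 2) *: dl (-1) one)
    ((1 / 4) *: gm (-1) (gm (-1) one) + (3 / 4) *: gm (-2) one
       - (1 / 4) *: dl (-1) (dl (-1) one))
    ((sqrtC 6 / 8 * (1 / 3)) *:
       (4 *: gm (-1) (gm (-1) (gm (-1) e)) + 6 *: gm (-1) (gm (-2) e)
          + 2 *: gm (-3) e))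
    (- (sqrtC 6 / 8) *: expv (-1)).

(* phi identifies W with the vertex subalgebra of Pi(0) generated by the four
   vectors above. *)
Definition realization (W : vaData F) (g : bpGens W) (phi : W -> Pi0) : Prop :=
  [/\ va_hom phi, injective phi, bp_map phi g = Pi0_gens &
      forall v : Pi0, (exists a, phi a = v) <-> va_generated (bp_set Pi0_gens) v].

(* M_s(r) as a module over W by restriction along phi. *)
Definition Mres (W : vaData F) (phi : W -> Pi0) (s : int) (r : F) :
  W -> int -> fock -> fock := fun a => Mact s r (phi a).

(* The L(0)-eigenspace of M_(-1)(r) for the eigenvalue -1/2 + m. *)
Definition Mcomp (W : vaData F) (g : bpGens W) (phi : W -> Pi0) (r : F)
    (m : nat) : set fock :=
  fun v => Lop (Mres phi (-1) r) g 0 v = (- (1 / 2) + m%:R) *: v.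

End HalfLattice.

(* Main.v *)
Require Import Defs.
From mathcomp Require Import all_boot all_order all_algebra.
From mathcomp Require Import zify ring.
From mathcomp Require Import finmap multiset.
From mathcomp.real_closed Require Import complex.
From mathcomp Require Import boolp classical_sets fsbigop reals.
From mathcomp Require Import monalg.

(* That M_s(r) is a module over Pi(0) amounts to the Borcherds identity for the
   fields defined by normally ordered products. It holds for pairs of
   generators (Heisenberg fields and the mutually commuting exponentials of
   multiples of the isotropic vector c = gamma + delta), and it is inherited by
   the products x_(n) a in either argument.

   On the basis vector b of exponent s delta + (r + j) c, L(0) acts by
   mdeg b - s^2 - s/2 - 2 (s + 1) (r + j), hence by mdeg b - 1/2 when s = -1,
   so that the L(0)-eigenspaces are the homogeneous components of the Fock
   space. Write t = r + j. On the lowest component, with basis v_j,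
     J(0) v_j = (t - 1) v_j,    G^-(0) v_j = - sqrt 6 / 8 v_(j-1),
     G^+(0) v_j = sqrt 6 / 24 * 4 t (2 t - 1) (4 t - 1) v_(j+1);
   no coefficient vanishes when 4 r is not an integer, and the J(0)-eigenvalues
   are distinct.

   A nonzero submodule contains a homogeneous u <> 0. Applying modes of J and
   G^- that lower the degree, one may assume that none of them acts nontrivially
   on u. Then exp(sum c(n) z^-n / n) fixes u, so all c(n) and delta(n), n > 0,
   kill u, and u has degree 0. Hence the submodule contains the lowest
   component, which generates M_(-1)(r) under the modes of J and G^-. *)

Set Implicit Arguments.
Unset Strict Implicit.
Unset Printing Implicit Defensive.

Import Order.TTheory GRing.Theory Num.Theory.
Local Open Scope ring_scope.

(** * Sums of finite support *)

(** The action is given by explicit fields, so the Borcherds identity has to be derived from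
    commutation relations. By Pascal's rule the identity for a pair reduces to its instances at
    [l = 0] (commutators) and at [m = 0], [l < 0] (iterates). Every basis vector of Pi(0) arises
    from an exponential by modes [x_(-p-1)] of Heisenberg fields, for which the iterate formula is
    in essence the definition of the fields. There remain pairs of exponentials: [<c, c> = 0] makes
    them commute, which settles [l = 0]; the case [l = -1] is multiplicativity, and lower [l] follow
    from [D e^(jc) = j c(-1) e^(jc)].

    The closure lemmas use the identity in the algebra as well as in the module, so the arguments
    run over interfaces ([free_field], [fock_space]) that are instantiated at both.

    The grading rests on a coincidence at s = -1: a basis field of exponent [jc] and Fock degree [d]
    acts on M_(-1)(r) like a field of weight [d - 2 j], and [d - 2 j] is also the weight of that
    vector in Pi(0) for the shifted conformal vector. *)

Definition fs (M : nmodType) (f : nat -> M) : M :=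
  \sum_(i \in [set: nat]%classic) f i.

(** A finite-support sum takes the default value 0 when the support is infinite, so additivity and
    linearity of [fs] fail in general; each rearrangement below therefore carries a proof of
    eventual vanishing. *)
Definition fin1 (M : nmodType) (f : nat -> M) :=
  exists N, forall i, (N <= i)%N -> f i = 0.

(** A bound on [i + k] expresses that the support in the plane is finite, in a form that is
    symmetric and directly usable both for exchanging sums and for regrouping along
    antidiagonals. *)
Definition fin2 (M : nmodType) (f : nat -> nat -> M) :=
  exists N, forall i k, (N <= i + k)%N -> f i k = 0.

Section FiniteSupportSums.
Variable M : nmodType.
Implicit Types (f g : nat -> M) (h : nat -> nat -> M).

Lemma fsE N f : (forall i, (N <= i)%N -> f i = 0) -> fs f = \sum_(i < N) f i.
Proof.
move=> hf; rewrite [RHS](@fsbig_ord _ _ +%R) /fs; apply/esym/fsbig_widen => //.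
by move=> i /= [_ /negP]; rewrite -leqNgt => /hf.
Qed.

Lemma eq_fs f g : f =1 g -> fs f = fs g.
Proof. by move=> /funext ->. Qed.

Lemma fs0 f : (forall i, f i = 0) -> fs f = 0.
Proof. by move=> hf; rewrite (@fsE 0) ?big_ord0 // => i _; apply: hf. Qed.

Lemma fs_single i0 f : (forall i, i != i0 -> f i = 0) -> fs f = f i0.
Proof.
move=> hf; rewrite (@fsE i0.+1) => [|i hi]; last first.
  by apply: hf; apply/eqP => e; rewrite e ltnn in hi.
by rewrite big_ord_recr /= big1 ?add0r // => i _; rewrite hf // ltn_eqF.
Qed.

Lemma fs_recl f : fin1 f -> fs f = f 0%N + fs (fun i => f i.+1).
Proof.
move=> [N hN]; rewrite (@fsE N.+1) => [|i /ltnW]; last exact: hN.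
by rewrite big_ord_recl (@fsE N) // => i hi; apply: hN; apply: leqW.
Qed.

Lemma fs_shift k f : (forall i, (i < k)%N -> f i = 0) -> fin1 f ->
  fs f = fs (fun i => f (k + i)%N).
Proof.
move=> hk [N hN]; rewrite (@fsE (k + N)) => [|i hi]; last first.
  by apply: hN; apply: leq_trans hi; apply: leq_addl.
rewrite (@fsE N) => [|i hi]; last first.
  by apply: hN; apply: leq_trans hi _; apply: leq_addl.
by rewrite big_split_ord /= big1 ?add0r // => i _; apply: hk.
Qed.

Lemma fsD f g : fin1 f -> fin1 g -> fs (fun i => f i + g i) = fs f + fs g.
Proof.
move=> [N hN] [K hK]; rewrite !(@fsE (maxn N K)) ?big_split //= => i.
- by rewrite geq_max => /andP[_ /hK].
- by rewrite geq_max => /andP[/hN].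
- by rewrite geq_max => /andP[/hN -> /hK ->]; rewrite addr0.
Qed.

Lemma fs_sum (I : eqType) (r : seq I) (F : I -> nat -> M) :
  (forall k, fin1 (F k)) ->
  fs (fun i => \sum_(k <- r) F k i) = \sum_(k <- r) fs (F k).
Proof.
move=> hF; elim: r => [|k r IH]; first by rewrite big_nil fs0 // => i; rewrite big_nil.
rewrite big_cons -IH -fsD //; first by apply: eq_fs => i; rewrite big_cons.
elim: r {IH} => [|j r [N hN]]; first by exists 0%N => i _; rewrite big_nil.
have [K hK] := hF j; exists (maxn N K) => i; rewrite geq_max => /andP[/hN h /hK e].
by rewrite big_cons e h addr0.
Qed.

Lemma fin1_fin2l h i : fin2 h -> fin1 (h i).
Proof. by move=> [N hN]; exists N => k hk; apply: hN; apply: leq_trans hk (leq_addl _ _). Qed.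

Lemma fin1_fin2r h k : fin2 h -> fin1 (fun i => h i k).
Proof. by move=> [N hN]; exists N => i hk; apply: hN; apply: leq_trans hk (leq_addr _ _). Qed.

Lemma fin1_fs h : fin2 h -> fin1 (fun i => fs (h i)).
Proof.
move=> [N hN]; exists N => i hi; apply: fs0 => k; apply: hN.
by apply: leq_trans hi (leq_addr _ _).
Qed.

Lemma fin2C h : fin2 h -> fin2 (fun k i => h i k).
Proof. by move=> [N hN]; exists N => i k hi; apply: hN; rewrite addnC. Qed.

(** How finiteness of double sums is obtained in practice: truncation of one field kills all rows
    from some point on, and in each single row another truncation bounds the columns. *)
Lemma fin2_rows h :
  (exists N, forall i, (N <= i)%N -> forall k, h i k = 0) ->
  (forall i, fin1 (h i)) -> fin2 h.
Proof.
move=> [N hN] hr.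
suff [K hK] : exists K, forall i, (i < N)%N -> forall k, (K <= k)%N -> h i k = 0.
  exists (N + K)%N => i k hik; have [/hN -> //|hi] := leqP N i.
  by apply: hK => //; lia.
elim: N {hN} => [|N [K hK]]; first by exists 0%N.
have [L hL] := hr N; exists (maxn K L) => i; rewrite ltnS leq_eqVlt => /orP[/eqP ->|hi] k.
  by rewrite geq_max => /andP[_ /hL].
by rewrite geq_max => /andP[hk _]; apply: hK.
Qed.

Lemma fin2_cols h :
  (exists N, forall k, (N <= k)%N -> forall i, h i k = 0) ->
  (forall k, fin1 (fun i => h i k)) -> fin2 h.
Proof. by move=> h1 h2; apply: fin2C; apply: fin2_rows. Qed.

Lemma exchange_fs h : fin2 h -> fs (fun i => fs (h i)) = fs (fun k => fs (h ^~ k)).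
Proof.
move=> [N hN].
have e1 i : fs (h i) = \sum_(k < N) h i k.
  by apply: fsE => k hk; apply: hN; apply: leq_trans hk (leq_addl _ _).
have e2 k : fs (h ^~ k) = \sum_(i < N) h i k.
  by apply: fsE => i hk; apply: hN; apply: leq_trans hk (leq_addr _ _).
rewrite (eq_fs e1) (eq_fs e2) !(@fsE N); first exact: exchange_big.
  move=> k hk; rewrite big1 // => i _; apply: hN.
  by apply: leq_trans hk (leq_addl _ _).
move=> i hi.
by rewrite big1 // => k _; apply: hN; apply: leq_trans hi (leq_addr _ _).
Qed.

(** Multiplying the expansions of [(x - y)^l] and [(x - y)^n] leads to convolutions, which are
    evaluated after regrouping by [u = i + k]. *)
Lemma fs_diag h : fin2 h ->
  fs (fun i => fs (h i)) = fs (fun u => \sum_(k < u.+1) h (u - k)%N k).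
Proof.
move=> [N hN].
have e1 i : fs (h i) = \sum_(k < N) h i k.
  by apply: fsE => k hk; apply: hN; apply: leq_trans hk (leq_addl _ _).
rewrite (eq_fs e1) !(@fsE N) => [| u hu | i hi]; last 2 first.
- by rewrite big1 // => k _; apply: hN; rewrite subnK //; case: k.
- by rewrite big1 // => k _; apply: hN; apply: leq_trans hi (leq_addr _ _).
have -> : \sum_(u < N) \sum_(k < u.+1) h (u - k)%N k =
    \sum_(u < N) \sum_(k < N | (k <= u)%N) h (u - k)%N k.
  apply: eq_bigr => u _; rewrite (big_ord_widen_cond N xpredT (fun k => h (u - k)%N k)) //.
rewrite exchange_big [RHS](exchange_big_dep xpredT) //=; apply: eq_bigr => k _.
have -> : \sum_(u < N | (k <= u)%N) h (u - k)%N k =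
    \sum_(i < N | (i < N - k)%N) h i k.
  rewrite -(big_ord_widen_cond N xpredT (h ^~ k)) ?leq_subr //=.
  rewrite -(big_mkord (fun u => (k <= u)%N) (fun u => h (u - k)%N k)).
  rewrite (@big_cat_nat _ _ _ k) //=; last by apply: ltnW; case: k.
  rewrite big_nat_cond big_pred0 => [|i]; last by apply/negP; lia.
  rewrite add0r -{1}[nat_of_ord k]add0n big_addn.
  rewrite (eq_bigl xpredT) => [|i]; last exact: leq_addl.
  by rewrite big_mkord; apply: eq_bigr => i _; rewrite addnK.
rewrite [LHS](bigID (fun i : 'I_N => (i < N - k)%N)) /= [X in _ + X]big1 ?addr0 // => i.
by move=> hi; apply: hN; lia.
Qed.

End FiniteSupportSums.

Section LinearMaps.
Variables (F : fieldType) (U M : lmodType F) (f : U -> M).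
Hypothesis lf : linear f.

Lemma lin0 : f 0 = 0.
Proof. by move: (lf 1 0 0); rewrite !scale1r addr0 => /eqP; rewrite -subr_eq0 opprD addrA subrr sub0r oppr_eq0 => /eqP. Qed.

Lemma linD u v : f (u + v) = f u + f v.
Proof. by rewrite -[u in LHS]scale1r lf scale1r. Qed.

Lemma linZ a u : f (a *: u) = a *: f u.
Proof. by rewrite -[a *: u]addr0 lf lin0 addr0. Qed.

Lemma linN u : f (- u) = - f u.
Proof. by rewrite -scaleN1r linZ scaleN1r. Qed.

Lemma linB u v : f (u - v) = f u - f v.
Proof. by rewrite linD linN. Qed.

Lemma lin_sum (I : Type) (r : seq I) (g : I -> U) :
  f (\sum_(i <- r) g i) = \sum_(i <- r) f (g i).
Proof. exact: (big_morph f linD lin0). Qed.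

Lemma lin_fs (g : nat -> U) : fin1 g -> f (fs g) = fs (fun i => f (g i)).
Proof.
move=> [N hN]; rewrite (fsE hN) lin_sum (@fsE _ N) // => i hi.
by rewrite hN ?lin0.
Qed.

Lemma fin1_lin (g : nat -> U) : fin1 g -> fin1 (fun i => f (g i)).
Proof. by move=> [N hN]; exists N => i hi; rewrite hN ?lin0. Qed.

End LinearMaps.

Section ScaledSums.
Variables (F : fieldType) (M : lmodType F).
Implicit Types (g h : nat -> M) (gg hh : nat -> nat -> M).

Lemma fin1Z (c : nat -> F) g : fin1 g -> fin1 (fun i => c i *: g i).
Proof. by move=> [N hN]; exists N => i hi; rewrite hN ?scaler0. Qed.

Lemma fin1D g h : fin1 g -> fin1 h -> fin1 (fun i => g i + h i).
Proof.
move=> [N hN] [K hK]; exists (maxn N K) => i; rewrite geq_max => /andP[h1 h'].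
by rewrite hN // hK // addr0.
Qed.

Lemma fin1N g : fin1 g -> fin1 (fun i => - g i).
Proof. by move=> [N hN]; exists N => i hi; rewrite hN ?oppr0. Qed.

Lemma fin1B g h : fin1 g -> fin1 h -> fin1 (fun i => g i - h i).
Proof. by move=> h1 h'; apply: fin1D => //; apply: fin1N. Qed.

Lemma fin2Z (c : nat -> nat -> F) gg : fin2 gg -> fin2 (fun i k => c i k *: gg i k).
Proof. by move=> [N hN]; exists N => i k hi; rewrite hN ?scaler0. Qed.

Lemma fin2D gg hh : fin2 gg -> fin2 hh -> fin2 (fun i k => gg i k + hh i k).
Proof.
move=> [N hN] [K hK]; exists (maxn N K) => i k; rewrite geq_max => /andP[h1 h'].
by rewrite hN // hK // addr0.
Qed.

Lemma fin2N gg : fin2 gg -> fin2 (fun i k => - gg i k).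
Proof. by move=> [N hN]; exists N => i k hi; rewrite hN ?oppr0. Qed.

Lemma fin2B gg hh : fin2 gg -> fin2 hh -> fin2 (fun i k => gg i k - hh i k).
Proof. by move=> h1 h'; apply: fin2D => //; apply: fin2N. Qed.

Lemma fsZ (c : F) g : fin1 g -> fs (fun i => c *: g i) = c *: fs g.
Proof.
move=> hg; rewrite (lin_fs (f := fun v => c *: v)) // => a u v.
by rewrite scalerDr !scalerA mulrC.
Qed.

Lemma fsN g : fin1 g -> fs (fun i => - g i) = - fs g.
Proof. by move=> hg; rewrite -scaleN1r -fsZ //; apply: eq_fs => i; rewrite scaleN1r. Qed.

Lemma fsB g h : fin1 g -> fin1 h -> fs (fun i => g i - h i) = fs g - fs h.
Proof. by move=> h1 h'; rewrite fsD ?fsN //; apply: fin1N. Qed.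

Lemma fs2D gg hh : fin2 gg -> fin2 hh ->
  fs (fun i => fs (fun k => gg i k + hh i k)) =
  fs (fun i => fs (gg i)) + fs (fun i => fs (hh i)).
Proof.
move=> h1 h'; rewrite -fsD; try exact: fin1_fs.
by apply: eq_fs => i; rewrite fsD //; apply: fin1_fin2l.
Qed.

Lemma fs2Z (c : F) gg : fin2 gg ->
  fs (fun i => fs (fun k => c *: gg i k)) = c *: fs (fun i => fs (gg i)).
Proof.
move=> h1; rewrite -fsZ; last exact: fin1_fs.
by apply: eq_fs => i; rewrite fsZ //; apply: fin1_fin2l.
Qed.

End ScaledSums.

(** * Binomial coefficients with integer upper entry *)

Section Binomials.
Variable F : numFieldType.
Implicit Types (m n l : int) (i k j t u : nat).
Local Notation binz := (@binz F).

Lemma factF_neq0 i : (i`!)%:R != 0 :> F.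
Proof. by rewrite pnatr_eq0 -lt0n fact_gt0. Qed.

Lemma binz0 m : binz m 0 = 1.
Proof. by rewrite /Defs.binz big_ord0 fact0 divr1. Qed.

Lemma binzS m i : i.+1%:R * binz m i.+1 = (m%:~R - i%:R) * binz m i.
Proof.
rewrite /Defs.binz big_ord_recr /= factS natrM.
have h1 := factF_neq0 i; have h2 : i.+1%:R != 0 :> F by rewrite pnatr_eq0.
move: h1 h2; move: (i`!%:R : F) (i.+1%:R : F) => a b h1 h2.
by field; rewrite h1 h2.
Qed.

Lemma binz1 m : binz m 1 = m%:~R.
Proof. by have := binzS m 0; rewrite binz0 mul1r mulr1 subr0. Qed.

Lemma binz_pascal m i : binz (m + 1) i.+1 = binz m i.+1 + binz m i.
Proof.
elim: i => [|i IH]; first by rewrite !binz1 binz0 intrD.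
have h2 k : k.+1%:R != 0 :> F by rewrite pnatr_eq0.
apply: (mulfI (h2 i.+1)); rewrite mulrDr !binzS {}IH intrD.
have e := binzS m i.
rewrite mulrDr; have -> : ((m%:~R + 1%:~R) - i.+1%:R) * binz m i = i.+1%:R * binz m i.+1 :> F.
  by rewrite e; congr (_ * _); rewrite -natr1; ring.
by rewrite -!natr1; ring.
Qed.

Lemma binz0S i : binz 0 i.+1 = 0.
Proof. by rewrite /Defs.binz big_ord_recl subrr !mul0r. Qed.

Lemma binz_nat k i : binz k i = 'C(k, i)%:R.
Proof.
elim: k i => [|k IH] [|i]; rewrite ?binz0 ?bin0 //; first exact: binz0S.
by rewrite -addn1 PoszD binz_pascal !IH addn1 binS natrD.
Qed.

(** Pascal's rule in [l] (the auxiliary [conv]) carries the identity one step up or down from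
    [l = 0]. Going down, [conv] gives the sum at [u + 1] only in terms of the one at [u], whence the
    second induction. *)
Lemma binz_vandermonde l n u :
  \sum_(k < u.+1) binz l (u - k) * binz n k = binz (l + n) u.
Proof.
have conv l' u' : \sum_(k < u'.+2) binz (l' + 1) (u'.+1 - k) * binz n k =
    \sum_(k < u'.+2) binz l' (u'.+1 - k) * binz n k +
    \sum_(k < u'.+1) binz l' (u' - k) * binz n k.
  rewrite big_ord_recr [X in _ = X + _]big_ord_recr /= subnn !binz0.
  rewrite -addrA [X in _ = _ + X]addrC addrA -big_split /=; congr (_ + _).
  apply: eq_bigr => k _; rewrite -mulrDl; congr (_ * _).
  have hk : (k <= u')%N by rewrite -ltnS.
  by rewrite subSn // binz_pascal.
have base u' : \sum_(k < u'.+1) binz 0 (u' - k) * binz n k = binz n u'.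
  rewrite big_ord_recr /= subnn binz0 mul1r big1 ?add0r // => k _.
  have : (0 < u' - k)%N by rewrite subn_gt0.
  by case: (u' - k)%N => // j _; rewrite binz0S mul0r.
elim/int_rect: l u => [|l IH|l IH] u; first by rewrite base add0r.
  rewrite intS addrC; case: u => [|u]; first by rewrite big_ord1 !binz0 mulr1.
  by rewrite conv !IH addrAC binz_pascal.
elim: u => [|u IHu]; first by rewrite big_ord1 !binz0 mulr1.
have := conv (- l.+1%:Z) u; rewrite IHu.
have -> : - l.+1%:Z + 1 = - l%:Z by lia.
rewrite IH => /eqP; rewrite -subr_eq => /eqP <-.
have -> : - l%:Z + n = (- l.+1%:Z + n) + 1 by lia.
by rewrite binz_pascal addrK.
Qed.

(** Both sides are [n (n-1) ... (n-k-j+1) / (k! j!)]; in particular the left side is symmetric in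
    [k] and [j]. *)
Lemma binz_mul n k j :
  binz n k * binz (n - k%:Z) j = binz n (k + j) * binz (k + j)%N k.
Proof.
rewrite binz_nat /Defs.binz big_split_ord /=.
have h1 := factF_neq0 k; have h2 := factF_neq0 j; have h3 := factF_neq0 (k + j).
have e : (k + j)`!%:R = 'C(k + j, k)%:R * (k`!%:R * j`!%:R) :> F.
  by rewrite -!natrM; have := bin_fact (leq_addr j k); rewrite addKn => <-.
have -> : \prod_(i < j) ((n - k%:Z)%:~R - i%:R) = \prod_(i < j) (n%:~R - (k + i)%:R) :> F.
  by apply: eq_bigr => i _; rewrite intrB natrD opprD addrA.
rewrite {}e mulf_eq0 negb_or in h3 *; case/andP: h3 => h3 _.
by field; rewrite h1 h2 h3.
Qed.

Lemma binz_mulC n k j :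
  binz n k * binz (n - k%:Z) j = binz n j * binz (n - j%:Z) k.
Proof.
rewrite !binz_mul addnC; congr (_ * _); rewrite !binz_nat; congr (_%:R).
by have := bin_sub (leq_addr k j); rewrite addKn.
Qed.

Lemma binz_nat_mul n k t : (t <= k)%N ->
  binz n k * binz k t = binz n t * binz (n - t%:Z) (k - t).
Proof. by move=> h; rewrite binz_mul subnKC. Qed.

Lemma binz_small k i : (k < i)%N -> binz k i = 0.
Proof. by move=> h; rewrite binz_nat bin_small. Qed.

(** The coefficients of [(x - y)^l] expanded in [x^(l-i) y^i], also for negative [l]; the expansion
    in [y^(l-i) x^i] has the additional factor [(-1)^l]. *)
Definition sb l i : F := (-1) ^ i * binz l i.

Lemma signD m n : (-1) ^ (m + n) = (-1) ^ m * (-1) ^ n :> F.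
Proof. by rewrite expfzDr // oppr_eq0 oner_eq0. Qed.

Lemma signB m n : (-1) ^ (m - n) = (-1) ^ m * (-1) ^ n :> F.
Proof. by rewrite signD; congr (_ * _); rewrite -exprz_inv invrN1. Qed.

Lemma sign_sq n : (-1) ^ n * (-1) ^ n = 1 :> F.
Proof. by rewrite -signB subrr. Qed.

Lemma sb0 l : sb l 0 = 1.
Proof. by rewrite /sb binz0 mulr1. Qed.

Lemma sb0S i : sb 0 i.+1 = 0.
Proof. by rewrite /sb binz0S mulr0. Qed.

Lemma sb_pascal l i : sb (l + 1) i.+1 = sb l i.+1 - sb l i.
Proof.
rewrite /sb binz_pascal mulrDr; congr (_ + _).
by rewrite intS signD expr1z mulN1r mulNr.
Qed.

Lemma sb_mul l n u k : (k <= u)%N ->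
  sb l (u - k) * sb n k = (-1) ^ u * (binz l (u - k) * binz n k).
Proof.
by move=> h; rewrite /sb -{3}(subnK h) PoszD signD; ring.
Qed.

Lemma sb_vandermonde l n u :
  \sum_(k < u.+1) sb l (u - k) * sb n k = sb (l + n) u.
Proof.
rewrite /sb -binz_vandermonde mulr_sumr; apply: eq_bigr => k _.
by rewrite sb_mul // -ltnS.
Qed.

(** In the closure lemmas a mode [x_(n-k)] or [x_(k)] is moved past a field of [b], which
    contributes [binz (n - k) t] or [binz k t] times a mode of [x_(t) b]. This lemma and the next
    sum these weights over [i + k = u]; what remains is one expansion of order [n + l - t], the
    order at which the identity for [x_(t) b] is assumed. *)
Lemma sb_conv_above l n t u :
  \sum_(k < u.+1) sb l (u - k) * sb n k * binz (n - k%:Z) t =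
  binz n t * sb (n + l - t%:Z) u.
Proof.
have -> : n + l - t%:Z = l + (n - t%:Z) by lia.
rewrite -sb_vandermonde mulr_sumr; apply: eq_bigr => k _.
by rewrite [RHS]mulrCA -mulrA; congr (_ * _); rewrite /sb -mulrA binz_mulC; ring.
Qed.

Lemma sb_conv_below l n t u :
  \sum_(k < u.+1) sb l (u - k) * sb n k * binz k t =
  if (t <= u)%N then sb n t * sb (n + l - t%:Z) (u - t) else 0.
Proof.
case: leqP => htu; last first.
  rewrite big1 // => k _; rewrite binz_small ?mulr0 //.
  by apply: leq_ltn_trans htu; rewrite -ltnS.
have -> : n + l - t%:Z = l + (n - t%:Z) by lia.
rewrite -sb_vandermonde mulr_sumr.
rewrite -(big_mkord xpredT (fun k => sb l (u - k) * sb n k * binz k t)).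
rewrite (@big_cat_nat _ _ _ t) //=; last exact: ltnW.
rewrite big_nat_cond big1 ?add0r => [|i /andP[/andP[_ hi] _]]; last first.
  by rewrite binz_small ?mulr0.
rewrite -{1}[t]add0n big_addn subSn // big_mkord; apply: eq_bigr => k _.
have hk : (k <= u - t)%N by rewrite -ltnS.
have -> : (u - (k + t) = u - t - k)%N by lia.
rewrite [RHS]mulrCA -mulrA; congr (_ * _).
rewrite /sb -mulrA binz_nat_mul ?leq_addl // addnK addnC PoszD signD; ring.
Qed.

End Binomials.

(** * The Borcherds identity and its closure properties *)

Section Borcherds.
Variable F : numFieldType.
Local Notation binz := (@binz F).
Local Notation sb := (@sb F).

Definition field (M : lmodType F) (A : int -> M -> M) : Prop :=
  (forall n, linear (A n)) /\
  forall w, exists N : int, forall n, N <= n -> A n w = 0.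

(* The two sides of the Borcherds identity of a module, on the pair [(a, b)];
   [br] only depends on the fields [A] and [B] of [a] and [b], and for [m = 0]
   it is the [n]-th mode of their [l]-th product. *)
Definition bl (V : vaData F) (M : lmodType F) (act : V -> int -> M -> M)
    (a b : V) (l m n : int) (w : M) : M :=
  fs (fun i : nat => binz m i *: act (nprod V a (l + i%:Z) b) (m + n - i%:Z) w).

Definition br (M : lmodType F) (A B : int -> M -> M) (l m n : int) (w : M) : M :=
  fs (fun i : nat => sb l i *:
    (A (m + l - i%:Z) (B (n + i%:Z) w) - (-1) ^ l *: B (n + l - i%:Z) (A (m + i%:Z) w))).

Definition borch_at (V : vaData F) (M : lmodType F) (act : V -> int -> M -> M)
    (a b : V) (l : int) : Prop :=
  forall m n w, bl act a b l m n w = br (act a) (act b) l m n w.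

Definition borch (V : vaData F) (M : lmodType F) (act : V -> int -> M -> M)
    (a b : V) : Prop := forall l, borch_at act a b l.

Section Fields.
Variables (M : lmodType F).
Implicit Types (A B C X : int -> M -> M).

Lemma field_fin A q w : field A -> fin1 (fun i : nat => A (q + i%:Z) w).
Proof.
case=> _ /(_ w)[N hN]; exists `|N - q|%N => i hi; apply: hN; lia.
Qed.

Lemma field_fin_comp A B (p : int -> int) q w : field A -> field B ->
  fin1 (fun i : nat => A (p i%:Z) (B (q + i%:Z) w)).
Proof.
move=> [lA _] fB; have [N hN] := field_fin q w fB; exists N => i hi.
by rewrite hN // (lin0 (lA _)).
Qed.

Lemma br_fin A B l m n w : field A -> field B ->
  fin1 (fun i : nat => sb l i *:
    (A (m + l - i%:Z) (B (n + i%:Z) w) - (-1) ^ l *: B (n + l - i%:Z) (A (m + i%:Z) w))).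
Proof.
move=> fA fB; apply: fin1Z; apply: fin1B.
  exact: (@field_fin_comp A B (fun z => m + l - z)).
by apply: fin1Z; exact: (@field_fin_comp B A (fun z => n + l - z)).
Qed.

Lemma br_lin A B l m n : field A -> field B -> linear (br A B l m n).
Proof.
move=> fA fB c u v; rewrite /br -(fsZ c (br_fin l m n u fA fB)).
rewrite -(fsD (fin1Z (fun=> c) (br_fin l m n u fA fB)) (br_fin l m n v fA fB)).
apply: eq_fs => i; rewrite (proj1 fA) (proj1 fB).
have e (x y : M) s : c *: (s *: x) + s *: y = s *: (c *: x + y).
  by rewrite scalerDr !scalerA mulrC.
rewrite {}e; congr (_ *: _); rewrite (proj1 fA) (proj1 fB).
by rewrite !scalerDr scalerN opprD addrACA !scalerA mulrC.
Qed.

Lemma br_field A B l m : field A -> field B -> field (br A B l m).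
Proof.
move=> fA fB; split=> [n|w]; first exact: br_lin.
have [NB hB] := proj2 fB w; have [i0 h0] := field_fin m w fA.
(* Only the finitely many [i < i0] give a nonzero [A (m + i) w], so a single bound on [n] serves
   them all. *)
have [N hN] : exists N : int, forall n, N <= n -> forall i : nat, (i < i0)%N ->
    B (n + l - i%:Z) (A (m + i%:Z) w) = 0.
  elim: i0 {h0} => [|i0 [N hN]]; first by exists 0.
  have [K hK] := proj2 fB (A (m + i0%:Z) w).
  exists (`|N| + `|K| + `|l| + i0%:Z) => n hn i; rewrite ltnS leq_eqVlt.
  by case/orP=> [/eqP ->|hi]; [apply: hK; lia|apply: hN; lia].
exists (`|N| + `|NB|) => n hn; apply: fs0 => i.
rewrite hB ?(lin0 (proj1 fA _)); last by lia.
have [/h0 ->|hi] := leqP i0 i; first by rewrite (lin0 (proj1 fB _)) scaler0 oppr0 addr0 scaler0.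
by rewrite hN ?scaler0 ?oppr0 ?addr0 ?scaler0 //; lia.
Qed.

Lemma br0E A B m n w : field A -> field B ->
  br A B 0 m n w = A m (B n w) - B n (A m w).
Proof.
move=> fA fB; rewrite /br (fs_single (i0 := 0%N)) => [|i]; last first.
  by case: i => // i _; rewrite sb0S scale0r.
by rewrite sb0 scale1r expr0z scale1r -[Posz 0]/(0 : int) !addr0 ?subr0.
Qed.

(* Pascal's rule, applied to [(x - y)^(l+1) = (x - y)^l (x - y)]. *)
Lemma br_pascal A B l m n w : field A -> field B ->
  br A B (l + 1) m n w = br A B l (m + 1) n w - br A B l m (n + 1) w.
Proof.
move=> fA fB; pose P (i : nat) := A (m + l + 1 - i%:Z) (B (n + i%:Z) w).
pose Q (i : nat) := (-1) ^ l *: B (n + l + 1 - i%:Z) (A (m + i%:Z) w).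
have fP : fin1 P by exact: (@field_fin_comp A B (fun z => m + l + 1 - z)).
have fQ : fin1 Q.
  by apply: fin1Z; exact: (@field_fin_comp B A (fun z => n + l + 1 - z)).
have fS (f : nat -> M) : fin1 f -> fin1 (fun i => f i.+1).
  by case=> N hN; exists N => i hi; apply: hN; apply: leqW.
transitivity (fs (fun i => sb (l + 1) i *: (P i + Q i))).
  apply: eq_fs => i; congr (_ *: (A _ _ + _)); first by lia.
  rewrite signD expr1z mulrN1 scaleNr opprK; congr (_ *: B _ _); lia.
have fPQ : fin1 (fun i => P i + Q i) by exact: fin1D.
have e1 : br A B l (m + 1) n w = fs (fun i => sb l i *: (P i - Q i.+1)).
  apply: eq_fs => i; congr (_ *: (A _ _ - _ *: B _ (A _ _))); lia.
have e2 : br A B l m (n + 1) w = fs (fun i => sb l i *: (P i.+1 - Q i)).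
  apply: eq_fs => i; congr (_ *: (A _ (B _ _) - _ *: B _ _)); lia.
rewrite e1 e2 -fsB; last 2 first.
- exact: fin1Z _ (fin1B fP (fS _ fQ)).
- exact: fin1Z _ (fin1B (fS _ fP) fQ).
rewrite fs_recl; last exact: (fin1Z _ fPQ).
transitivity (sb l 0 *: (P 0%N + Q 0%N) + (fs (fun i => sb l i.+1 *: (P i.+1 + Q i.+1))
    - fs (fun i => sb l i *: (P i.+1 + Q i.+1)))).
  rewrite !sb0; congr (_ + _); rewrite -fsB; last 2 first.
  - exact: fS (fin1Z _ fPQ).
  - exact: fin1Z _ (fin1D (fS _ fP) fQ) || exact: fin1Z _ (fS _ fPQ).
  by apply: eq_fs => i; rewrite sb_pascal scalerBl.
rewrite addrA -(fs_recl (f := fun i => sb l i *: (P i + Q i))); last exact: fin1Z _ fPQ.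
rewrite -fsB; last 2 first.
- exact: fin1Z _ fPQ.
- exact: fin1Z _ (fS _ fPQ).
apply: eq_fs => i; rewrite -!scalerBr; congr (_ *: _).
by rewrite [- (_ - _)]opprB [RHS]addrACA opprD [- Q _ - P _]addrC.
Qed.

End Fields.

Section Modules.
Variables (V : vaData F) (M : lmodType F) (act : V -> int -> M -> M).
Hypotheses (act_lin : forall n w, linear (fun a => act a n w))
  (act_field : forall a, field (act a)).
Hypotheses (V_lin : forall n w, linear (fun a => nprod V a n w))
  (V_field : forall a, field (nprod V a)).

Lemma bl_fin a b l m n w :
  fin1 (fun i : nat => binz m i *: act (nprod V a (l + i%:Z) b) (m + n - i%:Z) w).
Proof.
apply: fin1Z; have [N hN] := field_fin l b (V_field a); exists N => i hi.
by rewrite hN // (lin0 (act_lin _ _)).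
Qed.

Lemma bl0E a b l n w : bl act a b l 0 n w = act (nprod V a l b) n w.
Proof.
rewrite /bl (fs_single (i0 := 0%N)) => [|i]; last first.
  by case: i => // i _; rewrite binz0S scale0r.
by rewrite binz0 scale1r -[Posz 0]/(0 : int) add0r !addr0 ?subr0.
Qed.

Lemma bl_pascal a b l m n w :
  bl act a b (l + 1) m n w = bl act a b l (m + 1) n w - bl act a b l m (n + 1) w.
Proof.
pose P (i : nat) := act (nprod V a (l + i%:Z) b) (m + n + 1 - i%:Z) w.
have fP : fin1 P.
  have [N hN] := field_fin l b (V_field a); exists N => i hi.
  by rewrite /P hN // (lin0 (act_lin _ _)).
have -> : bl act a b l (m + 1) n w = fs (fun i => binz (m + 1) i *: P i).
  apply: eq_fs => i; congr (_ *: act _ _ _); lia.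
have -> : bl act a b l m (n + 1) w = fs (fun i => binz m i *: P i).
  apply: eq_fs => i; congr (_ *: act _ _ _); lia.
rewrite -(fsB (fin1Z _ fP) (fin1Z _ fP)).
rewrite fs_recl; last exact: fin1B (fin1Z _ fP) (fin1Z _ fP).
rewrite !binz0 subrr add0r; apply: eq_fs => i.
have e : binz (m + 1) i.+1 - binz m i.+1 = binz m i by rewrite binz_pascal addrC addKr.
rewrite -scalerBl e /P; congr (_ *: act (nprod V a _ b) _ w); lia.
Qed.

Lemma borch_at_succ a b l : borch_at act a b l -> borch_at act a b (l + 1).
Proof. by move=> h m n w; rewrite bl_pascal br_pascal // !h. Qed.

(** Pascal's rule is a recursion in [m] at order [l]: the values at [m + 1] and at [m] (with
    [n + 1]) differ by a term of order [l + 1]. It can be solved in both directions from [m = 0]. *)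
Lemma borch_at_pred a b l : borch_at act a b (l + 1) ->
  (forall n w, bl act a b l 0 n w = br (act a) (act b) l 0 n w) ->
  borch_at act a b l.
Proof.
move=> h h0; elim/int_rect => [|m IH|m IH] n w; first exact: h0.
  have := h m n w; rewrite bl_pascal br_pascal // IH => /subIr.
  by rewrite intS addrC.
have := h (- m.+1%:Z) (n - 1) w; rewrite bl_pascal br_pascal //.
have -> : - m.+1%:Z + 1 = - m%:Z by lia.
by rewrite IH subrK => /subrI.
Qed.

(** The commutator formula climbs to all [l >= 0]; the iterate formula is the slice [m = 0] required
    for each step down. *)
Lemma borch_intro a b : borch_at act a b 0 ->
  (forall (p : nat) n w,
     act (nprod V a (- p.+1%:Z) b) n w = br (act a) (act b) (- p.+1%:Z) 0 n w) ->
  borch act a b.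
Proof.
move=> h0 hn; elim/int_rect => [//|l IH|l IH].
  by rewrite intS addrC; apply: borch_at_succ.
apply: borch_at_pred => [|n w]; last by rewrite bl0E.
by have -> : - l.+1%:Z + 1 = - l%:Z by lia.
Qed.

Lemma borch_iter a b l n w : borch_at act a b l ->
  act (nprod V a l b) n w = br (act a) (act b) l 0 n w.
Proof. by move=> <-; rewrite bl0E. Qed.

Lemma borch_comm a b m n w : borch_at act a b 0 ->
  act a m (act b n w) - act b n (act a m w) =
  fs (fun i : nat => binz m i *: act (nprod V a i%:Z b) (m + n - i%:Z) w).
Proof.
move=> h; rewrite -(br0E m n w (act_field a) (act_field b)) -h; apply: eq_fs => i; congr (_ *: act (nprod V a _ b) _ w).
Qed.

End Modules.

End Borcherds.

(** * Closure of the Borcherds identity under products *)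

Section Closure.
Variable F : numFieldType.
Local Notation binz := (@binz F).
Local Notation sb := (@sb F).

Lemma sb_mul_sign n k i :
  sb n k * sb (n - k%:Z) i * (-1) ^ (n - k%:Z) = (-1) ^ n * sb n i * binz (n - i%:Z) k.
Proof.
rewrite /sb signB.
transitivity ((-1) ^ k%:Z * (-1) ^ k%:Z *
    ((-1) ^ n * ((-1) ^ i%:Z * (binz n k * binz (n - k%:Z) i)))).
  by ring.
by rewrite sign_sq mul1r binz_mulC; ring.
Qed.

Section Rearrangements.
Variable M : lmodType F.
Implicit Types (A B C D X : int -> M -> M) (P Q : nat -> M) (Z : nat -> nat -> M).

Lemma fs_sumZ n (c : nat -> nat -> F) P : fin1 P ->
  \sum_(k < n) fs (fun i => c k i *: P i) = fs (fun i => (\sum_(k < n) c k i) *: P i).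
Proof.
move=> fP; rewrite -(@fs_sum M 'I_n _ (fun k i => c k i *: P i)); last first.
  by move=> k; exact: fin1Z.
by apply: eq_fs => i; rewrite scaler_suml.
Qed.

Lemma fs_conv_above l n Z : fin2 Z ->
  fs (fun i => fs (fun k => (sb l i * sb n k) *:
    fs (fun t => binz (n - k%:Z) t *: Z t (i + k)%N))) =
  fs (fun t => binz n t *: fs (fun u => sb (n + l - t%:Z) u *: Z t u)).
Proof.
move=> fZ; rewrite fs_diag; last first.
  apply: fin2Z; have [N hN] := fZ; exists N => i k hi; apply: fs0 => t.
  by rewrite hN ?scaler0 //; lia.
transitivity (fs (fun u => fs (fun t => (binz n t * sb (n + l - t%:Z) u) *: Z t u))).
  apply: eq_fs => u.
  transitivity (\sum_(k < u.+1) fs (fun t =>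
      (sb l (u - k) * sb n k * binz (n - k%:Z) t) *: Z t u)).
    apply: eq_bigr => k _; rewrite -fsZ; last first.
      by apply: fin1Z; have := fin1_fin2r (u - k + k)%N fZ.
    by apply: eq_fs => t; rewrite subnK ?scalerA // -ltnS.
  rewrite (fs_sumZ _ (fun k t => sb l (u - k) * sb n k * binz (n - k%:Z) t)); last first.
    exact: fin1_fin2r fZ.
  by apply: eq_fs => t; rewrite sb_conv_above.
rewrite exchange_fs; last first.
  by apply: (fin2Z (fun u t => binz n t * sb (n + l - t%:Z) u)); apply: fin2C.
apply: eq_fs => t; rewrite -fsZ; last by apply: fin1Z; exact: fin1_fin2l.
by apply: eq_fs => u; rewrite scalerA.
Qed.

Lemma fs_conv_below l n Z : fin2 Z ->
  fs (fun i => fs (fun k => (sb l i * sb n k) *: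
    fs (fun t => binz k t *: Z t (i + k)%N))) =
  fs (fun t => sb n t *: fs (fun i => sb (n + l - t%:Z) i *: Z t (t + i)%N)).
Proof.
move=> fZ; rewrite fs_diag; last first.
  apply: fin2Z; have [N hN] := fZ; exists N => i k hi; apply: fs0 => t.
  by rewrite hN ?scaler0 //; lia.
pose c u t := if (t <= u)%N then sb n t * sb (n + l - t%:Z) (u - t) else 0.
transitivity (fs (fun u => fs (fun t => c u t *: Z t u))).
  apply: eq_fs => u.
  transitivity (\sum_(k < u.+1) fs (fun t =>
      (sb l (u - k) * sb n k * binz k t) *: Z t u)).
    apply: eq_bigr => k _; rewrite -fsZ; last first.
      by apply: fin1Z; have := fin1_fin2r (u - k + k)%N fZ.
    by apply: eq_fs => t; rewrite subnK ?scalerA // -ltnS.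
  rewrite (fs_sumZ _ (fun k t => sb l (u - k) * sb n k * binz k t)); last first.
    exact: fin1_fin2r fZ.
  by apply: eq_fs => t; rewrite sb_conv_below.
rewrite exchange_fs; last by apply: (fin2Z c); apply: fin2C.
apply: eq_fs => t; rewrite (fs_shift (k := t)); first last.
- by apply: fin1Z; exact: fin1_fin2l.
- by move=> i hi; rewrite /c leqNgt hi scale0r.
rewrite -fsZ; last first.
  have [N hN] := fin1_fin2l t fZ; exists N => i hi.
  by rewrite hN ?scaler0 //; lia.
by apply: eq_fs => i; rewrite scalerA /c leq_addr addKn.
Qed.

(** By Vandermonde the weights collapse to [binz (m + i) v] for one ordering and
    [binz (m + n - i) v] for the other. These are the weights of the [v]-th term of [bl] with
    [m + i] and [m + n - i] in place of [m]. *)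
Lemma br_diag X D n m e v w : field X -> field D ->
  \sum_(k < v.+1) (binz m (v - k) * sb n k) *: br X D (n - k%:Z) 0 (e + k%:Z) w =
  fs (fun i : nat => sb n i *: (binz (m + i%:Z) v *: X (n - i%:Z) (D (e + i%:Z) w)
    - (-1) ^ n *: (binz (m + n - i%:Z) v *: D (e + n - i%:Z) (X i%:Z w)))).
Proof.
move=> fX fD; pose P (i : nat) := X (n - i%:Z) (D (e + i%:Z) w).
pose Q (i : nat) := D (e + n - i%:Z) (X i%:Z w).
have fP : fin1 P by exact: (@field_fin_comp _ _ X D (fun z => n - z)).
have fQ : fin1 Q.
  have := @field_fin_comp _ _ D X (fun z => e + n - z) 0 w fD fX.
  by case=> N hN; exists N => i hi; rewrite -(hN i hi) add0r.
pose c k i := binz m (v - k) * (sb n i * binz i k).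
pose d k i := binz m (v - k) * ((-1) ^ n * sb n i * binz (n - i%:Z) k).
transitivity (\sum_(k < v.+1) (fs (fun i => c k i *: P i) - fs (fun i => d k i *: Q i))).
  apply: eq_bigr => k _; rewrite (fs_shift (k := k) (f := fun i => c k i *: P i)); first last.
  - exact: fin1Z.
  - by move=> i hi; rewrite /c binz_small ?mulr0 ?scale0r.
  rewrite -fsB; first last.
  - exact: fin1Z.
  - by have [N hN] := fP; exists N => i hi; rewrite hN ?scaler0 //; lia.
  rewrite /br -fsZ; last exact: (br_fin _ _ _ _ fX fD).
  apply: eq_fs => i; rewrite scalerA scalerBr scalerA /P /Q; congr (_ *: X _ (D _ _) - _ *: D _ (X _ _)).
  - rewrite /c -mulrA; congr (_ * _); rewrite /sb PoszD signD.
    by rewrite -[RHS]mulrA -binz_mul; ring.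
  - lia.
  - by rewrite PoszD; lia.
  - by rewrite /d -sb_mul_sign; ring.
  - lia.
rewrite sumrB.
rewrite (fs_sumZ _ c) // (fs_sumZ _ d) // -fsB; try exact: fin1Z.
apply: eq_fs => i; rewrite scalerBr !scalerA /c /d; congr (_ *: _ - _ *: _).
  under eq_bigr do rewrite mulrCA; rewrite -mulr_sumr; congr (_ * _).
  by rewrite binz_vandermonde.
under eq_bigr do rewrite mulrCA; rewrite -mulr_sumr.
by rewrite binz_vandermonde addrA; ring.
Qed.

End Rearrangements.
End Closure.

Section ClosureLemmas.
Variable F : numFieldType.
Local Notation binz := (@binz F).
Local Notation sb := (@sb F).
Variables (V : vaData F) (M : lmodType F) (act : V -> int -> M -> M).
Hypotheses (act_lin : forall n w, linear (fun a => act a n w))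
  (act_field : forall a, field (act a)).
Hypotheses (V_lin : forall n w, linear (fun a => nprod V a n w))
  (V_field : forall a, field (nprod V a)).
Local Notation "a ._( n )" := (nprod V a n) (at level 2, format "a ._( n )").

Lemma fin1_comm a b p q r w : fin1 (fun i : nat =>
  binz p i *: act (a._(q + i%:Z) b) (r - i%:Z) w).
Proof.
apply: fin1Z; have [N hN] := field_fin q b (V_field a); exists N => i hi.
by rewrite hN // (lin0 (act_lin _ _)).
Qed.

(* [sum_t C(m,t) x_(n) (a_(l+t) b)] *)
Lemma bl_nested x a b l m n q w :
  (forall d n' q w, act (x._(n') d) q w = br (act x) (act d) n' 0 q w) ->
  fs (fun t : nat => fs (fun k : nat => (binz m t * sb n k) *:
     act (x._(n - k%:Z) (a._(l + (t + k)%N%:Z) b)) (m + q - t%:Z) w)) =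
  fs (fun k : nat => sb n k *: (act x (n - k%:Z) (bl act a b l (m + k%:Z) q w)
    - (-1) ^ n *: bl act a b l (m + n - k%:Z) q (act x k%:Z w))).
Proof.
move=> hx; have [N hN] := field_fin l b (V_field a).
pose D v := act (a._(l + v%:Z) b).
have D0 v : (N <= v)%N -> forall n w, D v n w = 0.
  by move=> hv n' w'; rewrite /D hN // (lin0 (act_lin _ _)).
rewrite fs_diag; last first.
  exists N => i k hi; rewrite hN // (lin0 (proj1 (V_field x) _)).
  by rewrite (lin0 (act_lin _ _)) scaler0.
pose P v i := sb n i *: (binz (m + i%:Z) v *: act x (n - i%:Z) (D v (m + q - v%:Z + i%:Z) w)
    - (-1) ^ n *: (binz (m + n - i%:Z) v *: D v (m + q - v%:Z + n - i%:Z) (act x i%:Z w))).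
transitivity (fs (fun v => fs (P v))).
  apply: eq_fs => v; rewrite /P -br_diag //; last exact: act_field.
  apply: eq_bigr => k _; have hk : (k <= v)%N by rewrite -ltnS.
  rewrite hx subnK //.
  by have -> : m + q - (v - k)%N%:Z = m + q - v%:Z + k%:Z by lia.
rewrite exchange_fs; last first.
  apply: fin2_rows => [|v].
    exists N => v hv i; rewrite /P !D0 // (lin0 (proj1 (act_field x) _)).
    by rewrite !scaler0 subr0 scaler0.
  apply: fin1Z; apply: fin1B.
    apply: fin1Z; exact: (@field_fin_comp _ _ (act x) (D v) (fun z => n - z) _ _ (act_field _) (act_field _)).
  apply: (fin1Z (fun=> (-1) ^ n)); apply: fin1Z.
  have := @field_fin_comp _ _ (D v) (act x) (fun z => m + q - v%:Z + n - z) 0 w (act_field _) (act_field _).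
  by case=> K hK; exists K => i hi; rewrite -(hK i hi) add0r.
have fD c e w' : fin1 (fun v => binz c v *: D v (e - v%:Z) w').
  by apply: fin1Z; exists N => v hv; rewrite D0.
apply: eq_fs => k; rewrite /bl (lin_fs (proj1 (act_field x) _)); last exact: fD.
rewrite -(fsZ _ (fD _ _ _)) -fsB; last 2 first.
- by have [K hK] := fD (m + k%:Z) (m + k%:Z + q) w; exists K => v /hK ->; rewrite (lin0 (proj1 (act_field x) _)).
- exact: (fin1Z (fun=> (-1) ^ n) (fD _ _ _)).
rewrite -fsZ; last first.
  apply: fin1B; last exact: (fin1Z (fun=> (-1) ^ n) (fD _ _ _)).
  by have [K hK] := fD (m + k%:Z) (m + k%:Z + q) w; exists K => v /hK ->; rewrite (lin0 (proj1 (act_field x) _)).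
apply: eq_fs => v; rewrite /P (linZ (proj1 (act_field x) _)) /D.
by congr (_ *: (_ *: act x _ (act _ _ _) - _ *: (_ *: act _ _ _))); lia.
Qed.

(** Both sides are expanded by the iterate formula of [x], in the algebra on the left and in the
    module on the right. On the left the modes of [x] end up outside those of [a] and [b]; on the
    right some stand between them. Moving these outward costs commutators of [x] with [b], which add
    up to the identity for [a] and the [x_(t) b]. *)
Lemma borch_closure1 x a b l n :
  (forall l', (x._(n) a)._(l') b = br (nprod V x) (nprod V a) n 0 l' b) ->
  (forall d n' q w, act (x._(n') d) q w = br (act x) (act d) n' 0 q w) ->
  borch_at act x b 0 ->
  borch_at act a b l ->
  (forall t : nat, borch_at act a (x._(t%:Z) b) (n + l - t%:Z)) ->
  borch_at act (x._(n) a) b l.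
Proof.
move=> hV hx hxb hab hat m q w.
pose X := act x; pose A := act a; pose B := act b; pose XB t := act (x._(t%:Z) b).
have fXB t : field (XB t) by exact: act_field.
have fx : field X by exact: act_field.
have fa : field A by exact: act_field.
have fb : field B by exact: act_field.
have [N hN] := field_fin 0 b (V_field x).
have XB0 t : (N <= t)%N -> forall n w, XB t n w = 0.
  by move=> ht n' w'; rewrite /XB -[t%:Z]add0r hN // (lin0 (act_lin _ _)).
have comm p r w' : X p (B r w') - B r (X p w') =
    fs (fun t : nat => binz p t *: XB t (p + r - t%:Z) w').
  exact: borch_comm.
have fZ1 : fin2 (fun t u => A (n + m + l - u%:Z) (XB t (q + u%:Z - t%:Z) w)).
  apply: fin2_rows => [|t].
    by exists N => t ht u; rewrite XB0 // (lin0 (proj1 fa _)).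
  have := @field_fin_comp _ _ A (XB t) (fun z => n + m + l - z) (q - t%:Z) w fa (fXB t).
  by case=> K hK; exists K => u /hK; have -> : q - t%:Z + u%:Z = q + u%:Z - t%:Z by lia.
have fZ2 : fin2 (fun t u => XB t (n + q + l - u%:Z - t%:Z) (A (m + u%:Z) w)).
  apply: fin2_rows => [|t]; first by exists N => t ht u; rewrite XB0.
  exact: (@field_fin_comp _ _ (XB t) A (fun z => n + q + l - z - t%:Z)).
(* The right side has the orderings X A B, A X B, B X A and B A X. In [Gb] and [Gc] the mode of [x]
   has been moved outermost, and [G] collects the four terms of this kind. *)
pose Fa i k := X (n - k%:Z) (A (m + l - i%:Z + k%:Z) (B (q + i%:Z) w)).
pose Fb i k := A (n + m + l - i%:Z - k%:Z) (X k%:Z (B (q + i%:Z) w)).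
pose Fc i k := B (q + l - i%:Z) (X (n - k%:Z) (A (m + i%:Z + k%:Z) w)).
pose Fd i k := B (q + l - i%:Z) (A (n + m + i%:Z - k%:Z) (X k%:Z w)).
pose Gc i k := X (n - k%:Z) (B (q + l - i%:Z) (A (m + i%:Z + k%:Z) w)).
pose Gb i k := A (n + m + l - i%:Z - k%:Z) (B (q + i%:Z) (X k%:Z w)).
pose s i k := sb l i * sb n k.
pose G i k := Fa i k - (-1) ^ n *: Gb i k - (-1) ^ l *: Gc i k + ((-1) ^ n * (-1) ^ l) *: Fd i k.
(* [H1] and [H2] are the commutators of [X] and [B] left behind by [Fb] and [Fc]; apart from the
   binomial weights they depend on [i + k] only, as the convolution lemmas require. *)
pose H1 (i k : nat) := fs (fun t => binz k t *: A (n + m + l - (i + k)%N%:Z) (XB t (q + (i + k)%N%:Z - t%:Z) w)).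
pose H2 (i k : nat) := fs (fun t => binz (n - k%:Z) t *: XB t (n + q + l - (i + k)%N%:Z - t%:Z) (A (m + (i + k)%N%:Z) w)).
have fFa : fin2 Fa.
  apply: fin2_rows.
    have [K hK] := field_fin q w fb; exists K => i hi k.
    by rewrite /Fa hK // (lin0 (proj1 fa _)) (lin0 (proj1 fx _)).
  by move=> i; exact: (@field_fin_comp _ _ X A (fun z => n - z)).
have fGb : fin2 Gb.
  apply: fin2_cols.
    have [K hK] := field_fin 0 w fx; exists K => k /hK.
    by rewrite add0r => e i; rewrite /Gb e (lin0 (proj1 fb _)) (lin0 (proj1 fa _)).
  by move=> k; exact: (@field_fin_comp _ _ A B (fun z => n + m + l - z - k%:Z)).
have fGc : fin2 Gc.
  have [K hK] := field_fin m w fa; exists K => i k hik.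
  have e : A (m + i%:Z + k%:Z) w = 0 by rewrite -addrA; exact: hK.
  by rewrite /Gc e (lin0 (proj1 fb _)) (lin0 (proj1 fx _)).
have fFd : fin2 Fd.
  apply: fin2_cols.
    have [K hK] := field_fin 0 w fx; exists K => k /hK.
    by rewrite add0r => e i; rewrite /Fd e (lin0 (proj1 fa _)) (lin0 (proj1 fb _)).
  move=> k; have [K hK] := @field_fin_comp _ _ B A (fun z => q + l - z) (n + m - k%:Z) (X k%:Z w) fb fa.
  exists K => i /hK e; rewrite /Fd -[RHS]e; congr (B _ (A _ _)); lia.
have fG : fin2 G.
  rewrite /G; apply: fin2D; last exact: (fin2Z (fun _ _ => (-1) ^ n * (-1) ^ l)).
  apply: fin2B; last exact: (fin2Z (fun _ _ => (-1) ^ l)).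
  by apply: fin2B => //; exact: (fin2Z (fun _ _ => (-1) ^ n)).
have fH1 : fin2 H1.
  have [K hK] := fZ1; exists K => i k hi; apply: fs0 => t.
  by rewrite hK ?scaler0 //; lia.
have fH2 : fin2 H2.
  have [K hK] := fZ2; exists K => i k hi; apply: fs0 => t.
  by rewrite hK ?scaler0 //; lia.
have Fb_eq i k : Fb i k = Gb i k + H1 i k.
  have e := comm k%:Z (q + i%:Z) w.
  have {}e : X k%:Z (B (q + i%:Z) w) = B (q + i%:Z) (X k%:Z w) +
      fs (fun t : nat => binz k%:Z t *: XB t (k%:Z + (q + i%:Z) - t%:Z) w).
    by rewrite -e [RHS]addrC subrK.
  rewrite /Fb /Gb e.
  rewrite (linD (proj1 fa _)); congr (_ + _); rewrite (lin_fs (proj1 fa _)); last first.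
    by apply: fin1Z; exists N => t ht; rewrite XB0.
  apply: eq_fs => t; rewrite (linZ (proj1 fa _)).
  by congr (_ *: A _ (XB t _ w)); lia.
have Fc_eq i k : Fc i k = Gc i k - H2 i k.
  have e := comm (n - k%:Z) (q + l - i%:Z) (A (m + i%:Z + k%:Z) w).
  have -> : H2 i k = Gc i k - Fc i k.
    rewrite /Gc /Fc e; apply: eq_fs => t.
    by congr (_ *: XB t _ (A _ w)); lia.
  by rewrite opprB addrC subrK.
have eR : br (act (x._(n) a)) B l m q w =
    fs (fun i => fs (fun k => s i k *: (G i k - (-1) ^ n *: H1 i k + (-1) ^ l *: H2 i k))).
  apply: eq_fs => i; rewrite !hx -/X -/A.
  have fXA p r u := br_fin n p r u fx fa.
  have fBXA r r' u : fin1 (fun k : nat => B r (sb n k *: (X (0 + n - k%:Z) (A (r' + k%:Z) u) -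
     (-1) ^ n *: A (r' + n - k%:Z) (X (0 + k%:Z) u)))).
    by have [K hK] := fXA 0 r' u; exists K => k /hK ->; rewrite (lin0 (proj1 fb _)).
  rewrite /br (lin_fs (proj1 fb _)) // -(fsZ _ (fBXA _ _ _)) -fsB //; last exact: (fin1Z (fun=> (-1) ^ l)).
  rewrite -fsZ; last by apply: fin1B => //; exact: (fin1Z (fun=> (-1) ^ l)).
  apply: eq_fs => k; rewrite (linZ (proj1 fb _)) (linB (proj1 fb _)) (linZ (proj1 fb _)).
  rewrite [(-1) ^ l *: (sb n k *: _)]scalerA [_ * sb n k]mulrC -[in X in _ - X]scalerA -scalerBr scalerA.
  congr (_ *: _); rewrite !add0r.
  have -> : X (n - k%:Z) (A (m + l - i%:Z + k%:Z) (B (q + i%:Z) w)) = Fa i k by [].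
  have -> : A (m + l - i%:Z + n - k%:Z) (X k%:Z (B (q + i%:Z) w)) = Fb i k.
    by rewrite /Fb; congr (A _ _); lia.
  have -> : B (q + l - i%:Z) (X (n - k%:Z) (A (m + i%:Z + k%:Z) w)) = Fc i k by [].
  have -> : B (q + l - i%:Z) (A (m + i%:Z + n - k%:Z) (X k%:Z w)) = Fd i k.
    by rewrite /Fd; congr (B _ (A _ _)); lia.
  rewrite Fb_eq Fc_eq /G !(scalerBr, scalerDr) scalerA [(-1) ^ l * _]mulrC.
  move: (Fa i k) ((-1) ^ n *: Gb i k) ((-1) ^ l *: Gc i k) => u1 u2 u3.
  move: (_ *: Fd i k) ((-1) ^ n *: H1 i k) ((-1) ^ l *: H2 i k) => u4 u5 u6.
  by rewrite !(opprD, opprK, addrA) [LHS](ACl (1*2*4*6*3*5)).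
(* On the left, the products [x_(n-k) (a_(j) b)] give [G] through the identity for [a] and [b], and
   the products [a_(j) (x_(k) b)] give the identity for [a] and [x_(k) b] at order [n + l - k]. *)
have eL : bl act (x._(n) a) b l m q w =
    fs (fun i => fs (fun k => s i k *: G i k)) -
    (-1) ^ n *: fs (fun k => sb n k *: br A (XB k) (n + l - k%:Z) m q w).
  rewrite /bl (eq_fs (g := fun t : nat => fs (fun k : nat =>
      (binz m t * sb n k) *: act (x._(n - k%:Z) (a._(l + (t + k)%N%:Z) b)) (m + q - t%:Z) w +
      - (-1) ^ n *: ((binz m t * sb n k) *: act (a._(n + l - k%:Z + t%:Z) (x._(k%:Z) b)) (m + q - t%:Z) w)))); last first.
    move=> t; rewrite hV /br (lin_fs (act_lin _ _)); last exact: (br_fin _ _ _ _ (V_field x) (V_field a)).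
    rewrite -fsZ; last first.
      apply: (fin1_lin (act_lin (m + q - t%:Z) w)).
      exact: (br_fin _ _ _ _ (V_field x) (V_field a)).
    apply: eq_fs => k; rewrite (linZ (act_lin _ _)) (linB (act_lin _ _)) (linZ (act_lin _ _)).
    rewrite scaleNr !add0r [(-1) ^ n *: (_ *: _)]scalerA [(-1) ^ n * _]mulrC -[in RHS](scalerA _ ((-1) ^ n)) -scalerBr scalerA.
    by congr (_ *: (act (x._(_) (a._(_) b)) _ w - _ *: act (a._(_) (x._(_) b)) _ w)); lia.
  have fP : fin2 (fun t k : nat => (binz m t * sb n k) *:
      act (x._(n - k%:Z) (a._(l + (t + k)%N%:Z) b)) (m + q - t%:Z) w).
    have [K hK] := field_fin l b (V_field a).
    exists K => t k hi; rewrite hK // (lin0 (proj1 (V_field x) _)).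
    by rewrite (lin0 (act_lin _ _)) scaler0.
  have fQ : fin2 (fun t k : nat => (binz m t * sb n k) *:
      act (a._(n + l - k%:Z + t%:Z) (x._(k%:Z) b)) (m + q - t%:Z) w).
    apply: fin2_cols.
      exists N => k hk t.
      have e : x._(k%:Z) b = 0 by rewrite -[k%:Z]add0r; exact: hN.
      by rewrite e (lin0 (proj1 (V_field a) _)) (lin0 (act_lin _ _)) scaler0.
    move=> k; apply: fin1Z; have [K hK] := field_fin (n + l - k%:Z) (x._(k%:Z) b) (V_field a).
    by exists K => t /hK ->; rewrite (lin0 (act_lin _ _)).
  have fQ' : fin2 (fun t k : nat => - (-1) ^ n *: ((binz m t * sb n k) *:
      act (a._(n + l - k%:Z + t%:Z) (x._(k%:Z) b)) (m + q - t%:Z) w)).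
    exact: (fin2Z (fun _ _ => - (-1) ^ n)).
  rewrite (fs2D fP fQ') (fs2Z (- (-1) ^ n) fQ) (bl_nested a b l m n q w hx) scaleNr; congr (_ - _ *: _).
    transitivity (fs (fun k => fs (fun i => s i k *: G i k))); last first.
      by rewrite [RHS]exchange_fs //; exact: fin2Z.
    apply: eq_fs => k; rewrite !hab /br -/X -/A -/B.
    have fAB p r u := br_fin l p r u fa fb.
    rewrite (lin_fs (proj1 fx _)) //.
    have fX p r p' u : fin1 (fun i : nat => X p (sb l i *: (A (r + l - i%:Z) (B (p' + i%:Z) u) -
        (-1) ^ l *: B (p' + l - i%:Z) (A (r + i%:Z) u)))).
      by apply: (fin1_lin (proj1 fx p)); exact: fAB.
    rewrite -(fsZ _ (fAB _ _ _)) -fsB //; last exact: (fin1Z (fun=> (-1) ^ n)).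
    rewrite -fsZ; last by apply: fin1B => //; exact: (fin1Z (fun=> (-1) ^ n)).
    apply: eq_fs => i; rewrite (linZ (proj1 fx _)) (linB (proj1 fx _)) (linZ (proj1 fx _)).
    rewrite [(-1) ^ n *: (sb l i *: _)]scalerA [_ * sb l i]mulrC -[in X in _ - X]scalerA -scalerBr scalerA.
    rewrite [sb n k * _]mulrC; congr (_ *: _).
    have -> : X (n - k%:Z) (A (m + k%:Z + l - i%:Z) (B (q + i%:Z) w)) = Fa i k.
      by rewrite /Fa; congr (X _ (A _ _)); lia.
    have -> : X (n - k%:Z) (B (q + l - i%:Z) (A (m + k%:Z + i%:Z) w)) = Gc i k.
      by rewrite /Gc; congr (X _ (B _ (A _ _))); lia.
    have -> : A (m + n - k%:Z + l - i%:Z) (B (q + i%:Z) (X k%:Z w)) = Gb i k.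
      by rewrite /Gb; congr (A _ _); lia.
    have -> : B (q + l - i%:Z) (A (m + n - k%:Z + i%:Z) (X k%:Z w)) = Fd i k.
      by rewrite /Fd; congr (B _ (A _ _)); lia.
    rewrite /G scalerBr scalerA.
    by rewrite !(opprD, opprK, addrA) [LHS](ACl (1*3*2*4)).
  rewrite exchange_fs //; apply: eq_fs => k; rewrite -hat /bl -fsZ; last first.
    exact: fin1_comm.
  by apply: eq_fs => t; rewrite [RHS]scalerA mulrC.
have eH1 : fs (fun i => fs (fun k => s i k *: H1 i k)) =
  fs (fun t => sb n t *: fs (fun i => sb (n + l - t%:Z) i *:
     A (n + m + l - (t + i)%N%:Z) (XB t (q + (t + i)%N%:Z - t%:Z) w))).
  exact: (fs_conv_below l n fZ1).
have eH2 : fs (fun i => fs (fun k => s i k *: H2 i k)) =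
  fs (fun t => binz n t *: fs (fun u => sb (n + l - t%:Z) u *:
     XB t (n + q + l - u%:Z - t%:Z) (A (m + u%:Z) w))).
  exact: (fs_conv_above l n fZ2).

have {}eR : br (act (x._(n) a)) B l m q w = fs (fun i => fs (fun k => s i k *: G i k +
    (- (-1) ^ n *: (s i k *: H1 i k) + (-1) ^ l *: (s i k *: H2 i k)))).
  have e (u v z : M) (c d d' : F) :
      c *: (u - d *: v + d' *: z) = c *: u + (- d *: (c *: v) + d' *: (c *: z)).
    rewrite scalerDr scalerBr scaleNr -addrA.
    by congr (_ + (- _ + _)); rewrite !scalerA mulrC.
  by rewrite eR; apply: eq_fs => i; apply: eq_fs => k; exact: (e (G i k) (H1 i k) (H2 i k)).
rewrite eL eR.
have fs1 : fin2 (fun i k => s i k *: H1 i k) by exact: fin2Z.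
have fs2 : fin2 (fun i k => s i k *: H2 i k) by exact: fin2Z.
have fs1' := fin2Z (fun _ _ => - (-1) ^ n) fs1.
have fs2' := fin2Z (fun _ _ => (-1) ^ l) fs2.
rewrite (fs2D (fin2Z s fG) (fin2D fs1' fs2')) (fs2D fs1' fs2'); congr (_ + _).
rewrite (fs2Z (- (-1) ^ n) fs1) (fs2Z ((-1) ^ l) fs2) eH1 eH2.
have f1 t : fin1 (fun i : nat => sb (n + l - t%:Z) i *: A (m + (n + l - t%:Z) - i%:Z) (XB t (q + i%:Z) w)).
  by apply: fin1Z; exact: (@field_fin_comp _ _ A (XB t) (fun z => m + (n + l - t%:Z) - z)).
have f2 t : fin1 (fun i : nat => sb (n + l - t%:Z) i *: XB t (q + (n + l - t%:Z) - i%:Z) (A (m + i%:Z) w)).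
  by apply: fin1Z; exact: (@field_fin_comp _ _ (XB t) A (fun z => q + (n + l - t%:Z) - z)).
(* The sign [(-1)^l] equals [(-1)^n (-1)^t (-1)^(n+l-t)]: the last factor is the one in [br] at
   order [n + l - t], and [(-1)^t] turns [binz n t] into [sb n t]. *)
have -> : (-1) ^ l *: fs (fun t => binz n t *: fs (fun u => sb (n + l - t%:Z) u *:
     XB t (n + q + l - u%:Z - t%:Z) (A (m + u%:Z) w))) =
  (-1) ^ n *: fs (fun t => sb n t *: ((-1) ^ (n + l - t%:Z) *: fs (fun u => sb (n + l - t%:Z) u *:
     XB t (q + (n + l - t%:Z) - u%:Z) (A (m + u%:Z) w)))).
  rewrite -!fsZ; last 2 first.
  - apply: fin1Z; exists N => t ht; rewrite fs0 ?scaler0 // => u.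
    by rewrite XB0 ?scaler0.
  - by apply: fin1Z; exists N => t ht; rewrite fs0 // => u; rewrite XB0 ?scaler0.
  apply: eq_fs => t; rewrite !scalerA; congr (_ *: _).
    rewrite /sb signB signD.
    transitivity (((-1) ^ n * (-1) ^ n) * ((-1) ^ t%:Z * (-1) ^ t%:Z) * ((-1) ^ l * binz n t)).
      by rewrite !sign_sq !mul1r.
    by ring.
  by apply: eq_fs => u; congr (_ *: XB t _ _); lia.
rewrite scaleNr -scalerN -scalerDr -scalerN; congr (_ *: _).
rewrite [RHS]addrC -fsB; last 2 first.
- apply: fin1Z; exists N => t ht; rewrite fs0 ?scaler0 // => u.
  by rewrite XB0 ?scaler0.
- apply: fin1Z; exists N => t ht; rewrite fs0 // => u.
  by rewrite XB0 ?(lin0 (proj1 fa _)) ?scaler0.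
rewrite -fsN; last first.
  by apply: fin1Z; exists N => t ht; apply: fs0 => i; rewrite !XB0 // (lin0 (proj1 fa _)) scaler0 subr0 scaler0.
apply: eq_fs => t; rewrite -scalerBr -scalerN; congr (_ *: _).
rewrite -fsZ // /br.
rewrite -[RHS]opprB; congr (- _); rewrite -fsB; last 2 first.
- have [K hK] := f1 t; exists K => i /hK <-.
  by congr (_ *: A _ (XB t _ w)); lia.
- exact: (fin1Z (fun=> (-1) ^ (n + l - t%:Z)) (f2 t)).
apply: eq_fs => i; rewrite scalerBr [RHS]addrC [RHS]addrC; congr (_ - _); last first.
  by rewrite !scalerA mulrC.
by congr (_ *: A _ (XB t _ w)); lia.
Qed.

(** The mirror image of [borch_closure1]: modes of [y] are moved past those of [a], and the
    commutators bring in [y_(t) a]. The commutator formulas are assumed explicitly, in the algebra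
    and in the module, because in the applications they are read off from the relations between
    generators. *)
Lemma borch_closure2 a y c l n :
  (forall p, a._(p) (y._(n) c) = y._(n) (a._(p) c) -
     fs (fun t : nat => binz n t *: (y._(t%:Z) a)._(n + p - t%:Z) c)) ->
  (forall p q w, act y p (act a q w) - act a q (act y p w) =
     fs (fun t : nat => binz p t *: act (y._(t%:Z) a) (p + q - t%:Z) w)) ->
  (forall d q w, act (y._(n) d) q w = br (act y) (act d) n 0 q w) ->
  borch_at act a c l ->
  (forall t : nat, borch_at act (y._(t%:Z) a) c (n + l - t%:Z)) ->
  borch_at act a (y._(n) c) l.
Proof.
move=> hV comm hy hac hat m q w.
pose Y := act y; pose A := act a; pose C := act c; pose YA t := act (y._(t%:Z) a).
have fYA t : field (YA t) by exact: act_field.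
have fy : field Y by exact: act_field.
have fa : field A by exact: act_field.
have fc : field C by exact: act_field.
have [N hN] := field_fin 0 a (V_field y).
have ya0 t : (N <= t)%N -> y._(t%:Z) a = 0 by move=> /hN; rewrite add0r.
have YA0 t : (N <= t)%N -> forall n w, YA t n w = 0.
  by move=> ht n' w'; rewrite /YA ya0 // (lin0 (act_lin _ _)).
have fZ1 : fin2 (fun t u => YA t (n + m + l - u%:Z - t%:Z) (C (q + u%:Z) w)).
  apply: fin2_rows => [|t]; first by exists N => t ht u; rewrite YA0.
  exact: (@field_fin_comp _ _ (YA t) C (fun z => n + m + l - z - t%:Z)).
have fZ2 : fin2 (fun t u => C (n + q + l - u%:Z) (YA t (m + u%:Z - t%:Z) w)).
  apply: fin2_rows => [|t].
    by exists N => t ht u; rewrite YA0 // (lin0 (proj1 fc _)).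
  have := @field_fin_comp _ _ C (YA t) (fun z => n + q + l - z) (m - t%:Z) w fc (fYA t).
  by case=> K hK; exists K => u /hK; have -> : m - t%:Z + u%:Z = m + u%:Z - t%:Z by lia.
(* The right side has the orderings A Y C, A C Y, Y C A and C Y A; in [Ga] and [Gd] the mode of [y]
   has been moved outermost. *)
pose Fa i k := A (m + l - i%:Z) (Y (n - k%:Z) (C (q + i%:Z + k%:Z) w)).
pose Fb i k := A (m + l - i%:Z) (C (n + q + i%:Z - k%:Z) (Y k%:Z w)).
pose Fc i k := Y (n - k%:Z) (C (q + l - i%:Z + k%:Z) (A (m + i%:Z) w)).
pose Fd i k := C (n + q + l - i%:Z - k%:Z) (Y k%:Z (A (m + i%:Z) w)).
pose Ga i k := Y (n - k%:Z) (A (m + l - i%:Z) (C (q + i%:Z + k%:Z) w)).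
pose Gd i k := C (n + q + l - i%:Z - k%:Z) (A (m + i%:Z) (Y k%:Z w)).
pose s i k := sb l i * sb n k.
pose G i k := Ga i k - (-1) ^ n *: Fb i k - (-1) ^ l *: Fc i k + ((-1) ^ n * (-1) ^ l) *: Gd i k.
pose H1 (i k : nat) := fs (fun t => binz (n - k%:Z) t *: YA t (n + m + l - (i + k)%N%:Z - t%:Z) (C (q + (i + k)%N%:Z) w)).
pose H2 (i k : nat) := fs (fun t => binz k t *: C (n + q + l - (i + k)%N%:Z) (YA t (m + (i + k)%N%:Z - t%:Z) w)).
have fGa : fin2 Ga.
  have [K hK] := field_fin q w fc; exists K => i k hik.
  have e : C (q + i%:Z + k%:Z) w = 0 by rewrite -addrA; exact: hK.
  by rewrite /Ga e (lin0 (proj1 fa _)) (lin0 (proj1 fy _)).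
have fFb : fin2 Fb.
  apply: fin2_cols.
    have [K hK] := field_fin 0 w fy; exists K => k /hK.
    by rewrite add0r => e i; rewrite /Fb e (lin0 (proj1 fc _)) (lin0 (proj1 fa _)).
  move=> k; have [K hK] := @field_fin_comp _ _ A C (fun z => m + l - z) (n + q - k%:Z) (Y k%:Z w) fa fc.
  exists K => i /hK e; rewrite /Fb -[RHS]e; congr (A _ (C _ _)); lia.
have fFc : fin2 Fc.
  apply: fin2_rows.
    have [K hK] := field_fin m w fa; exists K => i hi k.
    by rewrite /Fc hK // (lin0 (proj1 fc _)) (lin0 (proj1 fy _)).
  by move=> i; exact: (@field_fin_comp _ _ Y C (fun z => n - z)).
have fGd : fin2 Gd.
  apply: fin2_cols.
    have [K hK] := field_fin 0 w fy; exists K => k /hK.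
    by rewrite add0r => e i; rewrite /Gd e (lin0 (proj1 fa _)) (lin0 (proj1 fc _)).
  by move=> k; exact: (@field_fin_comp _ _ C A (fun z => n + q + l - z - k%:Z)).
have fG : fin2 G.
  rewrite /G; apply: fin2D; last exact: (fin2Z (fun _ _ => (-1) ^ n * (-1) ^ l)).
  apply: fin2B; last exact: (fin2Z (fun _ _ => (-1) ^ l)).
  by apply: fin2B => //; exact: (fin2Z (fun _ _ => (-1) ^ n)).
have fH1 : fin2 H1.
  have [K hK] := fZ1; exists K => i k hi; apply: fs0 => t.
  by rewrite hK ?scaler0 //; lia.
have fH2 : fin2 H2.
  have [K hK] := fZ2; exists K => i k hi; apply: fs0 => t.
  by rewrite hK ?scaler0 //; lia.
have Fa_eq i k : Fa i k = Ga i k - H1 i k.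
  have e := comm (n - k%:Z) (m + l - i%:Z) (C (q + i%:Z + k%:Z) w).
  have -> : H1 i k = Ga i k - Fa i k.
    rewrite /Ga /Fa e; apply: eq_fs => t; rewrite /YA.
    have -> : n + m + l - (i + k)%N%:Z - t%:Z = n - k%:Z + (m + l - i%:Z) - t%:Z by lia.
    by rewrite PoszD [q + (_ + _)]addrA.
  by rewrite opprB addrC subrK.
have Fd_eq i k : Fd i k = Gd i k + H2 i k.
  have e := comm k%:Z (m + i%:Z) w.
  have {}e : Y k%:Z (A (m + i%:Z) w) = A (m + i%:Z) (Y k%:Z w) +
      fs (fun t : nat => binz k%:Z t *: YA t (k%:Z + (m + i%:Z) - t%:Z) w).
    by rewrite -e [RHS]addrC subrK.
  rewrite /Fd /Gd e.
  rewrite (linD (proj1 fc _)); congr (_ + _); rewrite (lin_fs (proj1 fc _)); last first.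
    by apply: fin1Z; exists N => t ht; rewrite YA0.
  apply: eq_fs => t; rewrite (linZ (proj1 fc _)).
  have -> : m + (i + k)%N%:Z - t%:Z = k%:Z + (m + i%:Z) - t%:Z by lia.
  by have -> : n + q + l - (i + k)%N%:Z = n + q + l - i%:Z - k%:Z by lia.
have fYC r r' u := br_fin n r r' u fy fc.
have eR : br A (act (y._(n) c)) l m q w = fs (fun i => fs (fun k => s i k *: G i k +
    (- (s i k *: H1 i k) + ((-1) ^ n * (-1) ^ l) *: (s i k *: H2 i k)))).
  apply: eq_fs => i; rewrite !hy -/Y -/C.
  have fA p r u : fin1 (fun k : nat => A p (sb n k *: (Y (0 + n - k%:Z) (C (r + k%:Z) u) -
     (-1) ^ n *: C (r + n - k%:Z) (Y (0 + k%:Z) u)))).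
    by apply: (fin1_lin (proj1 fa p)); exact: fYC.
  rewrite /br (lin_fs (proj1 fa _)) // -(fsZ _ (fYC _ _ _)).
  rewrite -(fsB (fA _ _ _) (fin1Z (fun=> (-1) ^ l) (fYC _ _ _))).
  rewrite -(fsZ _ (fin1B (fA _ _ _) (fin1Z (fun=> (-1) ^ l) (fYC _ _ _)))).
  apply: eq_fs => k; rewrite (linZ (proj1 fa _)) (linB (proj1 fa _)) (linZ (proj1 fa _)).
  rewrite [(-1) ^ l *: (sb n k *: _)]scalerA [_ * sb n k]mulrC -[in X in _ - X]scalerA -scalerBr scalerA.
  rewrite !add0r.
  have -> : A (m + l - i%:Z) (Y (n - k%:Z) (C (q + i%:Z + k%:Z) w)) = Fa i k by [].
  have -> : A (m + l - i%:Z) (C (q + i%:Z + n - k%:Z) (Y k%:Z w)) = Fb i k.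
    by rewrite /Fb; congr (A _ (C _ _)); lia.
  have -> : Y (n - k%:Z) (C (q + l - i%:Z + k%:Z) (A (m + i%:Z) w)) = Fc i k by [].
  have -> : C (q + l - i%:Z + n - k%:Z) (Y k%:Z (A (m + i%:Z) w)) = Fd i k.
    by rewrite /Fd; congr (C _ _); lia.
  have e (u1 u2 u3 u4 u5 u6 : M) (d d1 d2 : F) :
      d *: (u1 - u5 - d1 *: u2 - d2 *: (u3 - d1 *: (u4 + u6))) =
      d *: (u1 - d1 *: u2 - d2 *: u3 + (d1 * d2) *: u4) + (- (d *: u5) + (d1 * d2) *: (d *: u6)).
    rewrite !(scalerBr, scalerDr) !scalerA !(opprD, opprK, addrA) [LHS](ACl (1*3*4*5*2*6)).
    by congr (_ *: _ - _ *: _ - _ *: _ + _ *: _ - _ *: _ + _ *: _); ring.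
  by rewrite Fa_eq Fd_eq; exact: (e (Ga i k) (Fb i k) (Fc i k) (Gd i k)).
have eL : bl act a (y._(n) c) l m q w = fs (fun i => fs (fun k => s i k *: G i k)) -
    fs (fun t => binz n t *: br (YA t) C (n + l - t%:Z) m q w).
  pose D (i : nat) := act (a._(l + i%:Z) c).
  have fD i : field (D i) by exact: act_field.
  have [K hK] := field_fin l c (V_field a).
  have D0 i : (K <= i)%N -> forall n w, D i n w = 0.
    by move=> hi n' w'; rewrite /D hK // (lin0 (act_lin _ _)).
  have fYD i r r' u := br_fin n r r' u fy (fD i).
  pose P i k := (binz m i * sb n k) *: (Y (n - k%:Z) (D i (m + q - i%:Z + k%:Z) w) -
    (-1) ^ n *: D i (m + q - i%:Z + n - k%:Z) (Y k%:Z w)).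
  pose Q i t := (binz m i * binz n t) *: act ((y._(t%:Z) a)._(n + l - t%:Z + i%:Z) c) (m + q - i%:Z) w.
  have fP : fin2 P.
    apply: fin2_rows => [|i].
      exists K => i hi k; rewrite /P !D0 // (lin0 (proj1 fy _)).
      by rewrite scaler0 subr0 scaler0.
    apply: fin1Z; apply: fin1B; first exact: (@field_fin_comp _ _ Y (D i) (fun z => n - z)).
    apply: (fin1Z (fun=> (-1) ^ n)).
    have [L hL] := @field_fin_comp _ _ (D i) Y (fun z => m + q - i%:Z + n - z) 0 w (fD i) fy.
    by exists L => k hk; rewrite -[RHS](hL k hk) add0r.
  have fQ : fin2 Q.
    apply: fin2_cols => [|t].
      exists N => t ht i; rewrite /Q ya0 //.
      by rewrite (lin0 (V_lin _ _)) (lin0 (act_lin _ _)) scaler0.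
    apply: fin1Z; have [L hL] := field_fin (n + l - t%:Z) c (V_field (y._(t%:Z) a)).
    by exists L => i hi; rewrite hL // (lin0 (act_lin _ _)).
  transitivity (fs (fun i => fs (fun k => P i k + - Q i k))).
    apply: eq_fs => i; rewrite hV (linB (act_lin _ _)) hy.
    have fQ1 : fin1 (fun t : nat => binz n t *: (y._(t%:Z) a)._(n + (l + i%:Z) - t%:Z) c).
      by exists N => t ht; rewrite ya0 // (lin0 (V_lin _ _)) scaler0.
    rewrite (lin_fs (act_lin _ _)) // scalerBr /br.
    rewrite -(fsZ _ (fYD i _ _ _)) -fsZ; last exact: (fin1_lin (act_lin _ _)).
    rewrite -fsB; last 2 first.
    - exact: (fin1Z (fun=> binz m i) (fYD i _ _ _)).
    - exact: (fin1Z (fun=> binz m i) (fin1_lin (act_lin _ _) fQ1)).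
    apply: eq_fs => k; rewrite (linZ (act_lin _ _)) !scalerA /P /Q !add0r.
    by have -> : n + (l + i%:Z) - k%:Z = n + l - k%:Z + i%:Z by lia.
  rewrite (fs2D fP (fin2N fQ)).
  have -> : fs (fun i => fs (fun k => - Q i k)) = - fs (fun i => fs (Q i)).
    rewrite -(fsN (fin1_fs fQ)); apply: eq_fs => i.
    by rewrite -(fsN (fin1_fin2l i fQ)).
  congr (_ - _); last first.
    rewrite (exchange_fs fQ); apply: eq_fs => t; rewrite -hat /bl -fsZ; last exact: fin1_comm.
    by apply: eq_fs => i; rewrite /Q scalerA mulrC.
  rewrite (exchange_fs fP) [RHS]exchange_fs; last exact: (fin2Z s fG).
  apply: eq_fs => k.
  transitivity (sb n k *: (Y (n - k%:Z) (bl act a c l m (q + k%:Z) w) -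
      (-1) ^ n *: bl act a c l m (q + n - k%:Z) (Y k%:Z w))).
    have fBL r r' u := bl_fin act_lin V_field a c l r r' u.
    rewrite /bl (lin_fs (proj1 fy _)) // -(fsZ _ (fBL _ _ _)).
    rewrite -(fsB (fin1_lin (proj1 fy _) (fBL _ _ _)) (fin1Z (fun=> (-1) ^ n) (fBL _ _ _))).
    rewrite -(fsZ _ (fin1B (fin1_lin (proj1 fy _) (fBL _ _ _)) (fin1Z (fun=> (-1) ^ n) (fBL _ _ _)))).
    apply: eq_fs => i; rewrite /P (linZ (proj1 fy _)) /D.
    have -> : m + (q + k%:Z) - i%:Z = m + q - i%:Z + k%:Z by lia.
    have -> : m + (q + n - k%:Z) - i%:Z = m + q - i%:Z + n - k%:Z by lia.
    by rewrite !(scalerBr, scalerA); congr (_ *: _ - _ *: _); ring.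
  rewrite !hac /br -/A -/C.
  have fAC r r' u := br_fin l r r' u fa fc.
  rewrite (lin_fs (proj1 fy _)) // -(fsZ _ (fAC _ _ _)).
  rewrite -(fsB (fin1_lin (proj1 fy _) (fAC _ _ _)) (fin1Z (fun=> (-1) ^ n) (fAC _ _ _))).
  rewrite -(fsZ _ (fin1B (fin1_lin (proj1 fy _) (fAC _ _ _)) (fin1Z (fun=> (-1) ^ n) (fAC _ _ _)))).
  apply: eq_fs => i; rewrite (linZ (proj1 fy _)) (linB (proj1 fy _)) (linZ (proj1 fy _)).
  have -> : Y (n - k%:Z) (A (m + l - i%:Z) (C (q + k%:Z + i%:Z) w)) = Ga i k.
    by rewrite /Ga; congr (Y _ (A _ (C _ _))); lia.
  have -> : Y (n - k%:Z) (C (q + k%:Z + l - i%:Z) (A (m + i%:Z) w)) = Fc i k.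
    by rewrite /Fc; congr (Y _ (C _ _)); lia.
  have -> : A (m + l - i%:Z) (C (q + n - k%:Z + i%:Z) (Y k%:Z w)) = Fb i k.
    by rewrite /Fb; congr (A _ (C _ _)); lia.
  have -> : C (q + n - k%:Z + l - i%:Z) (A (m + i%:Z) (Y k%:Z w)) = Gd i k.
    by rewrite /Gd; congr (C _ _); lia.
  have e (u1 u2 u3 u4 : M) (d d' d1 d2 : F) :
      d *: (d' *: (u1 - d2 *: u3) - d1 *: (d' *: (u2 - d2 *: u4))) =
      (d' * d) *: (u1 - d1 *: u2 - d2 *: u3 + (d1 * d2) *: u4).
    rewrite [d1 *: (d' *: _)]scalerA [d1 * d']mulrC -[in X in _ - X]scalerA -scalerBr scalerA [d * _]mulrC.
    congr (_ *: _); rewrite scalerBr scalerA.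
    by rewrite !(opprD, opprK, addrA) [LHS](ACl (1*3*2*4)).
  exact: (e (Ga i k) (Fb i k) (Fc i k) (Gd i k)).
have eH1 : fs (fun i => fs (fun k => s i k *: H1 i k)) =
  fs (fun t => binz n t *: fs (fun u => sb (n + l - t%:Z) u *:
     YA t (n + m + l - u%:Z - t%:Z) (C (q + u%:Z) w))).
  exact: (fs_conv_above l n fZ1).
have eH2 : fs (fun i => fs (fun k => s i k *: H2 i k)) =
  fs (fun t => sb n t *: fs (fun i => sb (n + l - t%:Z) i *:
     C (n + q + l - (t + i)%N%:Z) (YA t (m + (t + i)%N%:Z - t%:Z) w))).
  exact: (fs_conv_below l n fZ2).
have fs1 : fin2 (fun i k => - (s i k *: H1 i k)) by apply: fin2N; exact: fin2Z.
have fs2 : fin2 (fun i k => s i k *: H2 i k) by exact: fin2Z.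
have fs2' := fin2Z (fun _ _ => (-1) ^ n * (-1) ^ l) fs2.
rewrite eL eR (fs2D (fin2Z s fG) (fin2D fs1 fs2')) (fs2D fs1 fs2'); congr (_ + _).
rewrite (fs2Z _ fs2) eH2.
have -> : fs (fun i => fs (fun k => - (s i k *: H1 i k))) = - fs (fun i => fs (fun k => s i k *: H1 i k)).
  have f := fin2Z s fH1; rewrite -(fsN (fin1_fs f)); apply: eq_fs => i.
  by rewrite -(fsN (fin1_fin2l i f)).
rewrite eH1.
have f1 t : fin1 (fun i : nat => sb (n + l - t%:Z) i *: YA t (n + m + l - i%:Z - t%:Z) (C (q + i%:Z) w)).
  by apply: fin1Z; exact: (@field_fin_comp _ _ (YA t) C (fun z => n + m + l - z - t%:Z)).
have f2 t : fin1 (fun i : nat => sb (n + l - t%:Z) i *: C (q + (n + l - t%:Z) - i%:Z) (YA t (m + i%:Z) w)).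
  by apply: fin1Z; exact: (@field_fin_comp _ _ C (YA t) (fun z => q + (n + l - t%:Z) - z)).
have -> : ((-1) ^ n * (-1) ^ l) *: fs (fun t => sb n t *: fs (fun i => sb (n + l - t%:Z) i *:
     C (n + q + l - (t + i)%N%:Z) (YA t (m + (t + i)%N%:Z - t%:Z) w))) =
  fs (fun t => binz n t *: ((-1) ^ (n + l - t%:Z) *: fs (fun u => sb (n + l - t%:Z) u *:
     C (q + (n + l - t%:Z) - u%:Z) (YA t (m + u%:Z) w)))).
  rewrite -fsZ; last first.
    apply: fin1Z; exists N => t ht; rewrite fs0 // => u.
    by rewrite YA0 // (lin0 (proj1 fc _)) scaler0.
  apply: eq_fs => t; rewrite !scalerA; congr (_ *: _).
    by rewrite /sb signB signD; ring.
  apply: eq_fs => u; congr (_ *: _).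
  have -> : m + (t + u)%N%:Z - t%:Z = m + u%:Z by lia.
  by have -> : n + q + l - (t + u)%N%:Z = q + (n + l - t%:Z) - u%:Z by lia.
have fb1 : fin1 (fun t => binz n t *: fs (fun u => sb (n + l - t%:Z) u *:
     YA t (n + m + l - u%:Z - t%:Z) (C (q + u%:Z) w))).
  by apply: fin1Z; exists N => t ht; apply: fs0 => u; rewrite YA0 ?scaler0.
rewrite addrC -fsB //; last first.
  apply: fin1Z; exists N => t ht; rewrite fs0 ?scaler0 // => u.
  by rewrite YA0 // (lin0 (proj1 fc _)) scaler0.
rewrite -fsN; last first.
  apply: fin1Z; exists N => t ht; apply: fs0 => i.
  by rewrite !YA0 // (lin0 (proj1 fc _)) scaler0 subr0 scaler0.
apply: eq_fs => t; rewrite -scalerBr -scalerN; congr (_ *: _).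
rewrite -[RHS]opprB; congr (- _); rewrite -fsZ // /br.
rewrite -(fsB (f1 t) (fin1Z (fun=> (-1) ^ (n + l - t%:Z)) (f2 t))).
apply: eq_fs => i; rewrite scalerBr; congr (_ - _); last by rewrite !scalerA mulrC.
by have -> : n + m + l - i%:Z - t%:Z = m + (n + l - t%:Z) - i%:Z by lia.
Qed.

Lemma borch_at_lin1 a b c k l :
  borch_at act a c l -> borch_at act b c l -> borch_at act (k *: a + b) c l.
Proof.
move=> ha hb m n w.
have e1 : bl act (k *: a + b) c l m n w = k *: bl act a c l m n w + bl act b c l m n w.
  rewrite /bl -(fsZ k (bl_fin act_lin V_field a c l m n w)).
  rewrite -(fsD (fin1Z (fun=> k) (bl_fin act_lin V_field a c l m n w)) (bl_fin act_lin V_field b c l m n w)).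
  by apply: eq_fs => i; rewrite V_lin act_lin scalerDr !scalerA mulrC.
have e2 : br (act (k *: a + b)) (act c) l m n w =
    k *: br (act a) (act c) l m n w + br (act b) (act c) l m n w.
  have fa := br_fin l m n w (act_field a) (act_field c).
  have fb := br_fin l m n w (act_field b) (act_field c).
  rewrite /br -(fsZ k fa) -(fsD (fin1Z (fun=> k) fa) fb).
  have e (x y : M) d : k *: (d *: x) + d *: y = d *: (k *: x + y).
    by rewrite scalerDr !scalerA mulrC.
  apply: eq_fs => i; rewrite {}e !act_lin (proj1 (act_field c)); congr (_ *: _).
  by rewrite scalerDr scalerBr opprD addrACA !scalerA [k * _]mulrC.
by rewrite e1 e2 ha hb.
Qed.

Lemma borch_at_lin2 a b c k l :
  borch_at act c a l -> borch_at act c b l -> borch_at act c (k *: a + b) l.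
Proof.
move=> ha hb m n w.
have e1 : bl act c (k *: a + b) l m n w = k *: bl act c a l m n w + bl act c b l m n w.
  rewrite /bl -(fsZ k (bl_fin act_lin V_field c a l m n w)).
  rewrite -(fsD (fin1Z (fun=> k) (bl_fin act_lin V_field c a l m n w)) (bl_fin act_lin V_field c b l m n w)).
  by apply: eq_fs => i; rewrite (proj1 (V_field c)) act_lin scalerDr !scalerA mulrC.
have e2 : br (act c) (act (k *: a + b)) l m n w =
    k *: br (act c) (act a) l m n w + br (act c) (act b) l m n w.
  have fa := br_fin l m n w (act_field c) (act_field a).
  have fb := br_fin l m n w (act_field c) (act_field b).
  rewrite /br -(fsZ k fa) -(fsD (fin1Z (fun=> k) fa) fb).
  have e (x y : M) d : k *: (d *: x) + d *: y = d *: (k *: x + y).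
    by rewrite scalerDr !scalerA mulrC.
  apply: eq_fs => i; rewrite {}e !act_lin (proj1 (act_field c)); congr (_ *: _).
  by rewrite scalerDr scalerBr opprD addrACA !scalerA [k * _]mulrC.
by rewrite e1 e2 ha hb.
Qed.

Lemma borch_at_0l c l : borch_at act 0 c l.
Proof.
move=> m n w; rewrite /bl /br !fs0 // => i.
  by rewrite (lin0 (act_lin _ _)) (lin0 (act_lin _ _)) (lin0 (proj1 (act_field c) _)) scaler0 subr0 scaler0.
by rewrite (lin0 (V_lin _ _)) (lin0 (act_lin _ _)) scaler0.
Qed.

Lemma borch_at_0r c l : borch_at act c 0 l.
Proof.
move=> m n w; rewrite /bl /br !fs0 // => i.
  by rewrite !(lin0 (act_lin _ _)) (lin0 (proj1 (act_field c) _)) scaler0 subr0 scaler0.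
by rewrite (lin0 (proj1 (V_field c) _)) (lin0 (act_lin _ _)) scaler0.
Qed.

Lemma borch_at_scale a c k l : borch_at act a c l -> borch_at act (k *: a) c l.
Proof.
move=> h; rewrite -[k *: a]addr0; apply: borch_at_lin1 => //; exact: borch_at_0l.
Qed.

Lemma borch_vac c :
  (forall n w, act (vac V) n w = if n == -1 then w else 0) ->
  (forall n w, (vac V)._(n) w = if n == -1 then w else 0) ->
  borch act (vac V) c.
Proof.
move=> hM hV; apply: borch_intro => // [m n w|p n w].
  rewrite br0E // /bl fs0 => [|i]; last first.
    by rewrite hV add0r (lin0 (act_lin _ _)) scaler0.
  by rewrite !hM; case: eqP => _; rewrite ?(lin0 (proj1 (act_field c) _)) subrr.
rewrite hV (_ : (- p.+1%:Z == -1) = (p == 0%N)); last by apply/eqP/eqP; lia.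
rewrite /br (fs_single (i0 := 0%N)) => [|i hi].
  rewrite !hM sb0 scale1r (_ : (0 + - p.+1%:Z - 0%:Z == -1) = (p == 0%N)); last first.
    by apply/eqP/eqP; lia.
  rewrite (_ : (0 + 0%:Z == -1 :> int) = false) // (lin0 (proj1 (act_field c) _)) scaler0 subr0.
  by case: eqP => _; rewrite ?addr0 // (lin0 (act_lin _ _)).
rewrite !hM (_ : (0 + - p.+1%:Z - i%:Z == -1) = false); last by apply/eqP; lia.
rewrite (_ : (0 + i%:Z == -1) = false); last by apply/eqP; lia.
by rewrite (lin0 (proj1 (act_field c) _)) scaler0 subr0 scaler0.
Qed.

(** The modes [- n A_(n-1)] are those of the derivative of [A], so this is
    [(D a)_(l) b = - l a_(l-1) b] at the level of fields. It lets an identity for [D a] at order [l]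
    be read as one for [a] at order [l - 1]. *)
Lemma br_deriv (A B : int -> M -> M) l n w : field A -> field B ->
  br (fun n w => - n%:~R *: A (n - 1) w) B l 0 n w = - l%:~R *: br A B (l - 1) 0 n w.
Proof.
move=> fA fB; rewrite /br -fsZ; last exact: br_fin fA fB.
pose P (i : nat) := A (l - 1 - i%:Z) (B (n + i%:Z) w).
pose Q (i : nat) := (-1) ^ l *: B (n + l - 1 - i%:Z) (A i%:Z w).
have fP : fin1 P by exact: (@field_fin_comp _ _ A B (fun z => l - 1 - z)).
have fQ : fin1 Q.
  apply: (fin1Z (fun=> (-1) ^ l)).
  have [N hN] := @field_fin_comp _ _ B A (fun z => n + l - 1 - z) 0 w fB fA.
  by exists N => i /hN; rewrite add0r.
pose R (i : nat) := (-1) ^ l *: B (n + l - i%:Z) (A (i%:Z - 1) w).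
have fR : fin1 R.
  have [N hN] := fQ; exists N.+1 => -[//|i] hi; rewrite /R -[RHS](hN i hi) /Q.
  have -> : i.+1%:Z - 1 = i by lia.
  by have -> : n + l - i.+1%:Z = n + l - 1 - i%:Z by lia.
have hb i : (l - i%:Z)%:~R * sb l i = l%:~R * sb (l - 1) i.
  have := binz_mulC F l i 1; have := binz_mulC F l 1 i; rewrite !binz1 => h _.
  by rewrite /sb mulrCA [in RHS]mulrCA; congr (_ * _); rewrite mulrC -h.
have hb' i : i.+1%:R * sb l i.+1 = - (l%:~R * sb (l - 1) i).
  rewrite -hb /sb mulrCA binzS intS signD expr1z mulN1r mulNr; congr (- _).
  by rewrite rmorphB; ring.
transitivity (fs (fun i => (- (l%:~R * sb (l - 1) i)) *: P i) + fs (fun i => (i%:R * sb l i) *: R i)).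
  rewrite -(fsD (fin1Z _ fP) (fin1Z _ fR)); apply: eq_fs => i.
  rewrite -hb !add0r (linZ (proj1 fB _)) scalerBr /P /R !scalerA.
  have -> : l - i%:Z - 1 = l - 1 - i%:Z by lia.
  rewrite -scaleNr; congr (_ *: _ + _ *: _); first by ring.
  by rewrite -[i%:Z%:~R]/(i%:R); ring.
rewrite (fs_recl (fin1Z _ fR)) mul0r scale0r add0r.
have fR' : fin1 (fun i => (i.+1%:R * sb l i.+1) *: R i.+1).
  by have [N hN] := fR; exists N => i hi; rewrite hN ?scaler0 // leqW.
rewrite -(fsD (fin1Z _ fP) fR'); apply: eq_fs => i.
rewrite hb' -scalerDr -mulNr -scalerA; congr (_ *: (_ *: _)).
rewrite /P /R !add0r -scaleNr signB expr1z mulrN1 opprK; congr (_ + _ *: _).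
have -> : i.+1%:Z - 1 = i by lia.
by have -> : n + l - i.+1%:Z = n + (l - 1) - i%:Z by lia.
Qed.

End ClosureLemmas.

(** * Exponentials of commuting operators and exponential fields *)

Section Exponentials.
Variables (F : numFieldType) (M : lmodType F).
Implicit Types (A B : nat -> M -> M) (v : M).

(* Defs.opow and Defs.oexp over an arbitrary module. *)
Fixpoint gopow A (l p : nat) v : M :=
  if l is l'.+1 then \sum_(i < p) A i.+1 (gopow A l' (p - i.+1) v)
  else if p == 0%N then v else 0.

Definition goexp A (p : nat) v : M :=
  \sum_(l < p.+1) (l`!)%:R^-1 *: gopow A l p v.

Lemma exchange_triangle p (f : nat -> nat -> M) :
  \sum_(i < p) \sum_(k < p - i.+1) f i k = \sum_(k < p) \sum_(i < p - k.+1) f i k.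
Proof.
have e (g : nat -> nat -> M) : \sum_(i < p) \sum_(k < p - i.+1) g i k =
    \sum_(i < p) \sum_(k < p | (i + k < p.-1)%N) g i k.
  apply: eq_bigr => i _; rewrite (big_ord_widen_cond p xpredT (g i)) ?leq_subr //=.
  by apply: eq_bigl => k; apply/idP/idP; lia.
rewrite e (exchange_big_dep xpredT) //= (e (fun i k => f k i)); apply: eq_bigr => k _.
by apply: eq_bigl => i; rewrite addnC.
Qed.

(** The recursion is the coefficient form of [t f'(t) = t A'(t) f(t)]; as every [p > 0] is
    invertible, it determines [f] from [f 0]. Identities between exponentials are proved below by
    checking this recursion. *)
Lemma goexp_uniq A (f : nat -> M) v : f 0%N = v ->
  (forall i, linear (A i)) ->
  (forall p, p%:R *: f p = \sum_(i < p) i.+1%:R *: A i.+1 (f (p - i.+1)%N)) ->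
  forall g : nat -> M, g 0%N = v ->
  (forall p, p%:R *: g p = \sum_(i < p) i.+1%:R *: A i.+1 (g (p - i.+1)%N)) ->
  f =1 g.
Proof.
move=> f0 lA hf g g0 hg p; elim/ltn_ind: p => -[|p] IH; first by rewrite f0 g0.
have h : p.+1%:R != 0 :> F by rewrite pnatr_eq0.
rewrite -[f _]scale1r -[g _]scale1r -(mulVf h) -!scalerA hf hg; congr (_ *: _).
by apply: eq_bigr => i _; rewrite IH // subSS ltnS leq_subr.
Qed.

Section OneFamily.
Variable A : nat -> M -> M.
Hypothesis lA : forall i, linear (A i).

Lemma gopow_lin l p : linear (gopow A l p).
Proof.
elim: l p => [|l IH] p a u v /=; first by case: eqP => _; rewrite ?scaler0 ?addr0.
rewrite scaler_sumr -big_split; apply: eq_bigr => i _ /=.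
by rewrite IH lA.
Qed.

Lemma goexp_lin p : linear (goexp A p).
Proof.
move=> a u v; rewrite /goexp scaler_sumr -big_split; apply: eq_bigr => i _ /=.
by rewrite gopow_lin scalerDr !scalerA mulrC.
Qed.

Lemma gopow_small l p v : (p < l)%N -> gopow A l p v = 0.
Proof.
elim: l p => // l IH p hp /=; rewrite big1 // => i _.
by rewrite IH ?(lin0 (lA _)) //; have := ltn_ord i; lia.
Qed.

Lemma goexp_widen N p v : (p < N)%N ->
  goexp A p v = \sum_(l < N) (l`!)%:R^-1 *: gopow A l p v.
Proof.
move=> h; rewrite /goexp (big_ord_widen_cond N xpredT (fun l => (l`!)%:R^-1 *: gopow A l p v)) //=.
rewrite [RHS](bigID (fun l : 'I_N => (l < p.+1)%N)) /= [X in _ + X]big1 ?addr0 // => l.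
by rewrite -leqNgt => hl; rewrite gopow_small ?scaler0.
Qed.

Lemma goexp0 v : goexp A 0 v = v.
Proof. by rewrite /goexp big_ord1 /= fact0 invr1 scale1r. Qed.

Hypothesis cA : forall i j v, A i (A j v) = A j (A i v).

(** The derivative rule [t (A^(l+1))' = (l+1) t A' A^l], which rests on the commutation of the
    coefficients. *)
Lemma gopow_rec l p v : p%:R *: gopow A l.+1 p v =
  l.+1%:R *: \sum_(i < p) i.+1%:R *: A i.+1 (gopow A l (p - i.+1) v).
Proof.
elim: l p => [|l IH] p.
  rewrite scale1r /= scaler_sumr; apply: eq_bigr => i _.
  case: eqP => [e|_]; last by rewrite (lin0 (lA _)) !scaler0.
  by congr (_%:R *: _); have := ltn_ord i; lia.
transitivity (\sum_(i < p) (i.+1%:R *: A i.+1 (gopow A l.+1 (p - i.+1) v) +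
    A i.+1 ((p - i.+1)%:R *: gopow A l.+1 (p - i.+1) v))).
  rewrite {1}[gopow]lock /= -lock scaler_sumr; apply: eq_bigr => i _.
  by rewrite (linZ (lA _)) -scalerDl -natrD subnKC.
rewrite big_split /= -[l.+2%:R]natr1 [X in _ = X]scalerDl scale1r addrC.
congr (_ + _).
under eq_bigr => i _ do rewrite IH (linZ (lA _)) (lin_sum (lA _)).
rewrite -scaler_sumr; congr (_ *: _).
transitivity (\sum_(i < p) \sum_(k < p - i.+1) k.+1%:R *: A k.+1 (A i.+1 (gopow A l (p - i.+1 - k.+1) v))).
  by apply: eq_bigr => i _; apply: eq_bigr => k _; rewrite (linZ (lA _)) cA.
rewrite (exchange_triangle p (fun i k => k.+1%:R *: A k.+1 (A i.+1 (gopow A l (p - i.+1 - k.+1) v)))).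
apply: eq_bigr => k _; rewrite -scaler_sumr -(lin_sum (lA _)); congr (_ *: A _ _).
by apply: eq_bigr => i _; congr (A _ (gopow _ _ _ _)); lia.
Qed.

Lemma goexp_rec p v :
  p%:R *: goexp A p v = \sum_(i < p) i.+1%:R *: A i.+1 (goexp A (p - i.+1) v).
Proof.
rewrite /goexp big_ord_recl /= scalerDr.
have -> : p%:R *: ((0`!)%:R^-1 *: (if p == 0%N then v else 0)) = 0.
  by case: p => [|p] /=; rewrite ?scale0r ?scaler0.
rewrite add0r scaler_sumr.
transitivity (\sum_(l < p) \sum_(i < p) i.+1%:R *: A i.+1 ((l`!)%:R^-1 *: gopow A l (p - i.+1) v)).
  apply: eq_bigr => l _.
  rewrite scalerA mulrC -scalerA [X in _ *: X](gopow_rec l p v) scalerA.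
  have -> : (l.+1`!)%:R^-1 * l.+1%:R = (l`!)%:R^-1 :> F.
    have h : l.+1%:R != 0 :> F by rewrite pnatr_eq0.
    by rewrite factS natrM invfM mulrAC mulVf ?mul1r.
  rewrite scaler_sumr; apply: eq_bigr => i _.
  by rewrite (linZ (lA _)) !scalerA mulrC.
rewrite exchange_big /=; apply: eq_bigr => i _.
rewrite -scaler_sumr -(lin_sum (lA _)); congr (_ *: A _ _).
by rewrite -goexp_widen //; have := ltn_ord i; lia.
Qed.

Lemma goexp_eq (f : nat -> M) v : f 0%N = v ->
  (forall p, p%:R *: f p = \sum_(i < p) i.+1%:R *: A i.+1 (f (p - i.+1)%N)) ->
  forall p, f p = goexp A p v.
Proof.
move=> f0 hf; apply: (goexp_uniq f0 lA hf); first exact: goexp0.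
by move=> p; exact: goexp_rec.
Qed.

Lemma goexp_comm (T : M -> M) p v : linear T ->
  (forall i v, T (A i.+1 v) = A i.+1 (T v)) -> T (goexp A p v) = goexp A p (T v).
Proof.
move=> lT hT; apply: (@goexp_eq (fun p => T (goexp A p v))); first by rewrite goexp0.
move=> q; rewrite -(linZ lT) goexp_rec (lin_sum lT); apply: eq_bigr => i _.
by rewrite (linZ lT) hT.
Qed.

(** Extended by 0 to negative degrees, so that differences of degrees can be written without case
    distinctions. *)
Definition gexpz (p : int) v : M := if p is Posz n then goexp A n v else 0.

(* [X, -] acts on the exponential of [\sum_i A i t^i] as multiplication by
   [kappa t^m] when [kappa] is the only nonzero commutator. *)
Lemma goexp_commutator (X : M -> M) (m : nat) (kappa : F) p v : linear X ->
  (forall i v, X (A i.+1 v) = A i.+1 (X v) + (if i.+1 == m then kappa else 0) *: v) ->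
  (0 < m)%N ->
  X (goexp A p v) = goexp A p (X v) + kappa *: gexpz (p%:Z - m%:Z) v.
Proof.
move=> lX hX m0.
have gz (q : nat) : gexpz (q%:Z - m%:Z) v = if (m <= q)%N then goexp A (q - m) v else 0.
  by case: leqP => h; [rewrite subzn | rewrite -opprB subzn ?(ltnW h) //;
     case: (m - q)%N (subn_gt0 q m) => [|k]; rewrite ?h].
apply/eqP; rewrite -subr_eq; apply/eqP; move: p.
apply: goexp_eq => [|p].
  by rewrite goexp0 gz leqNgt m0 scaler0 subr0.
rewrite scalerBr -(linZ lX) goexp_rec (lin_sum lX).
transitivity (\sum_(i < p) (i.+1%:R *: A i.+1 (X (goexp A (p - i.+1) v)) +
   (if i.+1 == m then m%:R * kappa else 0) *: goexp A (p - i.+1) v)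
   - p%:R *: (kappa *: gexpz (p%:Z - m%:Z) v)).
  congr (_ - _); apply: eq_bigr => i _; rewrite (linZ lX) hX scalerDr scalerA.
  by congr (_ + _ *: _); case: eqP => [->|]; rewrite ?mulr0.
rewrite big_split /= -addrA.
have -> : \sum_(i < p) (if i.+1 == m then m%:R * kappa else 0) *: goexp A (p - i.+1) v =
    (m%:R * kappa) *: gexpz (p%:Z - m%:Z) v.
  rewrite gz; case: leqP => h; last first.
    rewrite scaler0 big1 // => i _; case: eqP => [e|_]; last by rewrite scale0r.
    by have := ltn_ord i; lia.
  have hm : (m.-1 < p)%N by lia.
  rewrite (bigD1 (Ordinal hm)) //= prednK // eqxx big1 ?addr0 // => i hi.
  case: eqP => [e|_]; last by rewrite scale0r.
  by case/negP: hi; apply/eqP/val_inj => /=; lia.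
have -> : \sum_(i < p) i.+1%:R *: A i.+1 (X (goexp A (p - i.+1) v) - kappa *: gexpz ((p - i.+1)%N%:Z - m%:Z) v)
  = \sum_(i < p) i.+1%:R *: A i.+1 (X (goexp A (p - i.+1) v)) -
    kappa *: \sum_(i < p) i.+1%:R *: A i.+1 (gexpz ((p - i.+1)%N%:Z - m%:Z) v).
  rewrite scaler_sumr -sumrB; apply: eq_bigr => i _.
  by rewrite (linB (lA _)) (linZ (lA _)) scalerBr !scalerA mulrC.
congr (_ + _).
have -> : \sum_(i < p) i.+1%:R *: A i.+1 (gexpz ((p - i.+1)%N%:Z - m%:Z) v) =
    (p%:R - m%:R) *: gexpz (p%:Z - m%:Z) v.
  rewrite gz; case: leqP => h; last first.
    rewrite scaler0 big1 // => i _; rewrite gz leqNgt.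
    have -> : (p - i.+1 < m)%N by lia.
    by rewrite /= (lin0 (lA _)) scaler0.
  have -> : p%:R - m%:R = (p - m)%:R :> F by rewrite natrB.
  rewrite goexp_rec -[in LHS](subnK h) big_split_ord /= [X in _ + X]big1 => [|i _]; last first.
    rewrite gz leqNgt; have -> : (p - m + m - (p - m + i).+1 < m)%N by lia.
    by rewrite /= (lin0 (lA _)) scaler0.
  rewrite addr0; apply: eq_bigr => i _; rewrite gz.
  have -> : (m <= p - m + m - i.+1)%N by have := ltn_ord i; lia.
  by congr (_ *: A _ (goexp _ _ _)); have := ltn_ord i; lia.
by rewrite !scalerA -scalerBl -scaleNr; congr (_ *: _); ring.
Qed.

End OneFamily.

Lemma goexp_add A B p v : (forall i, linear (A i)) -> (forall i, linear (B i)) ->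
  (forall i j v, A i (A j v) = A j (A i v)) ->
  (forall i j v, B i (B j v) = B j (B i v)) ->
  (forall i j v, A i (B j v) = B j (A i v)) ->
  \sum_(q < p.+1) goexp A q (goexp B (p - q) v) = goexp (fun i v => A i v + B i v) p v.
Proof.
move=> lA lB cA cB cAB.
have lAB i : linear (fun v => A i v + B i v).
  by move=> a u w; rewrite lA lB scalerDr addrACA.
have cAB' i j u : A i (A j u + B j u) + B i (A j u + B j u) =
    A j (A i u + B i u) + B j (A i u + B i u).
  rewrite (linD (lA i)) (linD (lB i)) (linD (lA j)) (linD (lB j)) cA cB !cAB.
  by rewrite addrACA.
apply: (@goexp_eq _ lAB cAB' (fun p => \sum_(q < p.+1) goexp A q (goexp B (p - q) v))) p.
  by rewrite big_ord1 !goexp0.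
move=> p; pose f i q := i.+1%:R *: A i.+1 (goexp A q (goexp B (p - i.+1 - q) v)).
pose g i q := i.+1%:R *: B i.+1 (goexp A q (goexp B (p - i.+1 - q) v)).
transitivity (\sum_(q < p.+1) (\sum_(i < q) f i (q - i.+1)%N + \sum_(i < p - q) g i q)).
  rewrite scaler_sumr; apply: eq_bigr => q _.
  have hq : (q <= p)%N by rewrite -ltnS.
  rewrite -{1}(subnKC hq) natrD scalerDl goexp_rec //; congr (_ + _).
    apply: eq_bigr => i _; rewrite /f; congr (_ *: A _ (goexp _ _ (goexp _ _ _))).
    by have := ltn_ord i; lia.
  rewrite -(linZ (goexp_lin lA _)) goexp_rec // (lin_sum (goexp_lin lA _)).
  apply: eq_bigr => i _; rewrite (linZ (goexp_lin lA _)) /g -goexp_comm //.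
  by congr (_ *: B _ (goexp _ _ (goexp _ _ _))); lia.
rewrite big_split /=.
transitivity (\sum_(i < p) \sum_(q < (p - i.+1).+1) (f i q + g i q)); last first.
  apply: eq_bigr => i _; rewrite (lin_sum (lA _)) (lin_sum (lB _)) scalerDr !scaler_sumr -big_split /=.
  by apply: eq_bigr => q _.
under [RHS]eq_bigr => i _ do rewrite big_split /=.
rewrite big_split /=; congr (_ + _).
  rewrite big_ord_recl big_ord0 add0r.
  transitivity (\sum_(q < p) \sum_(i < p | (i <= q)%N) f i (q - i)%N).
    apply: eq_bigr => q _; rewrite lift0.
    rewrite (big_ord_widen_cond p xpredT (fun i => f i (q.+1 - i.+1)%N)) //=.
  rewrite (exchange_big_dep xpredT) //=; apply: eq_bigr => i _.
  have hi := ltn_ord i.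
  rewrite -(big_mkord (fun q => (i <= q)%N) (fun q => f i (q - i)%N)).
  rewrite (@big_cat_nat _ _ _ i) //=; last exact: ltnW.
  rewrite big_nat_cond big_pred0 => [|q]; last by apply/negP; lia.
  rewrite add0r -{1}[nat_of_ord i]add0n big_addn subnSK //.
  rewrite (eq_bigl xpredT) => [|q]; last exact: leq_addl.
  by rewrite big_mkord; apply: eq_bigr => q _; rewrite addnK.
rewrite big_ord_recr /= subnn big_ord0 addr0.
transitivity (\sum_(q < p) \sum_(i < p | (i + q < p)%N) g i q).
  apply: eq_bigr => q _; rewrite (big_ord_widen_cond p xpredT (fun i => g i q)) ?leq_subr //=.
  by apply: eq_bigl => i; apply/idP/idP; lia.
rewrite (exchange_big_dep xpredT) //=; apply: eq_bigr => i _.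
rewrite (big_ord_widen_cond p xpredT (fun q => g i q)) /=; last by have := ltn_ord i; lia.
by apply: eq_bigl => q; apply/idP/idP; have := ltn_ord i; lia.
Qed.

Lemma goexp_eq0 A p v : (forall i v, A i.+1 v = 0) ->
  goexp A p v = if p == 0%N then v else 0.
Proof.
move=> A0; case: p => [|p] /=; first by rewrite goexp0.
rewrite /goexp big1 // => -[[|l] hl] _ /=; first by rewrite scaler0.
by rewrite big1 ?scaler0 // => i _; rewrite A0.
Qed.

Lemma eq_goexp A B p v : (forall i v, A i.+1 v = B i.+1 v) -> goexp A p v = goexp B p v.
Proof.
move=> e; apply: eq_bigr => l _; congr (_ *: _).
have eAB : forall l q, gopow A l q v = gopow B l q v.
  by elim=> //= k IH q; apply: eq_bigr => i _; rewrite e IH.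
exact: eAB.
Qed.

End Exponentials.

(** * Fields of the multiples of an isotropic vector *)

Section ExponentialFields.
Variables (F : numFieldType) (M : lmodType F).
Variables (s : int) (C S : int -> M -> M).
Local Notation sb := (@sb F).

Definition pos_part (j : int) (i : nat) (v : M) : M := (i%:R^-1 * j%:~R) *: C (- i%:Z) v.
Definition neg_part (j : int) (i : nat) (v : M) : M := (- i%:R^-1 * j%:~R) *: C i%:Z v.

Local Notation P j := (gexpz (pos_part j)).
Local Notation Q j := (goexp (neg_part j)).

(** With [C] the modes of [c], the summand [2 * s * j] comes from the factor [z^(j c(0))], since
    [c(0)] is the scalar [- 2 s]. *)
Definition gexp_field (j n : int) (v : M) : M :=
  fs (fun q : nat => P j (q%:Z - n - 1 + 2 * s * j) (Q j q (S j v))).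

Local Notation E := gexp_field.

Hypothesis fC : field C.
Hypothesis cC : forall m n v, C m (C n v) = C n (C m v).
Hypothesis lS : forall j, linear (S j).
Hypothesis SS : forall j j' v, S j (S j' v) = S (j + j') v.
Hypothesis SC : forall n j v, C n (S j v) = S j (C n v).
Hypothesis C0 : forall v, C 0 v = - (2 * s)%:~R *: v.
Hypothesis nilQ : forall j v, exists N, forall q, (N <= q)%N -> Q j q v = 0.

Let lC n : linear (C n) := proj1 fC n.

Lemma pos_lin j i : linear (pos_part j i).
Proof. by move=> a u v; rewrite /pos_part lC scalerDr !scalerA mulrC. Qed.

Lemma neg_lin j i : linear (neg_part j i).
Proof. by move=> a u v; rewrite /neg_part lC scalerDr !scalerA mulrC. Qed.

Lemma lC_comm m n a v : C m (a *: C n v) = a *: C n (C m v).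
Proof. by rewrite (linZ (lC _)) cC. Qed.

Lemma pos_comm j j' i i' v : pos_part j i (pos_part j' i' v) = pos_part j' i' (pos_part j i v).
Proof. by rewrite /pos_part !lC_comm !scalerA cC mulrC. Qed.

Lemma neg_comm j j' i i' v : neg_part j i (neg_part j' i' v) = neg_part j' i' (neg_part j i v).
Proof. by rewrite /neg_part !lC_comm !scalerA cC mulrC. Qed.

Lemma P_lin j p : linear (P j p).
Proof.
case: p => p /=; first by apply: goexp_lin; exact: pos_lin.
by move=> a u v; rewrite scaler0 addr0.
Qed.

Lemma Q_lin j q : linear (Q j q).
Proof. by apply: goexp_lin; exact: neg_lin. Qed.

Lemma P_comm (T : M -> M) j p v : linear T ->
  (forall i v, T (C (- i.+1%:Z) v) = C (- i.+1%:Z) (T v)) -> T (P j p v) = P j p (T v).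
Proof.
move=> lT hT; case: p => p /=; last exact: lin0.
apply: goexp_comm => //; [exact: pos_lin | by move=> *; exact: pos_comm |].
by move=> i u; rewrite /pos_part (linZ lT) hT.
Qed.

Lemma Q_comm (T : M -> M) j q v : linear T ->
  (forall i v, T (C i.+1%:Z v) = C i.+1%:Z (T v)) -> T (Q j q v) = Q j q (T v).
Proof.
move=> lT hT; apply: goexp_comm => //; [exact: neg_lin | by move=> *; exact: neg_comm |].
by move=> i u; rewrite /neg_part (linZ lT) hT.
Qed.

Lemma CP n j p v : C n (P j p v) = P j p (C n v).
Proof. by apply: P_comm => // i u; exact: cC. Qed.

Lemma CQ n j q v : C n (Q j q v) = Q j q (C n v).
Proof. by apply: Q_comm => // i u; exact: cC. Qed.

Lemma SP k j p v : S k (P j p v) = P j p (S k v).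
Proof. by apply: P_comm => // i u; rewrite SC. Qed.

Lemma SQ k j q v : S k (Q j q v) = Q j q (S k v).
Proof. by apply: Q_comm => // i u; rewrite SC. Qed.

Lemma PQ j j' p q v : P j p (Q j' q v) = Q j' q (P j p v).
Proof. by apply: Q_comm => [|i u]; [exact: P_lin | rewrite CP]. Qed.

Lemma PP j j' p p' v : P j p (P j' p' v) = P j' p' (P j p v).
Proof. by apply: P_comm => [|i u]; [exact: P_lin | rewrite CP]. Qed.

Lemma QQ j j' q q' v : Q j q (Q j' q' v) = Q j' q' (Q j q v).
Proof. by apply: Q_comm => [|i u]; [exact: Q_lin | rewrite CQ]. Qed.

Lemma P_neg j p v : p < 0 -> P j p v = 0.
Proof. by case: p. Qed.

Lemma E_fin j e (v : M) : fin1 (fun q : nat => P j (e q) (Q j q v)).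
Proof. by have [N hN] := nilQ j v; exists N => q /hN ->; rewrite (lin0 (P_lin _ _)). Qed.

Lemma E_lin j n : linear (E j n).
Proof.
move=> a u v; rewrite /E -(fsZ _ (E_fin j (fun q => q%:Z - n - 1 + 2 * s * j) (S j u))).
rewrite -fsD; [|exact: (fin1Z (fun=> a) (E_fin _ _ _))|exact: E_fin].
by apply: eq_fs => q; rewrite lS Q_lin P_lin.
Qed.

Lemma E_field j : field (E j).
Proof.
split=> [n|v]; first exact: E_lin.
have [N hN] := nilQ j (S j v); exists (N%:Z + 2 * s * j) => n hn; apply: fs0 => q.
have [/hN ->|hq] := leqP N q; first exact: (lin0 (P_lin _ _)).
by apply: P_neg; lia.
Qed.

Lemma EE j j' m n v : E j m (E j' n v) =
  fs (fun q : nat => fs (fun q' : nat => P j (q%:Z - m - 1 + 2 * s * j)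
    (P j' (q'%:Z - n - 1 + 2 * s * j') (Q j q (Q j' q' (S (j + j') v)))))).
Proof.
apply: eq_fs => q; rewrite /gexp_field.
pose e (q' : nat) := q'%:Z - n - 1 + 2 * s * j'.
have f1 := E_fin j' e (S j' v).
rewrite (lin_fs (lS j) f1) (lin_fs (Q_lin j q)); last exact: (fin1_lin (lS j) f1).
rewrite (lin_fs (P_lin _ _)); last exact: (fin1_lin (Q_lin _ _) (fin1_lin (lS j) f1)).
by apply: eq_fs => q'; rewrite SP SQ SS -PQ.
Qed.

Lemma E_comm j j' m n v : E j m (E j' n v) = E j' n (E j m v).
Proof.
rewrite !EE [RHS]exchange_fs; last first.
  apply: fin2_rows => [|i].
    have [N hN] := nilQ j' (S (j' + j) v); exists N => i hi k.
    by rewrite QQ hN // (lin0 (Q_lin _ _)) (lin0 (P_lin _ _)) (lin0 (P_lin _ _)).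
  have [N hN] := nilQ j (S (j' + j) v); exists N => k hk.
  by rewrite hN // (lin0 (Q_lin _ _)) (lin0 (P_lin _ _)) (lin0 (P_lin _ _)).
apply: eq_fs => q; apply: eq_fs => q'.
by rewrite PP QQ [j + j']addrC.
Qed.

(** Exactly one factor fails to commute with [X m]: the shift for [m = 0], the creation half for
    [m > 0], the annihilation half for [m < 0]. Each produces the same multiple of the field. *)
Lemma E_comm_heis (X : int -> M -> M) (kappa : F) j m n v :
  (forall m, linear (X m)) ->
  (forall m n v, X m (C n v) - C n (X m v) = (if m + n == 0 then m%:~R * kappa else 0) *: v) ->
  (forall m j v, X m (S j v) - S j (X m v) = (if m == 0 then j%:~R * kappa else 0) *: S j v) ->
  X m (E j n v) - E j n (X m v) = (j%:~R * kappa) *: E j (m + n) v.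
Proof.
move=> lX XC XS.
have XC' a b u : a + b != 0 -> X a (C b u) = C b (X a u).
  by move=> h; apply/eqP; rewrite -subr_eq0 XC (negPf h) scale0r.
have XS' a i u : a != 0 -> X a (S i u) = S i (X a u).
  by move=> h; apply/eqP; rewrite -subr_eq0 XS (negPf h) scale0r.
pose e (q : nat) := q%:Z - n - 1 + 2 * s * j.
have f1 := E_fin j e (S j v).
rewrite /E (lin_fs (lX m) f1) -(fsB (fin1_lin (lX m) f1) (E_fin j e _)).
rewrite -(fsZ _ (E_fin j (fun q => q%:Z - (m + n) - 1 + 2 * s * j) (S j v))).
have [m0|m0|m0] := ltrgtP m 0; last first.
- subst m; apply: eq_fs => q; rewrite add0r.
  rewrite (P_comm _ _ _ (lX 0)) => [|i u]; last by rewrite XC'.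
  rewrite (Q_comm _ _ _ (lX 0)) => [|i u]; last by rewrite XC'.
  by rewrite -(linB (P_lin _ _)) -(linB (Q_lin _ _)) XS eqxx (linZ (Q_lin _ _)) (linZ (P_lin _ _)).
- case: m m0 f1 => [[|m]|m] // _ f1; apply: eq_fs => q.
  set u := Q j q (S j v).
  have Xu : X m.+1 u = Q j q (S j (X m.+1 v)).
    by rewrite /u Q_comm // => [|i w]; [rewrite XS'|rewrite XC'].
  suff XP p : X m.+1 (P j p u) = P j p (X m.+1 u) + (j%:~R * kappa) *: P j (p - m.+1%:Z) u.
    rewrite XP Xu [X in X - _]addrC addrK; congr (_ *: P j _ u); rewrite /e; lia.
  case: p => p; last first.
    by rewrite [in RHS](P_neg _ (p := _ - _)) //= (lin0 (lX _)) add0r scaler0.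
  rewrite /=; apply: goexp_commutator => //; [exact: pos_lin|by move=> *; exact: pos_comm|].
  move=> i w; rewrite /pos_part (linZ (lX _)).
  have hX := XC m.+1 (- i.+1%:Z) w; apply/eqP; rewrite [X in _ == X]addrC -subr_eq.
  rewrite -scalerBr hX scalerA; apply/eqP; congr (_ *: _).
  have -> : (m.+1%:Z + - i.+1%:Z == 0) = (i.+1 == m.+1) by apply/eqP/eqP; lia.
  case: eqP => [<-|]; last by rewrite mulr0.
  have h : i.+1%:R != 0 :> F by rewrite pnatr_eq0.
  by rewrite mulrACA mulVf // mul1r.
have [k hk] : exists k : nat, m = - k.+1%:Z by exists `|m|.-1; lia.
subst m.
have XQ q : X (- k.+1%:Z) (Q j q (S j v)) =
    Q j q (S j (X (- k.+1%:Z) v)) + (j%:~R * kappa) *: gexpz (neg_part j) (q%:Z - k.+1%:Z) (S j v).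
  rewrite -XS' //; apply: goexp_commutator => //; [exact: neg_lin|by move=> *; exact: neg_comm|].
  move=> i w; rewrite /neg_part (linZ (lX _)).
  have hX := XC (- k.+1%:Z) i.+1%:Z w; apply/eqP; rewrite [X in _ == X]addrC -subr_eq.
  rewrite -scalerBr hX scalerA; apply/eqP; congr (_ *: _).
  have -> : (- k.+1%:Z + i.+1%:Z == 0) = (i.+1 == k.+1) by apply/eqP/eqP; lia.
  case: eqP => [<-|]; last by rewrite mulr0.
  have h : i.+1%:R != 0 :> F by rewrite pnatr_eq0.
  by rewrite mulrACA rmorphN mulrNN mulVf // mul1r.
transitivity (fs (fun q : nat => (j%:~R * kappa) *: P j (e q) (gexpz (neg_part j) (q%:Z - k.+1%:Z) (S j v)))).
  apply: eq_fs => q; rewrite P_comm // => [|i u]; last by rewrite XC'.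
  by rewrite XQ (linD (P_lin _ _)) -(linZ (P_lin _ _)); apply/eqP; rewrite subr_eq [X in _ == X]addrC.
rewrite (fs_shift (k := k.+1)).
- apply: eq_fs => q; congr (_ *: P j _ _); first by rewrite /e; lia.
  by have -> : (k.+1 + q)%N%:Z - k.+1%:Z = q by lia.
- move=> i hi; rewrite (_ : gexpz (neg_part j) _ _ = 0) ?(lin0 (P_lin _ _)) ?scaler0 //.
  have hik : i%:Z - k.+1%:Z < 0 by lia.
  by case: (i%:Z - k.+1%:Z) hik.
- have [N hN] := nilQ j (S j v); exists (N + k.+1)%N => i hi.
  have -> : i%:Z - k.+1%:Z = (i - k.+1)%N by lia.
  by rewrite /= hN ?(lin0 (P_lin _ _)) ?scaler0 //; lia.
Qed.

Lemma sbN1 i : sb (-1) i = 1.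
Proof.
elim: i => [|i IH]; first by rewrite sb0.
by have := sb_pascal F (-1) i; rewrite addNr sb0S IH => /esym/eqP; rewrite subr_eq0 => /eqP.
Qed.

Lemma brN1E (A B : int -> M -> M) n v :
  br A B (-1) 0 n v =
  fs (fun i : nat => A (- i.+1%:Z) (B (n + i%:Z) v) + B (n - i.+1%:Z) (A i%:Z v)).
Proof.
apply: eq_fs => i; rewrite sbN1 scale1r (_ : (-1) ^ (-1) = -1 :> F); last first.
  by rewrite exprN1 invrN1.
rewrite scaleN1r opprK !add0r; congr (A _ _ + B _ _); lia.
Qed.

Lemma P_rec j p v : p%:~R *: P j p v =
  fs (fun i : nat => j%:~R *: C (- i.+1%:Z) (P j (p - i.+1%:Z) v)).
Proof.
case: p => p /=; last first.
  rewrite scaler0 fs0 // => i.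
  by rewrite ?P_neg // (lin0 (lC _)) scaler0.
rewrite goexp_rec; [|exact: pos_lin|by move=> *; exact: pos_comm].
rewrite (@fsE _ p) => [|i hi]; last first.
  by rewrite P_neg ?(lin0 (lC _)) ?scaler0 //; lia.
apply: eq_bigr => i _; rewrite {1}/pos_part scalerA mulrA.
have h : i.+1%:R != 0 :> F by rewrite pnatr_eq0.
rewrite divff // mul1r; congr (_ *: C _ _).
by have -> : p%:Z - i.+1%:Z = (p - i.+1)%N by have := ltn_ord i; lia.
Qed.

Lemma Q_rec j q v : q%:R *: Q j q v = - \sum_(i < q) j%:~R *: C i.+1%:Z (Q j (q - i.+1) v).
Proof.
rewrite goexp_rec; [|exact: neg_lin|by move=> *; exact: neg_comm].
rewrite -sumrN; apply: eq_bigr => i _; rewrite {1}/neg_part scalerA mulrA mulrN.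
have h : i.+1%:R != 0 :> F by rewrite pnatr_eq0.
by rewrite divff // mulN1r scaleNr.
Qed.

(* [D e^alpha = alpha(-1) e^alpha] *)
Lemma E_deriv j n v : - n%:~R *: E j (n - 1) v = j%:~R *: br C (E j) (-1) 0 n v.
Proof.
rewrite brN1E; set u := S j v; pose e : int := - n + 2 * s * j.
have hE k w : E j k w = fs (fun q : nat => P j (e + q%:Z + (n - 1 - k)) (Q j q (S j w))).
  by apply: eq_fs => q; congr (P j _ _); rewrite /e; lia.
have [K hK] := nilQ j u.
have Q0 q : (K <= q)%N -> Q j q u = 0 by exact: hK.
pose h1 (i q : nat) := C (- i.+1%:Z) (P j (e + q%:Z - i.+1%:Z) (Q j q u)).
pose h2 (i q : nat) := P j (e + q%:Z + i%:Z) (C i%:Z (Q j q u)).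
have f1 : fin2 h1.
  apply: fin2_cols => [|q].
    by exists K => q hq i; rewrite /h1 Q0 // (lin0 (P_lin _ _)) (lin0 (lC _)).
  exists (absz (e + q%:Z)) => i hi; rewrite /h1 P_neg ?(lin0 (lC _)) //; lia.
have f2 : fin2 h2.
  apply: fin2_cols => [|q].
    by exists K => q hq i; rewrite /h2 Q0 // (lin0 (lC _)) (lin0 (P_lin _ _)).
  have [N hN] := field_fin 0 (Q j q u) fC.
  exists N => i hi; have := hN i hi; rewrite add0r => h.
  by rewrite /h2 h (lin0 (P_lin _ _)).
transitivity (j%:~R *: (fs (fun i => fs (h1 i)) + fs (fun i => fs (h2 i)))); last first.
  congr (_ *: _); rewrite -(fsD (fin1_fs f1) (fin1_fs f2)); apply: eq_fs => i; congr (_ + _).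
    rewrite hE (lin_fs (lC _)); last exact: E_fin.
    by apply: eq_fs => q; rewrite /h1; congr (C _ (P j _ _)); lia.
  rewrite hE; apply: eq_fs => q; rewrite /h2 CQ SC; congr (P j _ _); lia.
rewrite scalerDr (exchange_fs f1) (fs_diag f2).
have fh1 q : fin1 (h1 ^~ q) by exact: fin1_fin2r.
(* Here [e + q] is the degree of the creation half, and its recursion yields the factor [e + q]. The
   recursion of the annihilation half together with [c(0) = - 2 s] yields [- 2 s j - q]. The two add
   up to [e - 2 s j = - n]. *)
have -> : j%:~R *: fs (fun q => fs (h1 ^~ q)) =
    fs (fun q : nat => (e + q%:Z)%:~R *: P j (e + q%:Z) (Q j q u)).
  rewrite -fsZ; last exact: fin1_fs (fin2C f1).
  by apply: eq_fs => q; rewrite P_rec -fsZ.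
have -> : j%:~R *: fs (fun q => \sum_(k < q.+1) h2 (q - k)%N k) =
    fs (fun q : nat => (- (2 * s * j) - q%:Z)%:~R *: P j (e + q%:Z) (Q j q u)).
  have [N hN] := f2; rewrite -fsZ; last first.
    exists N => q hq; rewrite big1 // => k _; apply: hN.
    by rewrite subnK // -ltnS.
  apply: eq_fs => q; rewrite big_ord_recr /= {2}/h2 subnn C0 addr0.
  have -> : \sum_(k < q) h2 (q - k)%N k = P j (e + q%:Z) (\sum_(k < q) C (q - k)%N%:Z (Q j k u)).
    rewrite (lin_sum (P_lin _ _)); apply: eq_bigr => k _; rewrite /h2; congr (P j _ _).
    by have := ltn_ord k; lia.
  have hq := Q_rec j q u.
  have -> : \sum_(k < q) C (q - k)%N%:Z (Q j k u) = \sum_(i < q) C i.+1%:Z (Q j (q - i.+1) u).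
    rewrite (reindex_inj rev_ord_inj) /=; apply: eq_bigr => i _.
    by rewrite subKn //; exact: ltn_ord.
  rewrite scalerDr -(linZ (P_lin _ _)) scaler_sumr.
  rewrite (_ : \sum_(i < q) _ = - (q%:R *: Q j q u)); last by rewrite hq opprK.
  rewrite (linN (P_lin _ _)) !(linZ (P_lin _ _)) scalerA -scaleNr -scalerDl; congr (_ *: _).
  by rewrite rmorphB rmorphN /= intrM rmorphM; ring.
rewrite -fsD; last 2 first.
- exact: (fin1Z _ (E_fin _ _ _)).
- exact: (fin1Z _ (E_fin _ _ _)).
rewrite hE -fsZ; last exact: E_fin.
apply: eq_fs => q; rewrite -scalerDl subrr addr0 -rmorphD; congr (_ *: _).
by rewrite -rmorphN; congr (_%:~R); rewrite /e; lia.
Qed.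

Lemma E0 n v : (forall v, S 0 v = v) -> E 0 n v = if n == -1 then v else 0.
Proof.
move=> S0.
have P0 p w : P 0 p w = if p == 0 then w else 0.
  case: p => p //=; rewrite goexp_eq0 // => i u.
  by rewrite /pos_part mulr0 scale0r.
have Q0 q w : Q 0 q w = if q == 0%N then w else 0.
  by rewrite goexp_eq0 // => i u; rewrite /neg_part mulr0 scale0r.
rewrite /E (fs_single (i0 := 0%N)) => [|q /negPf hq]; last first.
  by rewrite Q0 hq (lin0 (P_lin _ _)).
rewrite Q0 P0 S0 /= mulr0 addr0 -[Posz 0]/(0 : int) sub0r.
by rewrite -opprD oppr_eq0 addr_eq0.
Qed.

Lemma P_add j j' p v :
  \sum_(q < p.+1) P j q%:Z (P j' (p - q)%N%:Z v) = P (j + j') p v.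
Proof.
rewrite /= goexp_add; [|exact: pos_lin|exact: pos_lin|..]; try by move=> *; exact: pos_comm.
by apply: eq_goexp => i w; rewrite /pos_part -scalerDl intrD mulrDr.
Qed.

Lemma Q_add j j' p v :
  \sum_(q < p.+1) Q j q (Q j' (p - q) v) = Q (j + j') p v.
Proof.
rewrite /= goexp_add; [|exact: neg_lin|exact: neg_lin|..]; try by move=> *; exact: neg_comm.
by apply: eq_goexp => i w; rewrite /neg_part -scalerDl intrD mulrDr.
Qed.

(** The window [e - L < p <= e] contains all [p] from 0 to [T], and outside that range one of the
    two factors has negative degree. *)
Lemma P_conv j j' (e T : int) (L : nat) v : T <= e -> e < L%:Z ->
  \sum_(t < L) P j (e - t%:Z) (P j' (T - (e - t%:Z)) v) = P (j + j') T v.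
Proof.
case: T => T hT hL; last first.
  rewrite /= big1 // => t _; have [h|h] := ltP (e - t%:Z) 0; first by rewrite P_neg.
  by rewrite (P_neg j' (p := _ - _)) ?(lin0 (P_lin _ _)) //; lia.
case: e hT hL => // e hT hL; rewrite -P_add.
pose g (p : nat) := P j p%:Z (P j' (T%:Z - p%:Z) v).
transitivity (\sum_(t < e.+1) g (e - t)%N).
  rewrite (big_ord_widen_cond L xpredT (fun t => g (e - t)%N)) //= [LHS](bigID (fun t : 'I_L => (t < e.+1)%N)) /=.
  rewrite [X in _ + X]big1 ?addr0 => [|t ht]; last by rewrite P_neg //; lia.
  apply: eq_bigr => t ht; rewrite /g.
  by have -> : (e - t)%N%:Z = e%:Z - t%:Z by lia.
rewrite (reindex_inj rev_ord_inj) /=.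
transitivity (\sum_(p < e.+1) g p).
  by apply: eq_bigr => p _; rewrite subSS subKn // -ltnS.
transitivity (\sum_(p < T.+1) g p); last first.
  apply: eq_bigr => p _; rewrite /g.
  by have -> : T%:Z - p%:Z = (T - p)%N by have := ltn_ord p; lia.
rewrite [RHS](big_ord_widen_cond e.+1 xpredT g) //= [LHS](bigID (fun t : 'I_e.+1 => (t < T.+1)%N)) /=.
by rewrite [X in _ + X]big1 ?addr0 // => t ht; rewrite /g (P_neg j' (p := _ - _)) ?(lin0 (P_lin _ _)) //; lia.
Qed.

(** Since the two fields commute, their normally ordered product is the plain one, the sum of
    [E j a (E j' (n - 1 - a) v)] over all integers [a]. The two halves then multiply separately by
    the addition formula for exponentials. *)
Lemma E_prod j j' n v : br (E j) (E j') (-1) 0 n v = E (j + j') n v.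
Proof.
rewrite brN1E; set u := S (j + j') v.
pose w q q' := Q j q (Q j' q' u).
have [K1 hK1] := nilQ j u; have [K2 hK2] := nilQ j' u.
have w0 q q' : (K1 <= q)%N || (K2 <= q')%N -> w q q' = 0.
  case/orP=> h; rewrite /w; last by rewrite hK2 // (lin0 (Q_lin _ _)).
  by rewrite QQ hK1 // (lin0 (Q_lin _ _)).
pose K := (K1 + K2)%N.
have wK q q' : (K <= q + q')%N -> w q q' = 0.
  by move=> h; apply: w0; rewrite /K in h; lia.
pose f (a : int) := E j a (E j' (n - 1 - a) v).
pose h (a : int) (q q' : nat) := P j (q%:Z - a - 1 + 2 * s * j)
  (P j' (q'%:Z - (n - 1 - a) - 1 + 2 * s * j') (w q q')).
have fh a : fin2 (h a).
  by exists K => q q' hq; rewrite /h wK // (lin0 (P_lin _ _)) (lin0 (P_lin _ _)).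
have fE a : f a = fs (fun q => fs (h a q)) by rewrite /f EE.
pose N := (K + `|n| + 2 * `|s| * `|j| + 2 * `|s| * `|j'| + 2)%N.
have hsj : - (`|s| * `|j|)%N%:Z <= s * j <= (`|s| * `|j|)%N%:Z by nia.
have hsj' : - (`|s| * `|j'|)%N%:Z <= s * j' <= (`|s| * `|j'|)%N%:Z by nia.
have hbig a q q' : (N%:Z <= a) || (a < - N%:Z) -> h a q q' = 0.
  move=> ha; have [hq|hq] := leqP K (q + q'); first by rewrite /h wK // (lin0 (P_lin _ _)) (lin0 (P_lin _ _)).
  case/orP: ha => ha; rewrite /h; first by rewrite P_neg //; rewrite /N in ha; lia.
  by rewrite (P_neg j' (p := _ - _ - _ + _)) ?(lin0 (P_lin _ _)) //; rewrite /N in ha; lia.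
transitivity (\sum_(t < N + N) f (t%:Z - N%:Z)).
  have f0 a : (N%:Z <= a) || (a < - N%:Z) -> f a = 0.
    by move=> ha; rewrite fE; apply: fs0 => q; apply: fs0 => q'; apply: hbig.
  transitivity (fs (fun i : nat => f (- i.+1%:Z) + f i%:Z)).
    apply: eq_fs => i; rewrite /f [E j' _ (E j _ _)]E_comm.
    have -> : n - 1 - - i.+1%:Z = n + i%:Z by lia.
    by have -> : n - i.+1%:Z = n - 1 - i%:Z by lia.
  rewrite (@fsE _ N) => [|i hi]; last by rewrite !f0 ?addr0 //; lia.
  rewrite big_split [RHS]big_split_ord /=; congr (_ + _).
    rewrite (reindex_inj rev_ord_inj) /=; apply: eq_bigr => i _; congr (f _).
    by have := ltn_ord i; lia.
  by apply: eq_bigr => i _; congr (f _); lia.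
transitivity (fs (fun q => fs (fun q' => \sum_(t < N + N) h (t%:Z - N%:Z) q q'))).
  under eq_bigr => t _ do rewrite fE.
  rewrite -(@fs_sum _ 'I_(N + N) _ (fun t q => fs (h (t%:Z - N%:Z) q))) => [|t]; last exact: fin1_fs.
  apply: eq_fs => q.
  rewrite -(@fs_sum _ 'I_(N + N) _ (fun t q' => h (t%:Z - N%:Z) q q')) // => t.
  exact: fin1_fin2l.
pose T (i : nat) := i%:Z - n - 1 + 2 * s * (j + j').
transitivity (fs (fun q => fs (fun q' => P (j + j') (T (q + q')%N) (w q q')))).
  apply: eq_fs => q; apply: eq_fs => q'.
  have [hq|hq] := leqP K (q + q').
    rewrite wK // (lin0 (P_lin _ _)) big1 // => t _.
    by rewrite /h wK // (lin0 (P_lin _ _)) (lin0 (P_lin _ _)).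
  rewrite -(@P_conv j j' (q%:Z + N%:Z - 1 + 2 * s * j) _ (N + N)); last 2 first.
  - by rewrite /T mulrDr PoszD; rewrite /N; lia.
  - by rewrite /N; lia.
  apply: eq_bigr => t _; rewrite /h; congr (P j _ (P j' _ _)); first by lia.
  by rewrite /T mulrDr PoszD; lia.
rewrite fs_diag; last by exists K => q q' hq; rewrite wK // (lin0 (P_lin _ _)).
apply: eq_fs => i; rewrite -/u -[Q (j + j') i u]Q_add (lin_sum (P_lin _ _)).
rewrite (reindex_inj rev_ord_inj) /=; apply: eq_bigr => k _.
have hk : (k <= i)%N by rewrite -ltnS.
by rewrite subSS subKn // subnKC // /w.
Qed.

End ExponentialFields.

(** * Free fields *)

Section FreeField.
Variable F : numFieldType.
Local Notation binz := (@binz F).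
Local Notation sb := (@sb F).
Variable V : vaData F.
Variables (x1 : bool -> V) (e : int -> V) (ff : bool -> bool -> F) (kc : bool -> F).
Local Notation "a ._( n )" := (nprod V a n) (at level 2, format "a ._( n )").
Let c1 : V := x1 true + x1 false.

(* Free-field relations between the modes of the generators [x1] (Heisenberg)
   and [e] (exponentials of multiples of [c]). *)
Record free_field (M : lmodType F) (act : V -> int -> M -> M) : Prop := FreeField {
  ff_lin : forall n w, linear (fun a => act a n w);
  ff_field : forall a, field (act a);
  ff_vac : forall n w, act (vac V) n w = if n == -1 then w else 0;
  ff_heis : forall x y m n w, act (x1 x) m (act (x1 y) n w) - act (x1 y) n (act (x1 x) m w) =
    (if m + n == 0 then m%:~R * ff x y else 0) *: w;
  ff_heis_exp : forall x j m n w, act (x1 x) m (act (e j) n w) - act (e j) n (act (x1 x) m w) =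
    (j%:~R * kc x) *: act (e j) (m + n) w;
  ff_rec : forall x (p : nat) d q w, act ((x1 x)._(- p.+1%:Z) d) q w =
    br (act (x1 x)) (act d) (- p.+1%:Z) 0 q w;
  ff_exp_comm : forall j j' m n w, act (e j) m (act (e j') n w) = act (e j') n (act (e j) m w);
  ff_exp_prod : forall j j' n w, br (act (e j)) (act (e j')) (-1) 0 n w = act (e (j + j')) n w;
  ff_exp_deriv : forall j n w, - n%:~R *: act (e j) (n - 1) w =
    j%:~R *: br (act c1) (act (e j)) (-1) 0 n w }.

Hypothesis ffV : free_field (nprod V).
Hypothesis heis_exp : forall x j (t : nat),
  (x1 x)._(t%:Z) (e j) = (if t == 0%N then j%:~R * kc x else 0) *: e j.
Hypothesis heis_heis : forall x y (t : nat),
  (x1 x)._(t%:Z) (x1 y) = (if t == 1%N then ff x y else 0) *: vac V.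
Hypothesis exp_exp : forall j j' (t : nat), (e j)._(t%:Z) (e j') = 0.
Hypothesis exp_prod : forall j j', (e j)._(-1) (e j') = e (j + j').
Hypothesis kc0 : kc true + kc false = 0.
Hypothesis span : forall P : V -> Prop, P 0 ->
  (forall a u v, P u -> P v -> P (a *: u + v)) -> (forall j, P (e j)) ->
  (forall x (p : nat) v, P v -> P ((x1 x)._(- p.+1%:Z) v)) -> forall v, P v.

Let V_lin := ff_lin ffV.
Let V_field := ff_field ffV.

Section OneModule.
Variables (M : lmodType F) (act : V -> int -> M -> M).
Hypothesis ffM : free_field act.
Let act_lin := ff_lin ffM.
Let act_field := ff_field ffM.

(** Induction over the spanning set in the second argument; products [y_(-p-1) c] fall under
    [borch_closure2], where each [y_(t) x] is a multiple of the vacuum. *)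
Lemma borch_heis x d : borch act (x1 x) d.
Proof.
elim/span: d => [l|a u v hu hv l|j|y p c hc l].
- exact: borch_at_0r.
- exact: borch_at_lin2.
- apply: borch_intro => // [m n w|p n w]; last exact: (ff_rec ffM).
  rewrite br0E // (ff_heis_exp ffM) /bl (fs_single (i0 := 0%N)) => [|i /negPf hi].
    by rewrite binz0 scale1r add0r heis_exp eqxx (linZ (act_lin _ _)) -[Posz 0]/(0 : int) subr0.
  by rewrite add0r heis_exp hi scale0r (lin0 (act_lin _ _)) scaler0.
have hfs (U : lmodType F) (B : V -> int -> U -> U) r q w : free_field B ->
    fs (fun t : nat => binz r t *: B ((x1 y)._(t%:Z) (x1 x)) (q - t%:Z) w) =
    (if q == 0 then r%:~R * ff y x else 0) *: w.
  move=> fB; rewrite (fs_single (i0 := 1%N)) => [|t /negPf ht]; last first.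
    by rewrite heis_heis ht scale0r (lin0 (ff_lin fB _ _)) scaler0.
  rewrite heis_heis eqxx (linZ (ff_lin fB _ _)) (ff_vac fB) binz1.
  have -> : (q - 1 == -1) = (q == 0) by apply/eqP/eqP; lia.
  by case: eqP => _; rewrite ?scaler0 ?scale0r // scalerA.
apply: borch_closure2 => //.
- move=> q; have h := ff_heis ffV y x (- p.+1%:Z) q c.
  rewrite (hfs V (nprod V)) // -h opprB addrC subrK //.
- by move=> a b w; rewrite (ff_heis ffM) (hfs M act).
- by move=> d q w; exact: (ff_rec ffM).
- move=> t; rewrite heis_heis; apply: borch_at_scale => //.
  by apply: borch_vac => //; [exact: (ff_vac ffM)|exact: (ff_vac ffV)].
Qed.

Lemma borch_c1 d : borch act c1 d.
Proof.
by move=> l; rewrite /c1 -[x1 true]scale1r; apply: borch_at_lin1 => //; exact: borch_heis.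
Qed.

Lemma c1_exp (t : nat) j : c1._(t%:Z) (e j) = 0.
Proof.
rewrite /c1 (linD (V_lin _ _)) !heis_exp -scalerDl; case: eqP => _; last by rewrite addr0 scale0r.
by rewrite -mulrDr kc0 mulr0 scale0r.
Qed.

End OneModule.

Section Exponentials.
Variables (M : lmodType F) (act : V -> int -> M -> M).
Hypothesis ffM : free_field act.
Let act_lin := ff_lin ffM.
Let act_field := ff_field ffM.

(** Orders below -1 are reached by derivation: [j] times [c(-1) e_j] is the derivative of [e j], so
    the identity for [c(-1) e_j] at order [l], which [borch_closure1] provides, gives the one for
    [e j] at order [l - 1]. *)
Lemma borch_exp_exp j j' : borch act (e j) (e j').
Proof.
have h0 : borch_at act (e j) (e j') 0.
  move=> m n w; rewrite br0E // (ff_exp_comm ffM) subrr /bl fs0 // => i.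
  by rewrite add0r exp_exp (lin0 (act_lin _ _)) scaler0.
suff hneg (p : nat) : borch_at act (e j) (e j') (- p.+1%:Z).
  by apply: borch_intro => // p n w; apply: borch_iter.
elim: p => [|p IH].
  apply: borch_at_pred => // n w.
  by rewrite bl0E // exp_prod (ff_exp_prod ffM).
(* For [j = 0] the derivative relation says that [e 0] has no mode besides -1, so both sides vanish
   at orders below -1. *)
have [ej|j0] := eqVneq j 0.
  subst j; have e0 (U : lmodType F) (B : V -> int -> U -> U) q u : free_field B ->
      q != -1 -> B (e 0) q u = 0.
    move=> fB hq; have := ff_exp_deriv fB 0 (q + 1) u; rewrite scale0r addrK.
    move/eqP; rewrite scaler_eq0 oppr_eq0 intr_eq0 => /orP[h|/eqP //].
    by case/negP: hq; rewrite -subr_eq0 opprK.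
  apply: borch_at_pred => // [|n w]; first by have -> : - p.+2%:Z + 1 = - p.+1%:Z by lia.
  have h1 : (e 0)._(- p.+2%:Z) (e j') = 0 by apply: e0 => //; apply/eqP; lia.
  rewrite bl0E // h1 (lin0 (act_lin _ _)) /br fs0 // => i.
  rewrite (e0 M act) //; last by apply/eqP; lia.
  rewrite [act (e 0) _ w](e0 M act) //.
  by rewrite (lin0 (proj1 (act_field _) _)) scaler0 subr0 scaler0.
apply: borch_at_pred => //.
  by have -> : - p.+2%:Z + 1 = - p.+1%:Z by lia.
move=> n w; rewrite bl0E //.
pose l : int := - p.+1%:Z.
have hl : l%:~R != 0 :> F by rewrite intr_eq0 /l oppr_eq0.
have hd : borch_at act (c1._(-1) (e j)) (e j') l.
  apply: borch_closure1 => //.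
  - by move=> l'; apply: borch_iter => //; exact: (borch_c1 ffV).
  - by move=> d n' q u; apply: borch_iter => //; exact: borch_c1.
  - exact: borch_c1.
  - by move=> t; rewrite c1_exp; exact: borch_at_0r.
have h := borch_iter n w hd.
have -> : - p.+2%:Z = l - 1 by rewrite /l; lia.
have deriv (U : lmodType F) (B : V -> int -> U -> U) (ffB : free_field B) q u :
    j%:~R *: B (c1._(-1) (e j)) q u = - q%:~R *: B (e j) (q - 1) u.
  have hc : borch_at B c1 (e j) (-1) by exact: borch_c1.
  by rewrite (borch_iter q u hc) (ff_exp_deriv ffB).
have eL : j%:~R *: act ((c1._(-1) (e j))._(l) (e j')) n w =
    - l%:~R *: act ((e j)._(l - 1) (e j')) n w.
  by rewrite -(linZ (act_lin _ _)) (deriv V (nprod V) ffV) (linZ (act_lin _ _)).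
have eR : j%:~R *: br (act (c1._(-1) (e j))) (act (e j')) l 0 n w =
    - l%:~R *: br (act (e j)) (act (e j')) (l - 1) 0 n w.
  rewrite -br_deriv // -(fsZ _ (br_fin l 0 n w (act_field _) (act_field _))).
  apply: eq_fs => i; rewrite -!(deriv M act ffM) (linZ (proj1 (act_field _) _)).
  by rewrite !(scalerBr, scalerA); congr (_ *: _ - _ *: _); ring.
have hl' : - l%:~R != 0 :> F by rewrite oppr_eq0.
by apply: (scalerI hl'); rewrite -eL -eR h.
Qed.

Lemma borch_exp j b : borch act (e j) b.
Proof.
elim/span: b => [l|a u v hu hv l|j'|x p c hc l].
- exact: borch_at_0r.
- exact: borch_at_lin2.
- exact: borch_exp_exp.
have hfs (U : lmodType F) (B : V -> int -> U -> U) r q w : free_field B ->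
    fs (fun t : nat => binz r t *: B ((x1 x)._(t%:Z) (e j)) (q - t%:Z) w) =
    (j%:~R * kc x) *: B (e j) q w.
  move=> fB; rewrite (fs_single (i0 := 0%N)) => [|t /negPf ht]; last first.
    by rewrite heis_exp ht scale0r (lin0 (ff_lin fB _ _)) scaler0.
  by rewrite heis_exp eqxx (linZ (ff_lin fB _ _)) binz0 scale1r -[Posz 0]/(0 : int) subr0.
apply: borch_closure2 => //.
- move=> q; have h := ff_heis_exp ffV x j (- p.+1%:Z) q c.
  by rewrite (hfs V (nprod V)) // -h opprB addrC subrK.
- by move=> a b w; rewrite (ff_heis_exp ffM) (hfs M act).
- by move=> d q w; exact: (ff_rec ffM).
- by move=> t; rewrite heis_exp; apply: borch_at_scale => //; exact: hc.
Qed.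

(** Induction on the first argument, uniformly in [b]: [borch_closure1] calls for the identity at
    the vectors [x_(t) b] as well. *)
Theorem free_field_borch a b : borch act a b.
Proof.
elim/span: a b => [b l|k u v hu hv b l|j b|x p a ha b l].
- exact: borch_at_0l.
- by apply: borch_at_lin1 => //; [exact: hu|exact: hv].
- exact: borch_exp.
apply: borch_closure1 => //.
- by move=> l'; apply: borch_iter => //; exact: (borch_heis ffV).
- by move=> d n' q u; apply: borch_iter => //; exact: borch_heis.
- exact: borch_heis.
- exact: ha.
- by move=> t; exact: ha.
Qed.

End Exponentials.
End FreeField.

(** * Reordering of nested normally ordered products *)

Section NormalOrdering.
Variables (F : numFieldType) (M : lmodType F).
Local Notation sb := (@sb F).
Implicit Types (X Y B : int -> M -> M).

(** What Heisenberg fields retain of commutativity: negative modes commute with one another, and so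
    do nonnegative ones. *)
Definition half_commute X Y :=
  (forall i k v, X (Negz i) (Y (Negz k) v) = Y (Negz k) (X (Negz i) v)) /\
  (forall i k : nat, forall v, X i (Y k v) = Y k (X i v)).

(** At a negative order [br] is a normally ordered product: the first sum contains only negative
    modes of [X], acting last, and the second only nonnegative ones, acting first. *)
Lemma br_split X B (p : nat) n v : field X -> field B ->
  br X B (- p.+1%:Z) 0 n v =
  fs (fun i : nat => sb (- p.+1%:Z) i *: X (Negz (p + i)) (B (n + i%:Z) v)) +
  fs (fun i : nat => ((-1) ^+ p * sb (- p.+1%:Z) i) *: B (n - (p + i).+1%:Z) (X i v)).
Proof.
move=> fX fB.
have f1 : fin1 (fun i : nat => sb (- p.+1%:Z) i *: X (Negz (p + i)) (B (n + i%:Z) v)).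
  apply: fin1Z; have [N hN] := field_fin n v fB; exists N => i hi.
  by rewrite hN // (lin0 (proj1 fX _)).
have f2 : fin1 (fun i : nat => ((-1) ^+ p * sb (- p.+1%:Z) i) *: B (n - (p + i).+1%:Z) (X i v)).
  apply: fin1Z; have [N hN] := field_fin 0 v fX; exists N => i /hN; rewrite add0r => ->.
  exact: (lin0 (proj1 fB _)).
rewrite -(fsD f1 f2).
apply: eq_fs => i; rewrite scalerBr !add0r; congr (_ + _).
  by have -> : - p.+1%:Z - i%:Z = Negz (p + i) by rewrite NegzE; lia.
rewrite -scaleNr scalerA.
have -> : n - (p + i).+1%:Z = n + - p.+1%:Z - i%:Z by lia.
congr (_ *: _); rewrite mulNr mulrC -mulNr; congr (_ * _).
by rewrite -exprz_inv invrN1 -exprnP exprS mulN1r opprK.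
Qed.

(** The field of a Fock basis vector is a fold over the enumeration of a multiset, and inserting an
    element changes the enumeration in an uncontrolled way; this symmetry makes the field
    independent of it. Exchanging [X] and [Y] permutes the four sums [T1] to [T4]. *)
Lemma br_swap X Y B (p q : nat) : field X -> field Y -> field B -> half_commute X Y ->
  br X (br Y B (- q.+1%:Z) 0) (- p.+1%:Z) 0 = br Y (br X B (- p.+1%:Z) 0) (- q.+1%:Z) 0.
Proof.
move=> fX fY fB [c1 c2]; apply/funext => n; apply/funext => v.
pose a i := sb (- p.+1%:Z) i; pose a' i := (-1) ^+ p * a i.
pose b i := sb (- q.+1%:Z) i; pose b' i := (-1) ^+ q * b i.
have lX k := proj1 fX k; have lY k := proj1 fY k; have lB k := proj1 fB k.
have [NX hX] := field_fin 0 v fX; have [NY hY] := field_fin 0 v fY.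
have X0 (i : nat) : (NX <= i)%N -> X i v = 0 by move=> /hX; rewrite add0r.
have Y0 (i : nat) : (NY <= i)%N -> Y i v = 0 by move=> /hY; rewrite add0r.
pose T1 (i k : nat) := (a i * b k) *: X (Negz (p + i)) (Y (Negz (q + k)) (B (n + i%:Z + k%:Z) v)).
pose T2 (i k : nat) := (a i * b' k) *: X (Negz (p + i)) (B (n + i%:Z - (q + k).+1%:Z) (Y k v)).
pose T3 (i k : nat) := (a' i * b k) *: Y (Negz (q + k)) (B (n - (p + i).+1%:Z + k%:Z) (X i v)).
pose T4 (i k : nat) := (a' i * b' k) *: B (n - (p + i).+1%:Z - (q + k).+1%:Z) (Y k (X i v)).
have f1 : fin2 T1.
  have [K hK] := field_fin n v fB; exists K => i k hik.
  have e : B (n + i%:Z + k%:Z) v = 0 by rewrite -addrA; exact: hK.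
  by rewrite /T1 e (lin0 (lY _)) (lin0 (lX _)) scaler0.
have f2 : fin2 T2.
  apply: fin2_cols => [|k].
    by exists NY => k hk i; rewrite /T2 Y0 // (lin0 (lB _)) (lin0 (lX _)) scaler0.
  have [K hK] := field_fin (n - (q + k).+1%:Z) (Y k v) fB; exists K => i /hK e.
  have {}e : B (n + i%:Z - (q + k).+1%:Z) (Y k v) = 0 by rewrite addrAC.
  by rewrite /T2 e (lin0 (lX _)) scaler0.
have f3 : fin2 T3.
  apply: fin2_rows => [|i].
    by exists NX => i hi k; rewrite /T3 X0 // (lin0 (lB _)) (lin0 (lY _)) scaler0.
  have [K hK] := field_fin (n - (p + i).+1%:Z) (X i v) fB; exists K => k /hK e.
  by rewrite /T3 e (lin0 (lY _)) scaler0.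
have f4 : fin2 T4.
  apply: fin2_rows => [|i].
    by exists NX => i hi k; rewrite /T4 X0 // (lin0 (lY _)) (lin0 (lB _)) scaler0.
  have [K hK] := field_fin 0 (X i v) fY; exists K => k; move=> /hK; rewrite add0r => e.
  by rewrite /T4 e (lin0 (lB _)) scaler0.
have expand X' Y' (p' q' : nat) : field X' -> field Y' ->
  br X' (br Y' B (- q'.+1%:Z) 0) (- p'.+1%:Z) 0 n v =
  fs (fun i : nat => fs (fun k : nat => (sb (- p'.+1%:Z) i * sb (- q'.+1%:Z) k) *:
      X' (Negz (p' + i)) (Y' (Negz (q' + k)) (B (n + i%:Z + k%:Z) v))) +
    fs (fun k : nat => (sb (- p'.+1%:Z) i * ((-1) ^+ q' * sb (- q'.+1%:Z) k)) *:
      X' (Negz (p' + i)) (B (n + i%:Z - (q' + k).+1%:Z) (Y' k v)))) +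
  fs (fun i : nat => fs (fun k : nat => (((-1) ^+ p' * sb (- p'.+1%:Z) i) * sb (- q'.+1%:Z) k) *:
      Y' (Negz (q' + k)) (B (n - (p' + i).+1%:Z + k%:Z) (X' i v))) +
    fs (fun k : nat => (((-1) ^+ p' * sb (- p'.+1%:Z) i) * ((-1) ^+ q' * sb (- q'.+1%:Z) k)) *:
      B (n - (p' + i).+1%:Z - (q' + k).+1%:Z) (Y' k (X' i v)))).
  move=> fX' fY'; rewrite br_split //; last exact: br_field.
  have g1 m u : fin1 (fun i : nat => sb (- q'.+1%:Z) i *: Y' (Negz (q' + i)) (B (m + i%:Z) u)).
    by apply: fin1Z; have [N hN] := field_fin m u fB; exists N => i hi; rewrite hN // (lin0 (proj1 fY' _)).
  have g2 m u : fin1 (fun i : nat => ((-1) ^+ q' * sb (- q'.+1%:Z) i) *: B (m - (q' + i).+1%:Z) (Y' i u)).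
    apply: fin1Z; have [N hN] := field_fin 0 u fY'; exists N => i /hN; rewrite add0r => ->.
    exact: (lin0 (lB _)).
  congr (_ + _); apply: eq_fs => i; rewrite br_split //.
    rewrite (linD (proj1 fX' _)) scalerDr; congr (_ + _).
      rewrite (lin_fs (proj1 fX' _)) // -fsZ; last exact: (fin1_lin (proj1 fX' _)).
      by apply: eq_fs => k; rewrite (linZ (proj1 fX' _)) scalerA.
    rewrite (lin_fs (proj1 fX' _)) // -fsZ; last exact: (fin1_lin (proj1 fX' _)).
    by apply: eq_fs => k; rewrite (linZ (proj1 fX' _)) scalerA.
  rewrite scalerDr; congr (_ + _); rewrite -fsZ //; apply: eq_fs => k; by rewrite scalerA.
have -> : br X (br Y B (- q.+1%:Z) 0) (- p.+1%:Z) 0 n v =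
    fs (fun i => fs (T1 i)) + fs (fun i => fs (T2 i)) + (fs (fun i => fs (T3 i)) + fs (fun i => fs (T4 i))).
  rewrite -(fsD (fin1_fs f1) (fin1_fs f2)) -(fsD (fin1_fs f3) (fin1_fs f4)).
  exact: expand.
have -> : br Y (br X B (- p.+1%:Z) 0) (- q.+1%:Z) 0 n v =
    fs (fun i => fs (T1 ^~ i)) + fs (fun i => fs (T3 ^~ i)) + (fs (fun i => fs (T2 ^~ i)) + fs (fun i => fs (T4 ^~ i))).
  rewrite -(fsD (fin1_fs (fin2C f1)) (fin1_fs (fin2C f3))) -(fsD (fin1_fs (fin2C f2)) (fin1_fs (fin2C f4))).
  rewrite (expand Y X) //; congr (_ + _); apply: eq_fs => i; congr (_ + _); apply: eq_fs => k.
  - rewrite /T1 /a /b c1; have -> : n + k%:Z + i%:Z = n + i%:Z + k%:Z by lia.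
    by rewrite [sb (- p.+1%:Z) k * _]mulrC.
  - rewrite /T3 /a' /a /b; have -> : n - (p + k).+1%:Z + i%:Z = n + i%:Z - (p + k).+1%:Z by lia.
    by rewrite [_ * sb (- q.+1%:Z) i]mulrC.
  - rewrite /T2 /b' /a /b; have -> : n + k%:Z - (q + i).+1%:Z = n - (q + i).+1%:Z + k%:Z by lia.
    by rewrite [sb (- p.+1%:Z) k * _]mulrC.
  - rewrite /T4 /a' /b' /a /b c2.
    have -> : n - (p + k).+1%:Z - (q + i).+1%:Z = n - (q + i).+1%:Z - (p + k).+1%:Z by lia.
    by rewrite [((-1) ^+ p * _) * _]mulrC.
rewrite -(exchange_fs f1) -(exchange_fs f2) -(exchange_fs f3) -(exchange_fs f4).
by rewrite addrACA.
Qed.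

End NormalOrdering.

Local Open Scope mset_scope.

(** * Fock modules *)

Section Degree.

Definition mdeg (A : {mset (bool * nat)%type}) : nat :=
  \sum_(y <- enum_mset A) y.2.+1.

Lemma perm_enum_mset1D (y : bool * nat) (A : {mset (bool * nat)%type}) :
  perm_eq (enum_mset (y +` A)) (y :: enum_mset A).
Proof.
have -> : y +` A = seq_mset (y :: enum_mset A).
  by apply/msetP => z; rewrite mset_seqE mset1DE /= count_mem_mset eq_sym.
exact: perm_eq_seq_mset.
Qed.

Lemma mdeg1D y A : mdeg (y +` A) = (y.2.+1 + mdeg A)%N.
Proof. by rewrite /mdeg (perm_big _ (perm_enum_mset1D y A)) big_cons. Qed.

Lemma mdeg0 : mdeg mset0 = 0%N.
Proof. by rewrite /mdeg enum_mset0 big_nil. Qed.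

Lemma mset_ind1 (P : {mset (bool * nat)%type} -> Prop) :
  P mset0 -> (forall y A, P A -> P (y +` A)) -> forall A, P A.
Proof.
move=> h0 h1 A; rewrite -(seq_mset_id A).
elim: (enum_mset A) => [|y l IH].
  by rewrite (_ : seq_mset [::] = mset0) //; apply/msetP => z; rewrite mset_seqE mset0E.
rewrite (_ : seq_mset (y :: l) = y +` seq_mset l); first exact: h1.
by apply/msetP => z; rewrite mset1DE !mset_seqE /= eq_sym.
Qed.

Lemma mdeg_eq0 A : mdeg A = 0%N -> A = mset0.
Proof. by elim/mset_ind1: A => // y A _; rewrite mdeg1D. Qed.

End Degree.

Section FormValues.
Variable F : numClosedFieldType.
Local Notation form := (@Defs.form F).

Definition ff (x y : bool) : F := form (hvec F x) (hvec F y).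
(* [kc x] is [<x, c>] for the isotropic vector [c = gamma + delta]. *)
Definition kc (x : bool) : F := if x then 2 else -2.
Definition h0 (s : int) (r : F) (x : bool) (j : int) : F := form (hvec F x) (wt s r j).

Lemma ffE x y : ff x y = if x == y then kc x else 0.
Proof.
have e (a b c d : F) : form (a, b) (c, d) = 2 * a * c - 2 * b * d by [].
by case: x; case: y; rewrite /ff /hvec /gam /del e /kc /=; ring.
Qed.

Lemma h0E s r x j :
  h0 s r x j = if x then 2 * (r + j%:~R) else - (2 * (s%:~R + (r + j%:~R))).
Proof.
have ew : wt s r j = (s%:~R * 0 + (r + j%:~R) * (1 + 0), s%:~R * 1 + (r + j%:~R) * (0 + 1)) :> F * F.
  by [].
have e (a b c d : F) : form (a, b) (c, d) = 2 * a * c - 2 * b * d by [].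
by rewrite /h0 ew; case: x; rewrite /hvec /gam /del e; ring.
Qed.

End FormValues.

Section FockSpace.
Variable F : numClosedFieldType.

(* The Fock module of highest weights [s delta + (r + j)(gamma + delta)], on
   an abstract space with basis [bas]: [H true], [H false] are the modes of
   [gamma], [delta], and [S j] shifts the exponent by [j]. *)
Record fock_space (M : lmodType F) (s : int) (r : F) (bas : fockBasis -> M)
    (H : bool -> int -> M -> M) (S : int -> M -> M) : Prop := FockSpace {
  fk_ind : forall P : M -> Prop, P 0 ->
    (forall (a : F) u v, P u -> P v -> P (a *: u + v)) -> (forall b, P (bas b)) ->
    forall v, P v;
  fk_linH : forall x n, linear (H x n);
  fk_linS : forall j, linear (S j);
  fk_crea : forall x p b, H x (Negz p) (bas b) = bas (b.1, (x, p) +` b.2);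
  fk_zero : forall x b, H x 0 (bas b) = h0 s r x b.1 *: bas b;
  fk_ann : forall x (p : nat) b, H x p.+1%:Z (bas b) =
    (p.+1%:R * ff F x x * (b.2 (x, p))%:R) *: bas (b.1, b.2 `\ (x, p));
  fk_shift : forall j b, S j (bas b) = bas (b.1 + j, b.2) }.

Variables (M : lmodType F) (s : int) (r : F) (bas : fockBasis -> M).
Variables (H : bool -> int -> M -> M) (S : int -> M -> M).
Hypothesis fkM : fock_space s r bas H S.
Let linH := fk_linH fkM.
Let linS := fk_linS fkM.

Lemma fk_ext (f g : M -> M) : linear f -> linear g ->
  (forall b, f (bas b) = g (bas b)) -> forall v, f v = g v.
Proof.
move=> lf lg h; apply: (fk_ind fkM) => [|a u v hu hv|//]; first by rewrite (lin0 lf) (lin0 lg).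
by rewrite lf lg hu hv.
Qed.

Lemma lin_id : linear (@id M). Proof. by []. Qed.

Lemma lin_comp (f g : M -> M) : linear f -> linear g -> linear (fun v => f (g v)).
Proof. by move=> lf lg a u v; rewrite lg lf. Qed.

Lemma lin_sub (f g : M -> M) : linear f -> linear g -> linear (fun v => f v - g v).
Proof. by move=> lf lg a u v; rewrite lf lg scalerBr opprD addrACA. Qed.

Lemma lin_add (f g : M -> M) : linear f -> linear g -> linear (fun v => f v + g v).
Proof. by move=> lf lg a u v; rewrite lf lg scalerDr addrACA. Qed.

Lemma lin_scale (c : F) (f : M -> M) : linear f -> linear (fun v => c *: f v).
Proof. by move=> lf a u v; rewrite lf scalerDr !scalerA mulrC. Qed.

Lemma ann_crea x y (p q : nat) b :
  H x p.+1%:Z (H y (Negz q) (bas b)) - H y (Negz q) (H x p.+1%:Z (bas b)) =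
  (if p == q then p.+1%:R * ff F x y else 0) *: bas b.
Proof.
rewrite (fk_crea fkM) !(fk_ann fkM) (linZ (linH _ _)) (fk_crea fkM) /= mset1DE.
set k := p.+1%:R * ff F x x; case: b => j A /=.
(* Removing an absent element does nothing, so removal and insertion commute only if [(x, p)] occurs
   in [A]; otherwise the multiplicity in the coefficient is 0. *)
have eA : (0 < A (x, p))%N -> (y, q) +` (A `\ (x, p)) = ((y, q) +` A) `\ (x, p).
  move=> hA; apply/msetP => z; rewrite !(mset1DE, msetB1E).
  by have [->|_] := eqVneq z (x, p); [move: hA|]; move: (A _) (_ == _) => a []; lia.
have [exy|nxy] := eqVneq (x, p) (y, q).
  case: exy => <- <-; rewrite eqxx natrD mulrDr scalerDl mulr1 msetD1K -addrA.
  suff -> : (k * (A (x, p))%:R) *: bas (j, A) - (k * (A (x, p))%:R) *: bas (j, (x, p) +` (A `\ (x, p))) = 0.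
    by rewrite addr0.
  case: (posnP (A (x, p))) => [->|hA]; first by rewrite mulr0 !scale0r subrr.
  by rewrite msetB1K ?subrr // -mset_gt0.
rewrite add0n.
have -> : (k * (A (x, p))%:R) *: bas (j, ((y, q) +` A) `\ (x, p)) -
    (k * (A (x, p))%:R) *: bas (j, (y, q) +` (A `\ (x, p))) = 0.
  case: (posnP (A (x, p))) => [->|hA]; first by rewrite mulr0 !scale0r subrr.
  by rewrite eA // subrr.
rewrite ffE; case: (eqVneq p q) nxy => [->|_ _]; last by rewrite scale0r.
by case: (eqVneq x y) => [->|_ _]; rewrite ?eqxx // mulr0 scale0r.
Qed.

Lemma H_comm x y m n v : H x m (H y n v) - H y n (H x m v) =
  (if m + n == 0 then m%:~R * ff F x y else 0) *: v.
Proof.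
apply: (fk_ext (f := fun v => H x m (H y n v) - H y n (H x m v))
  (g := fun v => (if m + n == 0 then m%:~R * ff F x y else 0) *: v)) v.
- by apply: lin_sub; apply: lin_comp.
- by apply: lin_scale; exact: lin_id.
case=> j A.
case: m => [[|p]|p]; case: n => [[|q]|q].
- by rewrite !(fk_zero fkM) !(linZ (linH _ _)) !(fk_zero fkM) addr0 eqxx mul0r scale0r !scalerA mulrC subrr.
- by rewrite !(fk_zero fkM, fk_ann fkM, linZ (linH _ _)) /= scale0r !scalerA mulrC subrr.
- by rewrite !(fk_zero fkM, fk_crea fkM, linZ (linH _ _)) /= scale0r subrr.
- by rewrite !(fk_zero fkM, fk_ann fkM, linZ (linH _ _)) /= scale0r !scalerA mulrC subrr.
- rewrite !(fk_ann fkM, linZ (linH _ _)) /= scale0r !scalerA.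
  have -> : (A `\ (x, p)) `\ (y, q) = (A `\ (y, q)) `\ (x, p).
    by apply/msetP => z; rewrite !msetB1E subnAC.
  rewrite -scalerBl; apply/eqP; rewrite scaler_eq0; apply/orP; left; rewrite subr_eq0 !msetB1E.
  apply/eqP; case: (eqVneq (x, p) (y, q)) => [[-> ->]|_]; first by ring.
  by rewrite !subn0; ring.
- rewrite ann_crea; congr (_ *: _).
  by have -> : (p.+1%:Z + Negz q == 0) = (p == q) by apply/eqP/eqP; lia.
- by rewrite !(fk_zero fkM, fk_crea fkM, linZ (linH _ _)) /= scale0r subrr.
- rewrite -opprB ann_crea -scaleNr; congr (_ *: _).
  have -> : (Negz p + q.+1%:Z == 0) = (q == p) by apply/eqP/eqP; lia.
  case: eqP => [->|_]; last by rewrite oppr0.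
  by rewrite NegzE rmorphN /= mulNr !ffE eq_sym; case: eqP => [->|//].
- rewrite !(fk_crea fkM) /= scale0r msetDCA subrr //.
Qed.

Definition Cm (n : int) (v : M) : M := H true n v + H false n v.

Lemma linC n : linear (Cm n).
Proof. by apply: lin_add. Qed.

Lemma ff_kc x : ff F x true + ff F x false = kc F x.
Proof. by rewrite !ffE; case: x; rewrite ?addr0 ?add0r. Qed.

Lemma kc0 : kc F true + kc F false = 0.
Proof. exact: subrr. Qed.

Lemma H_C x m n v : H x m (Cm n v) - Cm n (H x m v) =
  (if m + n == 0 then m%:~R * kc F x else 0) *: v.
Proof.
rewrite /Cm (linD (linH _ _)) opprD addrACA !H_comm -scalerDl; congr (_ *: _).
by case: eqP => _; rewrite ?addr0 // -mulrDr ff_kc.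
Qed.

Lemma C_comm m n v : Cm m (Cm n v) = Cm n (Cm m v).
Proof.
have -> : Cm m (Cm n v) = H true m (Cm n v) + H false m (Cm n v) by [].
have -> : Cm n (Cm m v) = Cm n (H true m v) + Cm n (H false m v).
  by rewrite -(linD (linC n)).
apply/eqP; rewrite -subr_eq0 opprD addrACA !H_C -scalerDl; apply/eqP.
by case: eqP => _; rewrite ?addr0 ?scale0r // -mulrDr kc0 mulr0 scale0r.
Qed.

Lemma S_add j j' v : S j (S j' v) = S (j + j') v.
Proof.
apply: (fk_ext (f := fun v => S j (S j' v))) => //; first exact: lin_comp.
by move=> b; rewrite !(fk_shift fkM) /= -addrA [j' + j]addrC.
Qed.

Lemma S_0 v : S 0 v = v.
Proof.
apply: (fk_ext (g := id)) => //.
by move=> [j A]; rewrite (fk_shift fkM) addr0.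
Qed.

Lemma H_S x m j v : H x m (S j v) - S j (H x m v) =
  (if m == 0 then j%:~R * kc F x else 0) *: S j v.
Proof.
apply: (fk_ext (f := fun v => H x m (S j v) - S j (H x m v))
  (g := fun v => (if m == 0 then j%:~R * kc F x else 0) *: S j v)).
- by apply: lin_sub; apply: lin_comp.
- exact: lin_scale.
move=> [i A]; rewrite !(fk_shift fkM) /=.
case: m => [[|p]|p].
- rewrite !(fk_zero fkM) (linZ (linS _)) (fk_shift fkM) /= -scalerBl; congr (_ *: _).
  by rewrite !h0E intrD /kc; case: x; ring.
- by rewrite !(fk_ann fkM) (linZ (linS _)) (fk_shift fkM) subrr scale0r.
- by rewrite !(fk_crea fkM) (fk_shift fkM) subrr scale0r.
Qed.

Lemma C_S n j v : Cm n (S j v) = S j (Cm n v).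
Proof.
apply/eqP; rewrite -subr_eq0 /Cm (linD (linS _)) opprD addrACA !H_S -scalerDl; apply/eqP.
by case: eqP => _; rewrite ?addr0 ?scale0r // -mulrDr kc0 mulr0 scale0r.
Qed.

Lemma C_0 v : Cm 0 v = - (2 * s)%:~R *: v.
Proof.
apply: (fk_ext (f := Cm 0) (g := fun v => - (2 * s)%:~R *: v)); first exact: linC.
  by apply: lin_scale; exact: lin_id.
move=> b; rewrite /Cm !(fk_zero fkM) -scalerDl; congr (_ *: _).
by rewrite !h0E intrM; ring.
Qed.

(** Degrees are integers so that they can be shifted freely. A vector of negative degree is 0
    ([hd_neg]), and this is how truncation of fields and most vanishing statements are obtained. *)
Inductive hd (d : int) : M -> Prop :=
| hd0 : hd d 0
| hd_lin (a : F) u v : hd d u -> hd d v -> hd d (a *: u + v)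
| hd_bas (b : fockBasis) : (mdeg b.2)%:Z = d -> hd d (bas b).

Lemma hdZ d (a : F) v : hd d v -> hd d (a *: v).
Proof. by move=> h; rewrite -[_ *: _]addr0; apply: hd_lin => //; exact: hd0. Qed.

Lemma hdD d u v : hd d u -> hd d v -> hd d (u + v).
Proof. by move=> hu hv; rewrite -[u]scale1r; apply: hd_lin. Qed.

Lemma hd_sum d (I : eqType) (l : seq I) (f : I -> M) :
  (forall i, hd d (f i)) -> hd d (\sum_(i <- l) f i).
Proof. by move=> h; elim/big_rec: _ => [|i u _ hu]; [exact: hd0|exact: hdD]. Qed.

Lemma hd_fs d (f : nat -> M) : fin1 f -> (forall i, hd d (f i)) -> hd d (fs f).
Proof. by move=> [N hN] h; rewrite (fsE hN); apply: hd_sum. Qed.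

Lemma hd_neg d v : d < 0 -> hd d v -> v = 0.
Proof.
by move=> hlt; elim=> [//|a u w _ -> _ ->|b e]; [rewrite scaler0 addr0|lia].
Qed.

Lemma hd_span (P : M -> Prop) : P 0 ->
  (forall (a : F) u v, P u -> P v -> P (a *: u + v)) ->
  (forall (d : nat) v, hd d v -> P v) -> forall v, P v.
Proof. by move=> p0 pl ph; apply: (fk_ind fkM) => // b; apply: (ph (mdeg b.2)); apply: hd_bas. Qed.

Lemma hd_map (A : M -> M) (d d' : int) : linear A ->
  (forall b : fockBasis, (mdeg b.2)%:Z = d -> hd d' (A (bas b))) ->
  forall v, hd d v -> hd d' (A v).
Proof.
move=> lA hA v; elim=> [|a u w _ hu _ hw|//]; first by rewrite (lin0 lA); exact: hd0.
by rewrite lA; apply: hd_lin.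
Qed.

(* [shifts A beta]: the modes of [A] are those of a field of weight [beta]. *)
Definition shifts (A : int -> M -> M) (beta : int) : Prop :=
  forall d n v, hd d v -> hd (d + beta - n - 1) (A n v).

Lemma shifts_field A beta : (forall n, linear (A n)) -> shifts A beta -> field A.
Proof.
move=> lA sA; split=> //; apply: hd_span => [|a u v [N hN] [K hK]|d v hv].
- by exists 0 => n _; rewrite (lin0 (lA n)).
- by exists (`|N| + `|K|) => n hn; rewrite lA hN ?hK ?scaler0 ?addr0 //; lia.
- exists (d%:Z + beta) => n hn; apply: (@hd_neg (d%:Z + beta - n - 1)); first by lia.
  exact: sA.
Qed.

Lemma shifts_H x : shifts (H x) 1.
Proof.
move=> d n; apply: hd_map => // -[j A] /= hA.
case: n => [[|p]|p].
- by rewrite (fk_zero fkM); apply: hdZ; apply: hd_bas => /=; lia.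
- rewrite (fk_ann fkM) /=; case: (posnP (A (x, p))) => [->|hp].
    by rewrite mulr0 scale0r; exact: hd0.
  apply: hdZ; apply: hd_bas => /=.
  have e : mdeg A = (p.+1 + mdeg (A `\ (x, p)))%N.
    by rewrite -(mdeg1D (x, p)) msetB1K // -mset_gt0.
  by rewrite -hA e; lia.
- by rewrite (fk_crea fkM) /=; apply: hd_bas; rewrite /= mdeg1D -hA NegzE /=; lia.
Qed.

Lemma field_H x : field (H x).
Proof. by apply: (shifts_field (beta := 1)) => //; exact: shifts_H. Qed.

Lemma shifts_C : shifts Cm 1.
Proof. by move=> d n v hv; apply: hdD; apply: shifts_H. Qed.

Lemma field_C : field Cm.
Proof. by apply: (shifts_field (beta := 1)); [exact: linC|exact: shifts_C]. Qed.

Lemma hd_S j d v : hd d v -> hd d (S j v).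
Proof. by apply: hd_map => // b e; rewrite (fk_shift fkM); exact: hd_bas. Qed.

Lemma hd_gopow (A : nat -> M -> M) (sg : int) : (forall i, linear (A i)) ->
  (forall i d v, hd d v -> hd (d + sg * i%:Z) (A i v)) ->
  forall l p d v, hd d v -> hd (d + sg * p%:Z) (gopow A l p v).
Proof.
move=> lA hA; elim=> [|l IH] p d v hv /=.
  by case: eqP => [->|_]; [rewrite mulr0 addr0|exact: hd0].
apply: hd_sum => i; have hi := ltn_ord i.
have -> : d + sg * p%:Z = d + sg * (p - i.+1)%N%:Z + sg * i.+1%:Z.
  by rewrite -addrA -mulrDr; congr (_ + _ * _); lia.
by apply: hA; apply: IH.
Qed.

Lemma hd_goexp (A : nat -> M -> M) (sg : int) : (forall i, linear (A i)) ->
  (forall i d v, hd d v -> hd (d + sg * i%:Z) (A i v)) ->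
  forall p d v, hd d v -> hd (d + sg * p%:Z) (goexp A p v).
Proof. by move=> lA hA p d v hv; apply: hd_sum => i; apply: hdZ; apply: hd_gopow. Qed.

Lemma hd_neg_part j p d v : hd d v -> hd (d - p%:Z) (goexp (neg_part Cm j) p v).
Proof.
rewrite -mulN1r; apply: hd_goexp => [i|i e u hu]; first exact: (neg_lin field_C).
apply: hdZ; have -> : e + -1 * i%:Z = e + 1 - i%:Z - 1 by lia.
exact: shifts_C.
Qed.

Lemma hd_pos_part j p d v : hd d v -> hd (d + p) (gexpz (pos_part Cm j) p v).
Proof.
case: p => p hv /=; last exact: hd0.
rewrite -[p%:Z]mul1r; apply: hd_goexp hv => [i|i e u hu].
  exact: (pos_lin field_C).
apply: hdZ; have -> : e + 1 * i%:Z = e + 1 - (- i%:Z) - 1 by lia.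
exact: shifts_C.
Qed.

Lemma nil_neg_part j v : exists N, forall q, (N <= q)%N -> goexp (neg_part Cm j) q v = 0.
Proof.
have lQ q : linear (goexp (neg_part Cm j) q) by exact: (Q_lin field_C).
move: v; apply: hd_span => [|a u v [N hN] [K hK]|d v hv].
- by exists 0%N => q _; rewrite (lin0 (lQ q)).
- exists (N + K)%N => q hq; rewrite lQ hN ?hK ?scaler0 ?addr0 //; lia.
- exists d.+1 => q hq; apply: (@hd_neg (d%:Z - q%:Z)); first by lia.
  exact: hd_neg_part.
Qed.

Definition Ef (j : int) : int -> M -> M := gexp_field s Cm S j.

(** The annihilation half lowers the degree by [q] and the creation half raises it by
    [q - n - 1 + 2 s j]. The weight of an exponential field thus depends on the module, through
    [s]. *)
Lemma shifts_E j : shifts (Ef j) (2 * s * j).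
Proof.
move=> d n v hv; apply: hd_fs => [|q].
  exact: (E_fin field_C nil_neg_part j (fun q : nat => q%:Z - n - 1 + 2 * s * j)).
have -> : d + 2 * s * j - n - 1 = d - q%:Z + (q%:Z - n - 1 + 2 * s * j) by lia.
by apply: hd_pos_part; apply: hd_neg_part; apply: hd_S.
Qed.

Lemma field_E j : field (Ef j).
Proof. exact: (E_field s field_C linS nil_neg_part). Qed.

Lemma H_E x j m n v : H x m (Ef j n v) - Ef j n (H x m v) = (j%:~R * kc F x) *: Ef j (m + n) v.
Proof.
apply: (E_comm_heis s field_C C_comm nil_neg_part) => //.
- by move=> *; exact: H_C.
- by move=> *; exact: H_S.
Qed.

Lemma Ef_comm j j' m n v : Ef j m (Ef j' n v) = Ef j' n (Ef j m v).
Proof. exact: (E_comm s field_C C_comm linS S_add C_S nil_neg_part). Qed.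

Lemma Ef_prod j j' n v : br (Ef j) (Ef j') (-1) 0 n v = Ef (j + j') n v.
Proof. exact: (E_prod s field_C C_comm linS S_add C_S nil_neg_part). Qed.

Lemma Ef_deriv j n v : - n%:~R *: Ef j (n - 1) v = j%:~R *: br Cm (Ef j) (-1) 0 n v.
Proof. exact: (E_deriv field_C C_comm C_S C_0 nil_neg_part). Qed.

Lemma Ef0 n v : Ef 0 n v = if n == -1 then v else 0.
Proof. exact: (E0 s field_C n v S_0). Qed.

Lemma H_half_commute x y : half_commute (H x) (H y).
Proof.
have e m n v : m + n != 0 \/ m = 0 -> H x m (H y n v) = H y n (H x m v).
  move=> h; apply/eqP; rewrite -subr_eq0 H_comm; apply/eqP.
  by case: h => [/negPf ->|->]; rewrite ?mul0r ?if_same scale0r.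
split=> i k v; apply: e; first by left; apply/eqP; rewrite !NegzE; lia.
by case: i => [|i]; [right|left; apply/eqP; lia].
Qed.

Lemma shifts_br A B l a b : field A -> field B -> shifts A a -> shifts B b ->
  shifts (br A B l 0) (a + b - l - 1).
Proof.
move=> fA fB sA sB d n v hv; apply: hd_fs => [|i]; first exact: br_fin fA fB.
apply: hdZ; apply: hdD.
  have := sA _ (0 + l - i%:Z) _ (sB _ (n + i%:Z) _ hv).
  by have -> : d + b - (n + i%:Z) - 1 + a - (0 + l - i%:Z) - 1 = d + (a + b - l - 1) - n - 1 by lia.
rewrite -scaleNr; apply: hdZ; have := sB _ (n + l - i%:Z) _ (sA _ (0 + i%:Z) _ hv).
by have -> : d + a - (0 + i%:Z) - 1 + b - (n + l - i%:Z) - 1 = d + (a + b - l - 1) - n - 1 by lia.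
Qed.

(** The fold of [field_basis], with each normally ordered product of a divided derivative replaced
    by a [br] of negative order (see [normal_order_br]), to which the Borcherds machinery
    applies. *)
Definition Yl (j : int) (l : seq (bool * nat)) : int -> M -> M :=
  foldr (fun y B => br (H y.1) B (- y.2.+1%:Z) 0) (Ef j) l.

Definition Yf (b : fockBasis) : int -> M -> M := Yl b.1 (enum_mset b.2).

Lemma field_Yl j l : field (Yl j l).
Proof. by elim: l => [|y l IH] /=; [exact: field_E|apply: br_field => //; exact: field_H]. Qed.

Lemma field_Yf b : field (Yf b).
Proof. exact: field_Yl. Qed.

Lemma shifts_Yf b : shifts (Yf b) ((mdeg b.2)%:Z + 2 * s * b.1).
Proof.
rewrite /Yf /mdeg; elim: (enum_mset b.2) => [|y l IH] /=.
  by rewrite big_nil add0r; exact: shifts_E.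
have := @shifts_br _ _ (- y.2.+1%:Z) _ _ (field_H y.1) (field_Yl b.1 l) (shifts_H y.1) IH.
rewrite big_cons; set w := \sum_(z <- l) _.
by have -> : 1 + (w%:Z + 2 * s * b.1) - - y.2.+1%:Z - 1 = (y.2.+1 + w)%N%:Z + 2 * s * b.1 by lia.
Qed.

Lemma Yl_rem j y l : y \in l -> Yl j l = Yl j (y :: rem y l).
Proof.
elim: l => // z l IH; rewrite inE /=; have [-> //|nzy] := eqVneq y z.
move=> /= /IH e.
transitivity (br (H z.1) (Yl j (y :: rem y l)) (- z.2.+1%:Z) 0); first by rewrite -e.
apply: br_swap; [exact: field_H|exact: field_H|exact: field_Yl|].
exact: H_half_commute.
Qed.

Lemma Yl_perm j l l' : perm_eq l l' -> Yl j l = Yl j l'.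
Proof.
elim: l l' => [|y l IH] l' hl; first by have /perm_nilP -> : perm_eq l' [::] by rewrite perm_sym.
have hy : y \in l' by rewrite -(perm_mem hl) mem_head.
rewrite (Yl_rem j hy) /= (IH (rem y l')) //.
by rewrite -(perm_cons y) (perm_trans hl) // perm_to_rem.
Qed.

Lemma Yf_cons j y A : Yf (j, y +` A) = br (H y.1) (Yf (j, A)) (- y.2.+1%:Z) 0.
Proof. by rewrite /Yf /= (Yl_perm j (perm_enum_mset1D y A)). Qed.

Lemma Yf0 j : Yf (j, mset0) = Ef j.
Proof. by rewrite /Yf /= enum_mset0. Qed.

Lemma Yf_heis x : Yf (0, [mset (x, 0%N)]) = H x.
Proof.
rewrite -[[mset _]]msetD0 Yf_cons Yf0 /=; apply/funext => n; apply/funext => v.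
rewrite brN1E; case: n => n.
  rewrite (fs_single (i0 := n)) => [|i hi].
    rewrite !Ef0 (_ : (n%:Z + n%:Z == -1) = false); last by apply/eqP; lia.
    rewrite (_ : (n%:Z - n.+1%:Z == -1)); last by apply/eqP; lia.
    by rewrite (lin0 (linH _ _)) add0r.
  rewrite !Ef0 (_ : (n%:Z + i%:Z == -1) = false); last by apply/eqP; lia.
  rewrite (_ : (n%:Z - i.+1%:Z == -1) = false); last by apply/eqP; lia.
  by rewrite (lin0 (linH _ _)) add0r.
rewrite (fs_single (i0 := n)) => [|i hi].
  rewrite !Ef0 (_ : (Negz n + n%:Z == -1)); last by apply/eqP; lia.
  rewrite (_ : (Negz n - n.+1%:Z == -1) = false); last by apply/eqP; lia.
  by rewrite addr0.
rewrite !Ef0 (_ : (Negz n + i%:Z == -1) = false); last by apply/eqP; lia.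
rewrite (_ : (Negz n - i.+1%:Z == -1) = false); last by apply/eqP; lia.
by rewrite (lin0 (linH _ _)) add0r.
Qed.

End FockSpace.

(** * The Borcherds identity on Fock modules *)

Section FockModule.
Variables (F : numClosedFieldType) (V : vaData F).
Variables (basV : fockBasis -> V) (HV : bool -> int -> V -> V) (SV : int -> V -> V).
Hypothesis fkV : fock_space 0 0 basV HV SV.

Definition x1 (x : bool) : V := basV (0, [mset (x, 0%N)]).
Definition ex (j : int) : V := basV (j, mset0).

Section Action.
Variables (M : lmodType F) (s : int) (r : F) (bas : fockBasis -> M).
Variables (H : bool -> int -> M -> M) (S : int -> M -> M).
Hypothesis fkM : fock_space s r bas H S.
Variable act : V -> int -> M -> M.
Hypothesis act_lin : forall n w, linear (fun a => act a n w).
Hypothesis act_bas : forall b n w, act (basV b) n w = Yf s H S b n w.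

Lemma act_basE b : act (basV b) = Yf s H S b.
Proof. by apply/funext => n; apply/funext => w. Qed.

Lemma act_x1 x : act (x1 x) = H x.
Proof. by rewrite act_basE (Yf_heis fkM). Qed.

Lemma act_ex j : act (ex j) = Ef s H S j.
Proof. by rewrite act_basE Yf0. Qed.

Lemma act_field a : field (act a).
Proof.
elim/(fk_ind fkV): a => [|k a b [la ha] [lb hb]|b].
- split=> [n c u v|w]; first by rewrite !(lin0 (act_lin _ _)) scaler0 addr0.
  by exists 0 => n _; rewrite (lin0 (act_lin _ _)).
- split=> [n c u v|w].
    rewrite !act_lin la lb !scalerDr !scalerA addrACA; congr (_ *: _ + _ + _).
    by rewrite mulrC.
  have [N hN] := ha w; have [K hK] := hb w; exists (`|N| + `|K|) => n hn.
  by rewrite act_lin hN ?hK ?scaler0 ?addr0 //; lia.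
- by rewrite act_basE; exact: (field_Yf fkM b).
Qed.

End Action.

Hypothesis V_lin : forall n w, linear (fun a => nprod V a n w).
Hypothesis V_bas : forall b n w, nprod V (basV b) n w = Yf 0 HV SV b n w.
Hypothesis V_vac : vac V = ex 0.

Lemma fock_free_field (M : lmodType F) (s : int) (r : F) (bas : fockBasis -> M)
    (H : bool -> int -> M -> M) (S : int -> M -> M) (act : V -> int -> M -> M) :
  fock_space s r bas H S -> (forall n w, linear (fun a => act a n w)) ->
  (forall b n w, act (basV b) n w = Yf s H S b n w) ->
  free_field x1 ex (ff F) (kc F) act.
Proof.
move=> fkM act_lin act_bas.
have ax x : act (x1 x) = H x by exact: (act_x1 fkM act_bas).
have ae j : act (ex j) = Ef s H S j by exact: act_ex.
have fA a : field (act a) by exact: (act_field fkM act_lin act_bas).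
split=> //.
- by move=> n w; rewrite V_vac ae (Ef0 fkM).
- by move=> x y m n w; rewrite !ax (H_comm fkM).
- by move=> x j m n w; rewrite ax !ae (H_E fkM).
- move=> x p d q w.
  have fVx : nprod V (x1 x) = HV x by exact: (act_x1 fkV V_bas).
  rewrite fVx ax; move: d q w.
  apply: (fk_ind fkV) => [q w|k a b ha hb q w|[j A] q w].
  + rewrite (lin0 (fk_linH fkV _ _)) (lin0 (act_lin _ _)) /br fs0 // => i.
    by rewrite !(lin0 (act_lin _ _)) (lin0 (fk_linH fkM _ _)) scaler0 subr0 scaler0.
  + rewrite (fk_linH fkV) act_lin ha hb.
    have f1 := br_fin (- p.+1%:Z) 0 q w (field_H fkM x) (fA a).
    have f2 := br_fin (- p.+1%:Z) 0 q w (field_H fkM x) (fA b).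
    rewrite /br -(fsZ k f1) -(fsD (fin1Z (fun=> k) f1) f2).
    apply: eq_fs => i.
    have e (u v : M) d : k *: (d *: u) + d *: v = d *: (k *: u + v).
      by rewrite scalerDr !scalerA mulrC.
    rewrite e !act_lin (fk_linH fkM); congr (_ *: _).
    by rewrite scalerBr scalerDr opprD addrACA !scalerA [k * _]mulrC.
  + have -> : HV x (- p.+1%:Z) (basV (j, A)) = basV (j, (x, p) +` A).
      exact: (fk_crea fkV x p (j, A)).
    by rewrite act_bas (Yf_cons fkM) (act_basE act_bas).
- by move=> j j' m n w; rewrite !ae (Ef_comm fkM).
- by move=> j j' n w; rewrite !ae (Ef_prod fkM).
- move=> j n w; have ec : act (x1 true + x1 false) = Cm H.
    by apply/funext => m; apply/funext => v; rewrite (linD (act_lin _ _)) !ax.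
  by rewrite ec !ae (Ef_deriv fkM).
Qed.

Theorem fock_borch (M : lmodType F) (s : int) (r : F) (bas : fockBasis -> M)
    (H : bool -> int -> M -> M) (S : int -> M -> M) (act : V -> int -> M -> M) :
  fock_space s r bas H S -> (forall n w, linear (fun a => act a n w)) ->
  (forall b n w, act (basV b) n w = Yf s H S b n w) ->
  forall a b, borch act a b.
Proof.
move=> fkM act_lin act_bas.
have ffV := fock_free_field fkV V_lin V_bas.
have ffM := fock_free_field fkM act_lin act_bas.
have Vx x : nprod V (x1 x) = HV x by exact: (act_x1 fkV V_bas).
have Ve j : nprod V (ex j) = Ef 0 HV SV j by exact: act_ex.
have hexj j : hd basV 0 (ex j) by apply: hd_bas; rewrite /= mdeg0.
apply: (free_field_borch ffV) ffM => [x j t|x y t|j j' t|j j'||P p0 pl pe px].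
- rewrite Vx; case: t => [|t]; first by rewrite (fk_zero fkV) h0E /= !add0r /kc;
    case: x; congr (_ *: _); ring.
  by rewrite (fk_ann fkV) /= mset0E mulr0 !scale0r.
- rewrite Vx; case: t => [|t].
    rewrite (fk_zero fkV) h0E /= !addr0 mulr0 oppr0 if_same !scale0r //.
  rewrite (fk_ann fkV) /= msetnE V_vac; case: t => [|t] /=; last first.
    by rewrite (_ : ((x, t.+1) == (y, 0%N)) = false) ?mulr0 ?scale0r //; apply/eqP => -[].
  rewrite mul1r ffE eqxx; have [->|nxy] := eqVneq x y.
    rewrite eqxx mulr1 ffE eqxx /ex; congr (_ *: basV (_, _)).
    by apply/msetP => z; rewrite msetB1E msetnE mset0E subnn.
  rewrite (_ : ((x, 0%N) == (y, 0%N)) = false) ?mulr0 ?ffE ?(negPf nxy) ?scale0r //.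
  by apply/eqP => -[e]; rewrite e eqxx in nxy.
(* In the algebra itself [s = 0], so the [t]-th product of two exponentials has degree
   [- t - 1 < 0]. *)
- rewrite Ve; apply: (@hd_neg _ _ basV (0 + 2 * 0 * j - t%:Z - 1)); first by lia.
  exact: (shifts_E fkV j t (hexj j')).
- rewrite Ve /Ef /gexp_field (fs_single (i0 := 0%N)) => [|q hq].
    rewrite goexp0 /= mulr0 mul0r addr0 (_ : 0%:Z - -1 - 1 = 0%N) //= goexp0.
    by rewrite (fk_shift fkV) /= addrC.
  rewrite (_ : goexp _ _ _ = 0) ?(lin0 (P_lin (field_C fkV) _ _)) //.
  apply: (@hd_neg _ _ basV (0 - q%:Z)); first by lia.
  by apply: (hd_neg_part fkV); apply: (hd_S fkV).
- exact: kc0.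
- apply: (fk_ind fkV) => // -[j A]; elim/mset_ind1: A => [|[x p] A hA]; first exact: pe.
  have := px x p _ hA; rewrite Vx.
  by have -> : HV x (- p.+1%:Z) (basV (j, A)) = basV (j, (x, p) +` A) by exact: (fk_crea fkV x p (j, A)).
Qed.

End FockModule.

Local Close Scope mset_scope.

(** * Divided derivatives and products of negative order *)

Section NormalOrder.
Variables (F : numFieldType) (M : lmodType F).

Lemma sb_neg (q i : nat) : sb F (- q.+1%:Z) i = 'C(q + i, i)%:R.
Proof.
elim: i => [|i IH]; first by rewrite sb0 bin0.
have h : i.+1%:R != 0 :> F by rewrite pnatr_eq0.
apply: (mulfI h); rewrite /sb mulrCA binzS intS signD expr1z mulN1r mulNr.
have -> : - ((-1) ^ i%:Z * (((- q.+1%:Z)%:~R - i%:R) * binz F (- q.+1%:Z) i)) =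
    (q.+1%:R + i%:R) * sb F (- q.+1%:Z) i by rewrite /sb rmorphN /=; ring.
by rewrite IH -natrD -!natrM addSn addnS mul_bin_diag.
Qed.

(** The left side is [normal_ord] applied to a [q]-th divided derivative. The coefficients agree by
    [binom(-i-1, q) = (-1)^q binom(q+i, i)], and the terms [i < q] of the second sum vanish, which
    accounts for the shift of the index by [q]. *)
Lemma normal_order_br (X B : int -> M -> M) n v (q : nat) : field X -> field B ->
  fs (fun i : nat => binz F (q%:Z - (- 1 - i%:Z) - 1) q *:
        X (- 1 - i%:Z - q%:Z) (B (n + i%:Z) v)) +
  fs (fun i : nat => B (n - 1 - i%:Z) (binz F (q%:Z - i%:Z - 1) q *: X (i%:Z - q%:Z) v)) =
  br X B (- q.+1%:Z) 0 n v.
Proof.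
move=> fX fB; rewrite br_split //; congr (_ + _).
  apply: eq_fs => i; rewrite sb_neg.
  have -> : q%:Z - (- 1 - i%:Z) - 1 = (q + i)%N%:Z by lia.
  rewrite binz_nat -[in LHS](bin_sub (leq_addr i q)) addKn; congr (_ *: X _ _).
  by rewrite NegzE; lia.
rewrite (fs_shift (k := q)) => [|i hi|].
- apply: eq_fs => i; rewrite (linZ (proj1 fB _)).
  have -> : q%:Z - (q + i)%N%:Z - 1 = - i.+1%:Z by lia.
  have -> : (q + i)%N%:Z - q%:Z = i by lia.
  have -> : n - 1 - (q + i)%N%:Z = n - (q + i).+1%:Z by lia.
  congr (_ *: _); rewrite sb_neg.
  have := sb_neg i q; rewrite /sb => e.
  have -> : binz F (- i.+1%:Z) q = (-1) ^ q%:Z * ((-1) ^ q%:Z * binz F (- i.+1%:Z) q).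
    by rewrite mulrA sign_sq mul1r.
  rewrite e -exprnP; congr (_ * _); rewrite addnC.
  by rewrite -[in LHS](bin_sub (leq_addr i q)) addKn.
- have -> : q%:Z - i%:Z - 1 = (q - i.+1)%N by lia.
  by rewrite binz_small ?scale0r ?(lin0 (proj1 fB _)) //; lia.
- have [N hN] := field_fin (- q%:Z) v fX; exists N => i /hN e.
  by rewrite [i%:Z - _]addrC e scaler0 (lin0 (proj1 fB _)).
Qed.

End NormalOrder.

(** * The concrete Fock space and the action of Pi(0) *)

Section Fock.
Variable F : numClosedFieldType.
Local Notation fock := (fock F).
Local Notation cartan := (cartan F).

Lemma lext_incl (f : fockBasis -> fock) (u : fock) (d : {fset fockBasis}) :
  (msupp u `<=` d)%fset -> lext f u = \sum_(b <- d) u@_b *: f b.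
Proof.
move=> le; rewrite /lext (big_fset_incl _ le) // => b _.
by rewrite -mcoeff_eq0 => /eqP ->; rewrite scale0r.
Qed.

(** Cancellation can shrink the support of a combination, so all three sums are taken over one
    common finite set. *)
Lemma lext_lin (f : fockBasis -> fock) : linear (lext f).
Proof.
move=> a u v; pose d := (msupp (a *: u + v) `|` (msupp u `|` msupp v))%fset.
rewrite !(@lext_incl _ _ d); last 3 first.
- exact: fsubset_trans (fsubsetUr _ _) (fsubsetUr _ _).
- exact: fsubset_trans (fsubsetUl _ _) (fsubsetUr _ _).
- exact: fsubsetUl.
rewrite scaler_sumr -big_split; apply: eq_bigr => b _ /=.
by rewrite mcoeffD mcoeffZ scalerDl scalerA.
Qed.

Lemma lextU (f : fockBasis -> fock) (b : fockBasis) : lext f << b >> = f b.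
Proof. by rewrite /lext msuppU oner_eq0 big_seq_fset1 mcoeffUU scale1r. Qed.

Lemma fock_sum (u : fock) : u = \sum_(b <- msupp u) u@_b *: << b >>.
Proof.
apply/malgP => b; rewrite (@raddf_sum _ _ (@mcoeff fockBasis F b)) /=.
have [hb|hb] := boolP (b \in msupp u); last first.
  rewrite mcoeff_outdom // big_seq big1 // => c hc; rewrite mcoeffZ mcoeffU.
  by case: eqP hb => [<-|_]; rewrite ?hc // mulr0n mulr0.
rewrite (big_fsetD1 b) //= mcoeffZ mcoeffUU mulr1 big_seq big1 ?addr0 // => c.
by rewrite !inE => /andP[/negPf hc _]; rewrite mcoeffZ mcoeffU hc mulr0n mulr0.
Qed.

Lemma fock_ind (P : fock -> Prop) : P 0 ->
  (forall a u v, P u -> P v -> P (a *: u + v)) ->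
  (forall b : fockBasis, P << b >>) -> forall u, P u.
Proof.
move=> h0 hl hb u; rewrite (fock_sum u).
by elim/big_rec: _ => // b v _ hv; exact: hl.
Qed.

Lemma fock_ext (M : lmodType F) (f g : fock -> M) : linear f -> linear g ->
  (forall b : fockBasis, f << b >> = g << b >>) -> f =1 g.
Proof.
move=> lf lg h; apply: fock_ind => [|a u v hu hv|//]; first by rewrite (lin0 lf) (lin0 lg).
by rewrite lf lg hu hv.
Qed.

Section Module.
Variables (s : int) (r : F).
Local Notation heis := (heis s r).
Local Notation heis_basis := (heis_basis s r).

Definition cgam (h : cartan) : F := h.1.
Definition cdel (h : cartan) : F := h.2.

Lemma heisE h n v : heis h n v =
  cgam h *: lext (heis_basis true n) v + cdel h *: lext (heis_basis false n) v.
Proof. by []. Qed.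

Lemma heis_lin h n : linear (heis h n).
Proof. exact: (lin_add (lin_scale _ (lext_lin _)) (lin_scale _ (lext_lin _))). Qed.

Lemma add_comb (U : lmodType F) (a c c' d d' : F) (x y : U) :
  (a * c + c') *: x + (a * d + d') *: y = a *: (c *: x + d *: y) + (c' *: x + d' *: y).
Proof. by rewrite !scalerDl scalerDr !scalerA addrACA. Qed.

Lemma heis_linl n v : linear (fun h : cartan => heis h n v).
Proof. move=> a h h'; exact: add_comb. Qed.

Lemma heis_hvec x n b : heis (hvec F x) n << b >> = heis_basis x n b.
Proof.
have e (U : lmodType F) (u w : U) : (1 : F) *: u + (0 : F) *: w = u by rewrite scale1r scale0r addr0.
have e' (U : lmodType F) (u w : U) : (0 : F) *: u + (1 : F) *: w = w by rewrite scale1r scale0r add0r.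
rewrite heisE; case: x.
  by rewrite [LHS](e _ (lext (heis_basis true n) << b >>)); exact: lextU.
by rewrite [LHS](e' _ _ (lext (heis_basis false n) << b >>)); exact: lextU.
Qed.

Local Notation H := (fun x => heis (hvec F x)).
Local Notation S := (@shift F).

Lemma fock_space_fock : fock_space s r (fun b : fockBasis => << b >> : fock) H S.
Proof.
split.
- exact: fock_ind.
- by move=> x n; exact: heis_lin.
- by move=> j; exact: lext_lin.
- by move=> x p b; rewrite heis_hvec.
- by move=> x b; rewrite heis_hvec.
- by move=> x p b; rewrite heis_hvec.
- by move=> j b; exact: lextU.
Qed.

Lemma Cm_heis n v : Cm H n v = heis (gam F + del F) n v.
Proof.
have e := linD (heis_linl n v) (gam F) (del F).
exact: (esym e).
Qed.

Lemma exp_fieldE j n v : exp_field s r j n v = Ef s H S j n v.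
Proof.
have epos (p : int) w : match p with Posz p => oexp (fun i => heis (i%:R^-1 *: (j%:~R *: (gam F + del F))) (- i%:Z)) p w | Negz _ => 0 end
   = gexpz (pos_part (Cm H) j) p w.
  case: p => [p|p]; last by [].
  apply: (eq_goexp (M := fock)) => i u.
  rewrite /pos_part Cm_heis.
  have e := linZ (heis_linl (- i.+1%:Z) u) (i.+1%:R^-1 * j%:~R) (gam F + del F).
  rewrite -e; congr (heis _ _ _); exact: scalerA.
have eneg (p : nat) w : oexp (fun i => heis (- i%:R^-1 *: (j%:~R *: (gam F + del F))) i%:Z) p w
   = goexp (neg_part (Cm H) j) p w.
  apply: (eq_goexp (M := fock)) => i u.
  rewrite /neg_part Cm_heis.
  have e := linZ (heis_linl (i.+1%:Z) u) (- i.+1%:R^-1 * j%:~R) (gam F + del F).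
  rewrite -e; congr (heis _ _ _); exact: scalerA.
by apply: eq_fs => q; rewrite epos eneg.
Qed.

Lemma field_basisE b n v : field_basis s r b n v = Yf s H S b n v.
Proof.
rewrite /field_basis /Yf /Yl; move: n v.
elim: (enum_mset b.2) => [|[x q] l IH] n v; first exact: exp_fieldE.
have {}IH : foldr (fun x B => normal_ord (div_deriv x.2 (heis (hvec F x.1))) B)
    (exp_field s r b.1) l = Yl s H S b.1 l.
  by apply/funext => m; apply/funext => w; exact: IH.
have e := normal_order_br n v q (field_H fock_space_fock x) (field_Yl fock_space_fock b.1 l).
apply: etrans e; rewrite -IH; exact: erefl.
Qed.

Lemma Mact_lin n w : linear (fun a => Mact s r a n w).
Proof. exact: lext_lin. Qed.

Lemma Mact_bas b n w : Mact s r << b >> n w = Yf s H S b n w.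
Proof. rewrite -field_basisE; exact: (lextU (fun b => field_basis s r b n w)). Qed.

End Module.

Theorem Mact_borch s r (a b : Pi0 F) : borch (V := Pi0 F) (Mact s r) a b.
Proof.
have h := @fock_borch F (Pi0 F) _ _ _ (fock_space_fock 0 0) (Mact_lin 0 0) (Mact_bas 0 0) erefl.
have h2 := h fock s r _ _ _ (Mact s r) (fock_space_fock s r).
have h3 := h2 (Mact_lin s r).
have h4 := h3 (Mact_bas s r).
exact: h4.
Qed.

Lemma Mact_field s r (a : Pi0 F) : field (Mact s r a).
Proof.
exact: (act_field (V := Pi0 F) (fock_space_fock 0 0) (fock_space_fock s r) (Mact_lin s r) (Mact_bas s r)).
Qed.

Lemma Mact_module s r : va_module (V := Pi0 F) (Mact s r).
Proof.
split.
- split=> [a n|n w]; [exact: (proj1 (Mact_field s r a) n)|exact: Mact_lin].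
- by move=> a w; exact: (proj2 (Mact_field s r a) w).
- move=> n w; have e := Mact_bas s r (0, mset0) n w.
  by rewrite [LHS]e Yf0 (Ef0 (fock_space_fock s r)).
- move=> a b w l m n; exact: (Mact_borch s r a b l m n w).
Qed.

End Fock.

Local Open Scope mset_scope.

(** * The lowest component *)

(** Applying [L - lam k] removes the component of the head [k] and rescales the others by nonzero
    factors; so the tail components lie in [N] by induction, and the head by subtraction. *)
Lemma eigen_component (F : fieldType) (M : lmodType F) (N : M -> Prop) (L : M -> M)
    (I : eqType) (l : seq I) (f : I -> M) (lam : I -> F) :
  N 0 -> (forall a u v, N u -> N v -> N (a *: u + v)) -> linear L ->
  (forall v, N v -> N (L v)) -> (forall i, L (f i) = lam i *: f i) ->
  uniq l -> {in l &, injective lam} -> N (\sum_(i <- l) f i) ->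
  forall i, i \in l -> N (f i).
Proof.
move=> N0 Nl lL NL fL.
have NZ a u : N u -> N (a *: u) by move=> h; rewrite -[_ *: _]addr0; exact: Nl.
have NB u v : N u -> N v -> N (u - v).
  by move=> hu hv; rewrite addrC -scaleN1r; exact: Nl.
elim: l f fL => // k l IH f fL /= /andP[kl ul] inj; rewrite big_cons => hN.
have hl i : i \in l -> N (f i).
  move=> il; have hne : lam i - lam k != 0.
    rewrite subr_eq0; apply: contra kl => /eqP /inj <- //; first by rewrite inE il orbT.
    by rewrite inE eqxx.
  rewrite -[f i]scale1r -(mulVf hne) -scalerA; apply: (NZ).
  apply: (IH (fun i => (lam i - lam k) *: f i)) => // [a||].
  - by rewrite (linZ lL) fL !scalerA mulrC.
  - by move=> a b ha hb; apply: inj; rewrite inE ?ha ?hb orbT.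
  have := NB _ _ (NL _ hN) (NZ (lam k) _ hN).
  rewrite (linD lL) fL scalerDr opprD addrACA subrr add0r (lin_sum lL) scaler_sumr -sumrB.
  by rewrite (eq_bigr (fun i => (lam i - lam k) *: f i)) // => a _; rewrite fL scalerBl.
move=> i; rewrite inE => /orP[/eqP ->|]; last exact: hl.
have hs : N (\sum_(i <- l) f i).
  rewrite big_seq; elim/big_rec: _ => // a u al hu.
  by rewrite -[f a]scale1r; apply: Nl => //; exact: hl.
by rewrite -(addrK (\sum_(i <- l) f i) (f k)); exact: NB.
Qed.

Section LowestComponent.
Variable F : numClosedFieldType.
Variables (M : lmodType F) (s : int) (r : F) (bas : fockBasis -> M).
Variables (H : bool -> int -> M -> M) (S : int -> M -> M).
Hypothesis fkM : fock_space s r bas H S.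
Local Notation C := (Cm H).
Local Notation E := (Ef s H S).
Local Notation P j := (gexpz (pos_part C j)).
Local Notation Q j := (goexp (neg_part C j)).

Let linH := fk_linH fkM.
Let linS := fk_linS fkM.
Let lC : forall n, linear (C n) := linC fkM.
Let fC := field_C fkM.
Let cC := C_comm fkM.
Let SC := C_S fkM.

Lemma mdeg_count_fin (A : {mset (bool * nat)%type}) :
  (forall x, fin1 (fun i => (i.+1 * A (x, i))%:R : F^o)) /\
  (mdeg A)%:R =
    fs (fun i => (i.+1 * A (true, i))%:R) + fs (fun i => (i.+1 * A (false, i))%:R) :> F.
Proof.
pose f A x i : F := (i.+1 * (A : {mset (bool * nat)%type}) (x, i))%:R.
suff : (forall x, fin1 (f A x : nat -> F^o)) /\ (mdeg A)%:R = fs (f A true) + fs (f A false) by [].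
elim/mset_ind1: A => [|[y p] A [hf e]].
  split=> [x|]; first by exists 0%N => i _; rewrite /f mset0E muln0.
  by rewrite mdeg0 !fs0 ?addr0 // => i; rewrite /f mset0E muln0.
pose d x i : F := if (x == y) && (i == p) then p.+1%:R else 0.
have ef x i : f ((y, p) +` A) x i = d x i + f A x i.
  rewrite /f mset1DE /d xpair_eqE mulnDr natrD; congr (_ + _).
  by case: (x == y) => /=; [case: eqP => [->|_]|]; rewrite ?muln1 ?muln0.
have fd x : fin1 (d x).
  exists p.+1 => i hi; rewrite /d (_ : (i == p) = false) ?andbF //.
  by apply/eqP => ei; rewrite ei ltnn in hi.
have ed x : fs (d x) = if x == y then p.+1%:R else 0.
  rewrite (fs_single (i0 := p)) => [|i /negPf hi]; last by rewrite /d hi andbF.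
  by rewrite /d eqxx andbT.
split=> [x|].
  by have [N hN] := fin1D (M := F^o) (fd x) (hf x); exists N => i /hN <-; rewrite ef.
rewrite (eq_fs (ef true)) (eq_fs (ef false)) !fsD // !ed mdeg1D natrD e /=.
by rewrite addrACA; congr (_ + _); case: y {d ef fd ed} => /=; rewrite ?addr0 ?add0r.
Qed.

Lemma mdeg_count (A : {mset (bool * nat)%type}) : (mdeg A)%:R =
  fs (fun i => (i.+1 * A (true, i))%:R) + fs (fun i => (i.+1 * A (false, i))%:R) :> F.
Proof. by have [] := mdeg_count_fin A. Qed.

Lemma H_number x i b : H x (- i.+1%:Z) (H x i.+1%:Z (bas b)) =
  ((i.+1 * b.2 (x, i))%:R * ff F x x) *: bas b.
Proof.
rewrite (fk_ann fkM) (linZ (linH _ _)).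
have -> : H x (- i.+1%:Z) (bas (b.1, b.2 `\ (x, i))) = bas (b.1, (x, i) +` (b.2 `\ (x, i))).
  exact: (fk_crea fkM x i (b.1, b.2 `\ (x, i))).
case: b => j A /=; case: (posnP (A (x, i))) => [->|h].
  by rewrite muln0 mulr0 mul0r !scale0r.
by rewrite msetB1K -?mset_gt0 // natrM; congr (_ *: _); ring.
Qed.

Lemma number_fin x v : fin1 (fun i : nat => H x (- i.+1%:Z) (H x i.+1%:Z v)).
Proof.
have [N hN] := field_fin 1 v (field_H fkM x); exists N => i /hN e.
by rewrite intS e (lin0 (linH _ _)).
Qed.

(** The part of the Sugawara operator without zero modes. On a basis vector [x(-i) x(i)] acts by [i]
    times the norm of [x] times the multiplicity of [x(-i)]; the norms 2 and -2 explain the factors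
    and the sign. *)
Definition number (v : M) : M :=
  2^-1 *: fs (fun i : nat => H true (- i.+1%:Z) (H true i.+1%:Z v)) -
  2^-1 *: fs (fun i : nat => H false (- i.+1%:Z) (H false i.+1%:Z v)).

Lemma half_number_lin x :
  linear (fun v => fs (fun i : nat => H x (- i.+1%:Z) (H x i.+1%:Z v))).
Proof.
move=> a u v; rewrite -(fsZ a (number_fin x u)) -(fsD (fin1Z (fun=> a) (number_fin x u)) (number_fin x v)).
by apply: eq_fs => i; rewrite !linH.
Qed.

Lemma half_number_bas x b :
  fs (fun i : nat => H x (- i.+1%:Z) (H x i.+1%:Z (bas b))) =
  (fs (fun i => (i.+1 * b.2 (x, i))%:R) * ff F x x) *: bas b.
Proof.
rewrite mulrC -scalerA; have [/(_ x)[N hN] _] := mdeg_count_fin b.2.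
 rewrite (fsE hN) (@fsE _ N) => [|i /hN e]; last first.
  by rewrite H_number e mul0r scale0r.
rewrite scaler_suml scaler_sumr; apply: eq_bigr => i _.
by rewrite H_number mulrC scalerA.
Qed.

Lemma number_lin : linear number.
Proof. by apply: lin_sub; apply: lin_scale; exact: half_number_lin. Qed.

Lemma number_bas b : number (bas b) = (mdeg b.2)%:R *: bas b.
Proof.
rewrite /number !half_number_bas !scalerA -scalerBl mdeg_count; congr (_ *: _).
by rewrite !ffE /= /kc; field.
Qed.

Lemma number_hd (m : nat) v : hd bas m v -> number v = m%:R *: v.
Proof.
elim=> [|a u w _ hu _ hw|b e]; first by rewrite (lin0 number_lin) scaler0.
  by rewrite number_lin hu hw scalerDr !scalerA mulrC.
by rewrite number_bas; case: e => ->.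
Qed.

Lemma hd0_killed v n : hd bas 0 v -> forall x, H x n.+1%:Z v = 0.
Proof.
move=> hv x; apply: (@hd_neg _ _ bas (0 + 1 - n.+1%:Z - 1)); first by lia.
exact: (shifts_H fkM).
Qed.

Lemma killed_hd0 (m : nat) v : hd bas m v -> (forall x n, H x n.+1%:Z v = 0) ->
  (0 < m)%N -> v = 0.
Proof.
move=> hv h m0; have := number_hd hv; rewrite /number !fs0 => [|i|i].
- rewrite scaler0 subrr => /esym/eqP; rewrite scaler_eq0 pnatr_eq0.
  by case: m m0 {hv} => //= m _ /eqP.
- by rewrite h (lin0 (linH _ _)).
- by rewrite h (lin0 (linH _ _)).
Qed.

Hypothesis s1 : s = -1.

Section Subspace.
Variable N : M -> Prop.
Hypothesis N0 : N 0.
Hypothesis Nl : forall a u v, N u -> N v -> N (a *: u + v).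
Hypothesis NH : forall n v, N v -> N (H false n v).
Hypothesis NE : forall n v, N v -> N (E (-1) n v).

Let NZ a u : N u -> N (a *: u).
Proof. by move=> h; rewrite -[_ *: _]addr0; exact: Nl. Qed.

Let ND u v : N u -> N v -> N (u + v).
Proof. by move=> hu hv; rewrite -[u]scale1r; exact: Nl. Qed.

Let Nsum (I : eqType) (l : seq I) (f : I -> M) :
  (forall i, N (f i)) -> N (\sum_(i <- l) f i).
Proof. by move=> h; elim/big_rec: _ => // i u _; exact: ND. Qed.

Lemma E_top (p : int) v : E (-1) (p + 1) v =
  fs (fun q : nat => P (-1) (q%:Z - p) (Q (-1) q (S (-1) v))).
Proof. by apply: eq_fs => q; rewrite s1; congr (gexpz _ _ _); lia. Qed.

(* If no mode of [e^-c] lowers the degree of [u], then [exp(sum c(n) z^-n / n)]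
   fixes it, whence [c(n) u = 0] for [n > 0]. *)
Lemma C_killed u : (forall k : nat, E (-1) (k.+2)%:Z u = 0) ->
  forall n : nat, C n.+1%:Z u = 0.
Proof.
move=> h; set w := S (-1) u; have [K hK] := nil_neg_part fkM (-1) w.
have Q0 : forall q, Q (-1) q.+1 w = 0.
  (* Descending induction from the bound [K]: in mode [q + 2] the terms of index below [q + 1] have
     a creation factor of negative degree and those above vanish by induction, so [Q (-1) (q + 1) w]
     alone remains. *)
  suff hq d q : (K <= d + q)%N -> Q (-1) q.+1 w = 0 by move=> q; exact: (hq K q (leq_addr _ _)).
  elim: d q => [|d IH] q hd; first by apply: hK; apply: leqW.
  have := h q; rewrite (_ : q.+2%:Z = q.+1%:Z + 1); last by lia.
  rewrite E_top (fs_single (i0 := q.+1)) => [|i hi]; first by rewrite subrr /= goexp0.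
  have [hlt|hge] := ltnP i q.+1; first by rewrite P_neg //; lia.
  case: i hi hge => // i hi hge; rewrite IH ?(lin0 (P_lin fC _ _)) //.
  by rewrite -/w; move: hi hge; rewrite eqSS ltnS; lia.
have S1 v : S 1 (S (-1) v) = v by rewrite (S_add fkM) subrr (S_0 fkM).
(* As all [Q] of positive index kill [w], their recursion at [n + 1] reduces to its last term
   [C (n + 1) w]; undoing the shift gives the claim for [u]. *)
move=> n; rewrite -[C _ u]S1 -SC -/w.
have := Q_rec fC cC (-1) n.+1 w; rewrite Q0 scaler0 => /esym/eqP.
rewrite oppr_eq0 big_ord_recr /= subnn goexp0 big1 ?add0r => [|i _]; last first.
  have -> : (n.+1 - i.+1 = (n - i.+1).+1)%N by have := ltn_ord i; lia.
  by rewrite Q0 (lin0 (lC _)) scaler0.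
rewrite scaler_eq0 intr_eq0 /= => /eqP ->; exact: lin0 (linS _).
Qed.

Lemma descent (m : nat) u : hd bas m u -> N u -> u <> 0 ->
  exists2 v, N v & hd bas 0 v /\ v <> 0.
Proof.
elim/ltn_ind: m u => m IH u hu Nu u0.
have [m0|m0] := posnP m; first by exists u => //; rewrite m0 in hu.
have [[n hn]|hH] := pselect (exists n : nat, H false n.+1%:Z u <> 0).
  have h : hd bas (m%:Z - n.+1%:Z) (H false n.+1%:Z u).
    by have := shifts_H fkM false n.+1%:Z hu; have -> : m%:Z + 1 - n.+1%:Z - 1 = m%:Z - n.+1%:Z by lia.
  have [hmn|hmn] := leqP n.+1 m; last by case: hn; apply: hd_neg h; lia.
  have e : m%:Z - n.+1%:Z = (m - n.+1)%N by lia.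
  by rewrite e in h; apply: (IH (m - n.+1)%N _ _ h) => //; [lia|exact: NH].
(* At [s = -1] the field of [e^-c] has weight 2, so its mode [k + 2] lowers the degree by
   [k + 1]. *)
have [[k hk]|hE] := pselect (exists k : nat, E (-1) k.+2%:Z u <> 0).
  have h : hd bas (m%:Z - k.+1%:Z) (E (-1) k.+2%:Z u).
    have := shifts_E fkM (-1) k.+2%:Z hu; rewrite s1.
    by have -> : m%:Z + 2 * -1 * -1 - k.+2%:Z - 1 = m%:Z - k.+1%:Z by lia.
  have [hmn|hmn] := leqP k.+1 m; last by case: hk; apply: hd_neg h; lia.
  have e : m%:Z - k.+1%:Z = (m - k.+1)%N by lia.
  by rewrite e in h; apply: (IH (m - k.+1)%N _ _ h) => //; [lia|exact: NE].
have hf n : H false n.+1%:Z u = 0 by apply: contrapT => h; apply: hH; exists n.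
have hc n : C n.+1%:Z u = 0.
  by apply: C_killed => k; apply: contrapT => h; apply: hE; exists k.
case: u0; apply: (killed_hd0 hu) => // -[] n; last exact: hf.
by have := hc n; rewrite /Cm hf addr0.
Qed.

Hypothesis Nbas : forall j, N (bas (j, mset0)).

(** All shifts of [v] are required to lie in [N] because modes of [e^-c] also lower the exponent by
    1; the second condition makes the annihilation half of [e^-c] act as the identity. *)
Let good v := (forall j, N (S j v)) /\ forall n : nat, C n.+1%:Z v = 0.

Lemma good_P p v : good v -> good (P (-1) p v).
Proof.
move=> [hS hC]; split=> [j|n]; last by rewrite (CP fC cC) hC (lin0 (P_lin fC _ _)).
rewrite (SP fC cC linS SC).
have e : E (-1) (- p + 1) (S (j + 1) v) = P (-1) p (S j v).
  rewrite E_top (S_add fkM) (_ : -1 + (j + 1) = j); last by lia.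
  have Q0 q : Q (-1) q (S j v) = if q == 0%N then S j v else 0.
    have [N' hN'] : exists N', N' = q by exists q.
    elim/ltn_ind: q {N' hN'} => -[|q] IH; first by rewrite goexp0.
    have hq : q.+1%:R != 0 :> F by rewrite pnatr_eq0.
    apply: (scalerI hq); rewrite (Q_rec fC cC) scaler0 big1 ?oppr0 // => i _.
    rewrite IH; last by lia.
    by case: eqP => _; rewrite ?(lin0 (lC _)) ?scaler0 // SC hC (lin0 (linS _)) scaler0.
  rewrite (fs_single (i0 := 0%N)) => [|i /negPf hi]; last by rewrite Q0 hi (lin0 (P_lin fC _ _)).
  by rewrite Q0 /= (_ : 0%:Z - - p = p) //; lia.
by rewrite -e; apply: NE.
Qed.

(** The recursion for [P (-1) (p + 1) v] contains [C (- p - 1) v] as its last term; its other terms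
    are modes of [c] of smaller depth applied to good vectors, so they are covered by induction. *)
Lemma good_C p v : good v -> good (C (- p.+1%:Z) v).
Proof.
elim/ltn_ind: p v => p IH v gv; split=> [j|n]; last first.
  by rewrite cC (proj2 gv) (lin0 (lC _)).
have e : C (- p.+1%:Z) v = - (p.+1%:R *: P (-1) p.+1%:Z v) -
    \sum_(i < p) C (- i.+1%:Z) (P (-1) (p - i)%N%:Z v).
  have := P_rec fC cC (-1) p.+1%:Z v.
  rewrite (@fsE _ p.+1) => [->|i hi]; last by rewrite P_neg ?(lin0 (lC _)) ?scaler0 //; lia.
  rewrite big_ord_recr /= subrr /= goexp0 scaleN1r opprD opprK addrAC.
  rewrite (eq_bigr (fun i : 'I_p => - C (- i.+1%:Z) (P (-1) (p - i)%N%:Z v))) => [|i _].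
    by rewrite sumrN opprK subrr add0r.
  by rewrite scaleN1r; congr (- C _ (gexpz _ _ _)); have := ltn_ord i; lia.
have NN u : N u -> N (- u) by move=> hu; rewrite -scaleN1r; exact: NZ.
rewrite e (linB (linS _)) (linN (linS _)) (linZ (linS _)); apply: ND.
  by apply: NN; apply: NZ; exact: (proj1 (good_P p.+1%:Z gv)).
rewrite (lin_sum (linS _)); apply: NN; apply: Nsum => i; exact: (proj1 (IH i (ltn_ord i) _ (good_P (p - i)%N%:Z gv))).
Qed.

(* On vectors killed by the [c(n)], n > 0, the field of [e^-c] reduces to
   [exp(-sum c(-n) z^n / n)], whose coefficients recover the [c(-n)]; with the
   [delta(-n)] these give all creation operators. *)
Lemma lowest_generates v : N v.
Proof.
pose mon l u := foldr (fun (p : nat) w => C (- p.+1%:Z) w) u l.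
have lin_mon l : linear (mon l).
  elim: l => [|p l IH] // a u w.
  by rewrite -[LHS]/(C (- p.+1%:Z) (mon l (a *: u + w))) IH lC.
(* [delta(-n)] does not commute with [c(n)], so it leads out of the good vectors. [G] therefore asks
   for membership after any product of creation modes of [c], with which [delta(-n)] does
   commute. *)
pose G u := forall j l, N (S j (mon l u)).
have Gl a u w : G u -> G w -> G (a *: u + w).
  by move=> hu hw j l; rewrite lin_mon linS; apply: Nl.
have G0 : G (bas (0, mset0)).
  move=> j l; suff : good (mon l (bas (0, mset0))) by case.
  elim: l => [|p l IH]; last exact: good_C.
  split=> [i|n]; first by rewrite (fk_shift fkM) /=; exact: Nbas.
  by rewrite /Cm !hd0_killed ?addr0 //; apply: hd_bas; rewrite /= mdeg0.
have GC p u : G u -> G (C (- p.+1%:Z) u).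
  by move=> hu j l; have := hu j (rcons l p); rewrite /mon foldr_rcons.
have GH p u : G u -> G (H false (- p.+1%:Z) u).
  move=> hu j l.
  have HC q w : C (- q.+1%:Z) (H false (- p.+1%:Z) w) = H false (- p.+1%:Z) (C (- q.+1%:Z) w).
    have hpq : (- p.+1%:Z + - q.+1%:Z == 0) = false by lia.
    by apply/esym/eqP; rewrite -subr_eq0 (H_C fkM) hpq scale0r.
  have -> : mon l (H false (- p.+1%:Z) u) = H false (- p.+1%:Z) (mon l u).
    by elim: l => //= q l ->; rewrite HC.
  have -> : S j (H false (- p.+1%:Z) (mon l u)) = H false (- p.+1%:Z) (S j (mon l u)).
    have hp : (- p.+1%:Z == 0) = false by lia.
    by apply/esym/eqP; rewrite -subr_eq0 (H_S fkM) hp scale0r.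
  by apply: NH; apply: hu.
have GT x p u : G u -> G (H x (- p.+1%:Z) u).
  case: x => hu; last exact: GH.
  have -> : H true (- p.+1%:Z) u = -1 *: H false (- p.+1%:Z) u + C (- p.+1%:Z) u.
    by rewrite scaleN1r /Cm addrCA addNr addr0.
  by apply: Gl; [exact: GH|exact: GC].
have Gbas A : G (bas (0, A)).
  elim/mset_ind1: A => // -[x p] A /(GT x p).
  by have -> : H x (- p.+1%:Z) (bas (0, A)) = bas (0, (x, p) +` A) by exact: (fk_crea fkM x p (0, A)).
apply: (fk_ind fkM) => // -[j A]; have := Gbas A j [::].
by rewrite /= (fk_shift fkM) /= add0r.
Qed.

End Subspace.
End LowestComponent.

(** * The generators of the Bershadsky-Polyakov algebra *)

Section TopModes.
Variable F : numClosedFieldType.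
Variables (M : lmodType F) (s : int) (r : F) (bas : fockBasis -> M).
Variables (H : bool -> int -> M -> M) (S : int -> M -> M).
Hypothesis fkM : fock_space s r bas H S.

(** In [B(z) v] no power below [z^(-n0-1)] occurs, and that power has the coefficient [w]. Leading
    terms multiply, so [G^+(0)] can be computed without expanding a cubic normally ordered
    product. *)
Definition top (B : int -> M -> M) (n0 : int) (v w : M) : Prop :=
  B n0 v = w /\ forall n, n0 < n -> B n v = 0.

Lemma top_Ef j i : top (Ef s H S j) (2 * s * j - 1) (bas (i, mset0)) (bas (i + j, mset0)).
Proof.
have h0 k : hd bas 0 (bas (k, mset0)) by apply: hd_bas; rewrite /= mdeg0.
split=> [|n hn]; last first.
  by apply: (@hd_neg _ _ bas (0 + 2 * s * j - n - 1));
    [lia|exact: (shifts_E fkM j n (h0 i))].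
rewrite /Ef /gexp_field (fs_single (i0 := 0%N)) => [|q hq].
  rewrite goexp0 (_ : _ + _ = 0%N :> int); last by lia.
  by rewrite /= goexp0 (fk_shift fkM).
rewrite (fk_shift fkM) (_ : goexp _ _ _ = 0) ?(lin0 (P_lin (field_C fkM) _ _)) //.
apply: (@hd_neg _ _ bas (0 - q%:Z)); first by lia.
exact: (hd_neg_part fkM).
Qed.

(** On a vector killed by the positive modes, [x(z)] has the leading term [h0 z^-1], whose [p]-th
    divided derivative is [(-1)^p h0 z^(-p-1)]. *)
Lemma top_br x B n0 i w (p : nat) : field B -> top B n0 (bas (i, mset0)) w ->
  top (br (H x) B (- p.+1%:Z) 0) (n0 + p%:Z + 1) (bas (i, mset0))
    (((-1) ^+ p * h0 s r x i) *: w).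
Proof.
move=> fB [e h]; have fH := field_H fkM x.
have lB n : linear (B n) by exact: (proj1 fB n).
have hk n : H x n.+1%:Z (bas (i, mset0)) = 0.
  by apply: (hd0_killed fkM); apply: hd_bas; rewrite /= mdeg0.
have hs n : n0 + p%:Z + 1 <= n -> br (H x) B (- p.+1%:Z) 0 n (bas (i, mset0)) =
    ((-1) ^+ p * h0 s r x i) *: B (n - p.+1%:Z) (bas (i, mset0)).
  move=> hn; rewrite br_split // fs0 ?add0r => [|k]; last first.
    by rewrite h ?(lin0 (fk_linH fkM _ _)) ?scaler0 //; lia.
  rewrite (fs_single (i0 := 0%N)) => [|[|k] // _]; last by rewrite hk (lin0 (lB _)) scaler0.
  by rewrite sb0 mulr1 addn0 (fk_zero fkM) (linZ (lB _)) scalerA.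
split=> [|n hn]; rewrite hs; try lia.
  by rewrite (_ : _ - _ = n0) ?e //; lia.
by rewrite h ?scaler0 //; lia.
Qed.

End TopModes.

Section Generators.
Variables (F : numClosedFieldType) (V : vaData F).
Variables (basV : fockBasis -> V) (HV : bool -> int -> V -> V) (SV : int -> V -> V).
Hypothesis fkV : fock_space 0 0 basV HV SV.
Hypothesis V_bas : forall b n w, nprod V (basV b) n w = Yf 0 HV SV b n w.
Hypothesis V_vac : vac V = ex basV 0.
Variables (M : lmodType F) (s : int) (r : F) (bas : fockBasis -> M).
Variables (H : bool -> int -> M -> M) (S : int -> M -> M).
Hypothesis fkM : fock_space s r bas H S.
Variable act : V -> int -> M -> M.
Hypothesis act_lin : forall n w, linear (fun a => act a n w).
Hypothesis act_bas : forall b n w, act (basV b) n w = Yf s H S b n w.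

Local Notation E := (Ef s H S).
Local Notation one := (basV (0, mset0)).
Let linH := fk_linH fkM.
Let fH := field_H fkM.

Lemma act_rec x (p : nat) d : act (HV x (- p.+1%:Z) d) = br (H x) (act d) (- p.+1%:Z) 0.
Proof.
have ffM := fock_free_field fkV V_bas V_vac fkM act_lin act_bas.
apply/funext => q; apply/funext => w.
by have := ff_rec ffM x p d q w; rewrite (act_x1 fkM act_bas) (act_x1 fkV V_bas).
Qed.

Lemma act_heis x : act (HV x (-1) one) = H x.
Proof. by rewrite (fk_crea fkV x 0%N (0, mset0)) msetD0; exact: (act_x1 fkM act_bas). Qed.

Lemma act_one n w : act one n w = if n == -1 then w else 0.
Proof. by rewrite (act_ex act_bas) (Ef0 fkM). Qed.

Lemma act_heis_deriv x w : act (HV x (-2) one) 1 w = - H x 0 w.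
Proof.
rewrite act_rec br_split; [|exact: fH|exact: (act_field fkV fkM act_lin act_bas)].
rewrite fs0 ?add0r => [|i]; last first.
  by rewrite act_one (_ : (_ == _) = false) ?(lin0 (linH _ _)) ?scaler0 //; lia.
rewrite (fs_single (i0 := 0%N)) => [|i hi].
  by rewrite sb0 mulr1 scaleN1r act_one.
by rewrite act_one (_ : (_ == _) = false) ?scaler0 //; lia.
Qed.

Lemma act_heis_sq x w : act (HV x (-1) (HV x (-1) one)) 1 w =
  H x 0 (H x 0 w) + 2 *: fs (fun i : nat => H x (- i.+1%:Z) (H x i.+1%:Z w)).
Proof.
have f1 := number_fin fkM x w.
have f2 : fin1 (fun i : nat => H x (1 - i.+1%:Z) (H x i%:Z w)).
  have [N hN] := field_fin 0 w (fH x); exists N => i /hN; rewrite add0r => ->.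
  by rewrite (lin0 (linH _ _)).
rewrite act_rec act_heis brN1E.
have -> : fs (fun i : nat => H x (- i.+1%:Z) (H x (1 + i%:Z) w) + H x (1 - i.+1%:Z) (H x i%:Z w)) =
    fs (fun i : nat => H x (- i.+1%:Z) (H x i.+1%:Z w) + H x (1 - i.+1%:Z) (H x i%:Z w)).
  by apply: eq_fs => i; rewrite -intS.
rewrite (fsD f1 f2) (fs_recl f2) subrr addrC -addrA; congr (_ + _).
rewrite (scalerDl _ 1 1) scale1r; congr (_ + _); apply: eq_fs => i.
by rewrite (_ : 1 - i.+2%:Z = - i.+1%:Z) //; lia.
Qed.

Definition Jvec : V := - (1 / 2) *: HV false (-1) one.
Definition Tvec : V := (1 / 4) *: HV true (-1) (HV true (-1) one)
  + (3 / 4) *: HV true (-2) one - (1 / 4) *: HV false (-1) (HV false (-1) one).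
Definition Gpvec : V := (sqrtC 6 / 8 * (1 / 3)) *:
  (4 *: HV true (-1) (HV true (-1) (HV true (-1) (basV (1, mset0))))
   + 6 *: HV true (-1) (HV true (-2) (basV (1, mset0))) + 2 *: HV true (-3) (basV (1, mset0))).
Definition Gmvec : V := - (sqrtC 6 / 8) *: basV (-1, mset0).

Lemma act_J n w : act Jvec n w = - (1 / 2) *: H false n w.
Proof. by rewrite (linZ (act_lin n w)) act_heis. Qed.

Lemma act_Gm n w : act Gmvec n w = - (sqrtC 6 / 8) *: E (-1) n w.
Proof. by rewrite (linZ (act_lin n w)) (act_ex act_bas). Qed.

(** Written for an arbitrary action, because it is evaluated twice: on Pi(0), where its eigenvalues
    are the weights of vectors, and on M_(-1)(r), where they are the degrees minus 1/2. *)
Definition L0 (w : M) : M := act Tvec 1 w - (1 / 2) *: act Jvec 0 w.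

Lemma L0E w : L0 w = number H w + (4^-1 *: H true 0 (H true 0 w) - (3 / 4) *: H true 0 w)
   - 4^-1 *: H false 0 (H false 0 w) + 4^-1 *: H false 0 w.
Proof.
rewrite /L0 act_J /Tvec (linB (act_lin 1 w)) (linD (act_lin 1 w)) !(linZ (act_lin 1 w)).
rewrite !act_heis_sq act_heis_deriv /number.
set X := fs _; set Y := fs _; set a := H true 0 _; set b := H true 0 w.
set c := H false 0 _; set d := H false 0 w.
rewrite !scalerDr !scalerA !scalerN opprD.
have -> : 1 / 4 * 2 = 2^-1 :> F by field.
have -> : 1 / 2 * - (1 / 2) = - 4^-1 :> F by field.
rewrite scaleNr opprK !div1r; congr (_ + _); rewrite addrA.
by rewrite [LHS](ACl ((2 * 5) * (1 * 3) * 4)).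
Qed.

Definition L0_weight (b : fockBasis) : F :=
  (mdeg b.2)%:R - s%:~R ^+ 2 - s%:~R / 2 - 2 * (s%:~R + 1) * (r + b.1%:~R).

Lemma L0_bas b : L0 (bas b) = L0_weight b *: bas b.
Proof.
rewrite L0E (number_bas fkM) !(fk_zero fkM) !(linZ (linH _ _)) !(fk_zero fkM) !scalerA.
rewrite -scalerBl -!scalerDl -scalerBl -scalerDl; congr (_ *: _).
by rewrite !h0E /L0_weight; field.
Qed.

Lemma L0_lin : linear L0.
Proof.
have h a n : linear (act a n) by exact: (proj1 (act_field fkV fkM act_lin act_bas a) n).
by apply: lin_sub; [exact: h|apply: lin_scale; exact: h].
Qed.

Lemma L0_hd (m : nat) v : s = -1 -> hd bas m v -> L0 v = (- (1 / 2) + m%:R) *: v.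
Proof.
move=> s1; elim=> [|a u w _ hu _ hw|b e]; first by rewrite (lin0 L0_lin) scaler0.
  by rewrite L0_lin hu hw scalerDr !scalerA mulrC.
by rewrite L0_bas; congr (_ *: _); case: e => e; rewrite /L0_weight e s1; field.
Qed.

Lemma J0_bas b : act Jvec 0 (bas b) = (s%:~R + (r + b.1%:~R)) *: bas b.
Proof.
by rewrite act_J (fk_zero fkM) scalerA h0E; congr (_ *: _); field.
Qed.

Lemma Gm_bas j : s = -1 -> act Gmvec 1 (bas (j, mset0)) = - (sqrtC 6 / 8) *: bas (j - 1, mset0).
Proof. by move=> s1; have [e _] := top_Ef fkM (-1) j; rewrite act_Gm; rewrite s1 in e; rewrite s1 e. Qed.

Lemma Gp_bas j (t := r + j%:~R) : s = -1 -> act Gpvec 0 (bas (j, mset0)) =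
  (sqrtC 6 / 24 * (4 * t * (2 * t - 1) * (4 * t - 1))) *: bas (j + 1, mset0).
Proof.
move=> s1; have fA a : field (act a) by exact: (act_field fkV fkM act_lin act_bas).
have tE : top (act (basV (1, mset0))) (-3) (bas (j, mset0)) (bas (j + 1, mset0)).
  rewrite (_ : act _ = E 1); last exact: (act_ex act_bas).
  by have := top_Ef fkM 1 j; rewrite (_ : 2 * s * 1 - 1 = -3) //; rewrite s1.
have tr d n0 w p : top (act d) n0 (bas (j, mset0)) w ->
    top (act (HV true (- p.+1%:Z) d)) (n0 + p%:Z + 1) (bas (j, mset0)) (((-1) ^+ p * (2 * t)) *: w).
  by move=> h; rewrite act_rec; have := top_br fkM true p (fA d) h; rewrite h0E.
(* Each of the three monomials raises the leading mode from -3 to 0. Their factors are [(2t)^3],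
   [-(2t)^2] and [2t], and [4 (2t)^3 - 6 (2t)^2 + 2 (2t) = 4t (2t-1) (4t-1)]. *)
have [e1 _] := tr _ _ _ 0%N (tr _ _ _ 0%N (tr _ _ _ 0%N tE)).
have [e2 _] := tr _ _ _ 0%N (tr _ _ _ 1%N tE).
have [e3 _] := tr _ _ _ 2%N tE.
rewrite /Gpvec !(linZ (act_lin 0 _), linD (act_lin 0 _)) [act _ _ _]e1 [X in _ + 6 *: X]e2 [X in _ + 2 *: X]e3 !scalerA -!scalerDl scalerA.
by congr (_ *: _); field.
Qed.

End Generators.

(** * Smith algebra modules and irreducibility *)

Section Combinations.
Variables (F : fieldType) (M : lmodType F).

Definition linear_closed (P : M -> Prop) : Prop :=
  P 0 /\ forall (a : F) u v, P u -> P v -> P (a *: u + v).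

Lemma sum_if_mem (I : eqType) (l l' : seq I) (f : I -> M) :
  uniq l -> uniq l' -> {subset l <= l'} ->
  \sum_(i <- l') (if i \in l then f i else 0) = \sum_(i <- l) f i.
Proof.
move=> ul ul' sl; rewrite -big_mkcond -big_filter; apply: perm_big.
apply: uniq_perm => //; first exact: filter_uniq.
by move=> i; rewrite mem_filter; case: (boolP (i \in l)) => //= /sl ->.
Qed.

(** Distinct indices are what [eigen_component] asks for; two lists are merged by extending both
    coefficient families by 0. *)
Lemma closed_uniq_sum (I : eqType) (f : I -> M) :
  linear_closed (fun v => exists (l : seq I) (a : I -> F), uniq l /\ v = \sum_(i <- l) a i *: f i).
Proof.
split; first by exists [::], (fun=> 0); rewrite big_nil.
move=> k u v [l [a [ul ->]]] [l' [a' [ul' ->]]].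
exists (undup (l ++ l')), (fun i => k * (if i \in l then a i else 0) + (if i \in l' then a' i else 0)).
split; first exact: undup_uniq.
have h := undup_uniq (l ++ l').
rewrite -(sum_if_mem _ ul h) => [|i il]; last by rewrite mem_undup mem_cat il.
rewrite -(sum_if_mem _ ul' h) => [|i il]; last by rewrite mem_undup mem_cat il orbT.
rewrite scaler_sumr -big_split; apply: eq_bigr => i _ /=.
by rewrite scalerDl -scalerA; case: (i \in l); case: (i \in l'); rewrite ?scale0r.
Qed.

Lemma op_horner2_widen (g : {poly {poly F}}) (X Y : M -> M) v m n :
  (forall i, (m <= i)%N -> g`_i = 0) -> (forall i j, (n <= j)%N -> g`_i`_j = 0) ->
  op_horner2 g X Y v = \sum_(i < m) \sum_(j < n) g`_i`_j *: iter i X (iter j Y v).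
Proof.
move=> hm hn.
have e i : \sum_(j < size g`_i) g`_i`_j *: iter i X (iter j Y v) =
    \sum_(j < n) g`_i`_j *: iter i X (iter j Y v).
  rewrite -(fsE (f := fun j => g`_i`_j *: iter i X (iter j Y v))) => [|j hj]; last first.
    by rewrite nth_default // scale0r.
  by rewrite (@fsE _ n) // => j /hn ->; rewrite scale0r.
have -> : op_horner2 g X Y v = \sum_(i < size g) \sum_(j < n) g`_i`_j *: iter i X (iter j Y v).
  by apply: eq_bigr => i _; exact: e.
rewrite -(fsE (f := fun i => \sum_(j < n) g`_i`_j *: iter i X (iter j Y v))) => [|i hi]; last first.
  by rewrite (nth_default _ hi) big1 // => j _; rewrite coef0 scale0r.
by rewrite (@fsE _ m) // => i /hm ->; rewrite big1 // => j _; rewrite coef0 scale0r.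
Qed.

Lemma op_horner2_smith (k : F) (X Y : M -> M) v :
  op_horner2 (bp_smith_poly k) X Y v =
  - (3 *: X (X v)) + (2 * k + 3) *: X v + (k + 3) *: Y v.
Proof.
pose c := 2 * k + 3; pose d := k + 3.
(* The outer variable is [x] and the inner one [y], so the coefficients of the powers of [x] are
   [(k + 3) y], [2 k + 3] and [- 3]. *)
have e i : (bp_smith_poly k)`_i = - ((i == 2)%:R *+ 3 - c%:P * (i == 1)%:R -
    (if i == 0%N then d%:P * 'X else 0)).
  by rewrite /bp_smith_poly mulr_natl -polyCM !(coefN, coefB, coefMn, coefXn, coefCM, coefX, coefC).
have e0 : (bp_smith_poly k)`_0 = d%:P * 'X by rewrite e /= mul0rn mulr0 subr0 sub0r opprK.
have e1 : (bp_smith_poly k)`_1 = c%:P by rewrite e /= mul0rn mulr1 subr0 sub0r opprK.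
have e2 : (bp_smith_poly k)`_2 = (- 3)%:P.
  by rewrite e /= mulr0 !subr0 -polyC1 -polyCMn -polyCN.
have e3 i : (3 <= i)%N -> (bp_smith_poly k)`_i = 0.
  by case: i => [|[|[|i]]] // _; rewrite e /= mul0rn mulr0 !subr0 oppr0.
rewrite (@op_horner2_widen _ _ _ _ 3 2) => [|//|i [|[|j]] // _]; last first.
  case: i => [|[|[|i]]]; rewrite ?e0 ?e1 ?e2 ?e3 ?coefC ?coef0 //.
  by rewrite coefCM coefX mulr0.
rewrite !big_ord_recl !big_ord0 /= e0 e1 e2 !coefC !coefCM !coefX /=.
rewrite !scale0r !mulr0 mulr1 scale0r scaleNr !addr0 add0r.
by rewrite [LHS]addrC [X in X + _]addrC.
Qed.

End Combinations.

(** Expresses without coordinates that an eigenvector of a diagonal operator is a combination of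
    basis vectors of the same eigenvalue: every subspace [P] containing those contains it. *)
Definition diagonalizing (F : numClosedFieldType) (M : lmodType F) (bas : fockBasis -> M) : Prop :=
  forall (L : M -> M) (c : fockBasis -> F) (a : F) (v : M) (P : M -> Prop),
    linear L -> (forall b, L (bas b) = c b *: bas b) -> L v = a *: v ->
    linear_closed P -> (forall b, c b = a -> P (bas b)) -> P v.

Section Realization.
Variable F : numClosedFieldType.
Variables (V : vaData F) (basV : fockBasis -> V) (HV : bool -> int -> V -> V) (SV : int -> V -> V).
Hypothesis fkV : fock_space 0 0 basV HV SV.
Hypothesis V_lin : forall n w, linear (fun a => nprod V a n w).
Hypothesis V_bas : forall b n w, nprod V (basV b) n w = Yf 0 HV SV b n w.
Hypothesis V_vac : vac V = ex basV 0.
Hypothesis V_diag : diagonalizing basV.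
Variables (M : lmodType F) (r : F) (bas : fockBasis -> M).
Variables (H : bool -> int -> M -> M) (S : int -> M -> M).
Hypothesis fkM : fock_space (-1) r bas H S.
Hypothesis M_diag : diagonalizing bas.
Hypothesis bas_neq0 : forall b, bas b <> 0.
Variable act : V -> int -> M -> M.
Hypothesis act_lin : forall n w, linear (fun a => act a n w).
Hypothesis act_bas : forall b n w, act (basV b) n w = Yf (-1) H S b n w.
Hypothesis act_module : va_module act.
Variables (W : vaData F) (g : bpGens W) (phi : W -> V).
Hypothesis phi_hom : va_hom phi.
Hypotheses (phiJ : phi (bpJ g) = Jvec basV HV) (phiT : phi (bpT g) = Tvec basV HV).
Hypotheses (phiGp : phi (bpGp g) = Gpvec basV HV) (phiGm : phi (bpGm g) = Gmvec basV).

Definition restr (a : W) : int -> M -> M := act (phi a).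
Definition degree_comp (m : nat) (v : M) : Prop := Lop restr g 0 v = (- (1 / 2) + m%:R) *: v.

Local Notation L0M := (L0 basV HV act).

Let act_linr a n : linear (act a n).
Proof. exact: (proj1 (act_field fkV fkM act_lin act_bas a) n). Qed.

Let L0M_lin : linear L0M := L0_lin fkV fkM act_lin act_bas.

Lemma Lop_L0 v : Lop restr g 0 v = L0M v.
Proof. by rewrite /Lop /restr phiT phiJ add0r. Qed.

Lemma restr_module : va_module restr.
Proof.
have [phi_lin phi_vac phi_prod] := phi_hom.
have [_ trunc vacE borchE] := act_module.
split.
- split=> [a n|n w a u v]; first exact: act_linr.
  by rewrite /restr phi_lin act_lin.
- by move=> a w; exact: trunc.
- by move=> n w; rewrite /restr phi_vac.
- move=> a b w l m n; apply: etrans (borchE (phi a) (phi b) w l m n).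
  by apply: eq_fs => i; rewrite /restr phi_prod.
Qed.

Lemma degree_compE m v : degree_comp m v <-> hd bas m v.
Proof.
rewrite /degree_comp Lop_L0; split=> [e|]; last exact: (L0_hd fkV V_bas V_vac fkM act_lin act_bas).
apply: (M_diag (L := L0M) (c := L0_weight (-1) r) _ _ e) => //.
- exact: (L0_bas fkV V_bas V_vac fkM act_lin act_bas).
- by split=> [|a u w]; [exact: hd0|exact: hd_lin].
move=> b; rewrite /L0_weight => hb; apply: hd_bas; congr Posz.
apply/eqP; rewrite -(eqr_nat F); apply/eqP.
by apply: (addrI (- (1 / 2))); rewrite -hb; field.
Qed.

(** The vector [phi a] has the same weight in Pi(0), where basis vectors of exponent [j] have weight
    [mdeg - 2 j]. Their fields on a Fock module shift degrees by [mdeg + 2 s j - n - 1], and at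
    [s = -1] the two weights agree. *)
Lemma weight_shift a (d : int) : Lop (nprod W) g 0 a = d%:~R *: a ->
  forall n (m : int) w, hd bas m w -> hd bas (m + d - n - 1) (act (phi a) n w).
Proof.
have [phi_lin phi_vac phi_prod] := phi_hom => e.
have eV : L0 basV HV (nprod V) (phi a) = d%:~R *: phi a.
  rewrite -(linZ phi_lin) -e /Lop (linB phi_lin) (linZ phi_lin) !phi_prod phiT phiJ.
  by rewrite /L0 add0r.
pose P u := forall n m w, hd bas m w -> hd bas (m + d - n - 1) (act u n w).
suff : P (phi a) by [].
apply: (V_diag (L := L0 basV HV (nprod V)) (c := L0_weight 0 0) (P := P) _ _ eV).
- exact: (L0_lin fkV fkV V_lin V_bas).
- exact: (L0_bas fkV V_bas V_vac fkV V_lin V_bas).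
- split=> [n m w _|k u v hu hv n m w hw]; first by rewrite (lin0 (act_lin n w)); exact: hd0.
  by rewrite act_lin; apply: hd_lin; [exact: hu|exact: hv].
move=> b hb n m w hw; rewrite act_bas.
have ed : (mdeg b.2)%:Z + 2 * -1 * b.1 = d.
  apply/eqP; rewrite -(eqr_int F) -hb /L0_weight; apply/eqP.
  by rewrite rmorphD !rmorphM /=; field.
by rewrite -ed; exact: (shifts_Yf fkM b).
Qed.

Lemma degree_decomposition : direct_sum_decomposition degree_comp.
Proof.
have Ll := lin_comp L0M_lin.
split=> [m|v|N f hf e m hm].
- split; first by rewrite /degree_comp Lop_L0 (lin0 L0M_lin) scaler0.
  move=> a u v; rewrite /degree_comp !Lop_L0 => hu hv.
  by rewrite L0M_lin hu hv scalerDr !scalerA mulrC.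
- pose P v := exists f : nat -> M, fin1 f /\ (forall m, hd bas m%:Z (f m)) /\ v = fs f.
  suff [f [[N hN] [hf ->]]] : P v.
    by exists N, f; split=> [m|]; [exact/degree_compE|exact: fsE].
  move: v; apply: (fk_ind fkM) => [|a u v [f [ff [hf ->]]] [h [fh [hh ->]]]|b].
  + exists (fun=> 0); split; first by exists 0%N.
    by split=> [m|]; [exact: hd0|rewrite fs0].
  + exists (fun m => a *: f m + h m); split; first by apply: fin1D => //; exact: fin1Z.
    split=> [m|]; first exact: hd_lin.
    by rewrite fsD ?fsZ //; exact: fin1Z.
  + exists (fun m => if m == mdeg b.2 then bas b else 0); split; [|split].
    * by exists (mdeg b.2).+1 => i hi; rewrite gtn_eqF.
    * by move=> m; case: eqP => [->|_]; [exact: hd_bas|exact: hd0].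
    * by rewrite (fs_single (i0 := mdeg b.2)) ?eqxx // => i /negPf ->.
- rewrite -(big_mkord xpredT f) in e.
  apply: (eigen_component (N := fun v => v = 0) (L := L0M) (l := index_iota 0 N)
    (f := f) (lam := fun m => - (1 / 2) + m%:R)) => //.
  + by move=> a u v -> ->; rewrite scaler0 addr0.
  + by move=> v ->; exact: (lin0 L0M_lin).
  + by move=> i; rewrite -Lop_L0; exact: hf.
  + exact: iota_uniq.
  + by move=> i j _ _ /addrI/eqP; rewrite eqr_nat => /eqP.
  + by rewrite mem_index_iota.
Qed.

Theorem restr_graded : graded_module restr g degree_comp.
Proof.
split; [exact: restr_module|exact: degree_decomposition|].
move=> a d n m w /weight_shift h /degree_compE /h - /(_ n); rewrite /restr.
by case: (_ - 1) => k hk; [exact/degree_compE|exact: hd_neg hk].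
Qed.

Lemma lowest_weight v : degree_comp 0 v -> Lop restr g 0 v = - (1 / 2) *: v.
Proof. by rewrite /degree_comp addr0. Qed.

Lemma lowest_nonzero : exists2 v, degree_comp 0 v & v <> 0.
Proof. by exists (bas (0, mset0)) => //; apply/degree_compE/hd_bas; rewrite /= mdeg0. Qed.

Lemma hd_lowest (P : M -> Prop) v : linear_closed P -> (forall j, P (bas (j, mset0))) ->
  hd bas 0 v -> P v.
Proof.
move=> [P0 Pl] Pb; elim=> [//|a u w _ hu _ hw|[j A] /= []]; first exact: Pl.
by move=> /mdeg_eq0 ->; exact: Pb.
Qed.

Lemma eq_lowest (A B : M -> M) : linear A -> linear B ->
  (forall j, A (bas (j, mset0)) = B (bas (j, mset0))) -> forall v, hd bas 0 v -> A v = B v.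
Proof.
move=> lA lB h v; apply: (hd_lowest (P := fun v => A v = B v)) => //.
by split=> [|a u w hu hw]; rewrite ?(lin0 lA) ?(lin0 lB) // lA lB hu hw.
Qed.

Hypothesis r_generic : ~ exists n : int, 4 * r = n%:~R.

Local Notation X := (Jop restr g 0).
Local Notation Y := (Lop restr g 0).
Local Notation E := (Gpop restr g 0).
Local Notation G := (fun v => - Gmop restr g 0 v).

Let X_bas j : X (bas (j, mset0)) = (r + j%:~R - 1) *: bas (j, mset0).
Proof.
rewrite /Jop /restr phiJ (J0_bas fkV fkM act_lin act_bas) /=; congr (_ *: _).
by rewrite addrC.
Qed.

Let beta (j : int) : F := let t := r + j%:~R in
  sqrtC 6 / 24 * (4 * t * (2 * t - 1) * (4 * t - 1)).

Let E_bas j : E (bas (j, mset0)) = beta j *: bas (j + 1, mset0).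
Proof. by rewrite /Gpop /restr phiGp (Gp_bas fkV V_bas V_vac fkM act_lin act_bas). Qed.

Let G_bas j : G (bas (j, mset0)) = (sqrtC 6 / 8) *: bas (j - 1, mset0).
Proof.
by rewrite /Gmop /restr phiGm add0r (Gm_bas fkM act_lin act_bas) // scaleNr opprK.
Qed.

Let sqrt6_neq0 : sqrtC 6 != 0 :> F.
Proof. by rewrite sqrtC_eq0 pnatr_eq0. Qed.

Let beta_neq0 j : beta j != 0.
Proof.
have h (n : int) : 4 * r != n%:~R by apply/eqP => e; apply: r_generic; exists n.
(* The zeros [t = 0, 1/2, 1/4] of the three factors, for [t = r + j], mean that [4 r] is [- 4 j],
   [2 - 4 j] or [1 - 4 j]. *)
have h0 := h (- (4 * j)); have h1 := h (2 - 4 * j); have h2 := h (1 - 4 * j).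
rewrite !(rmorphN, rmorphB, rmorphM) /= in h0 h1 h2.
rewrite /beta !mulf_neq0 ?invr_neq0 ?pnatr_eq0 //.
- apply: contra h0 => /eqP e; apply/eqP.
  have -> : 4 * r = 4 * (r + j%:~R) - 4 * j%:~R by ring.
  by rewrite e mulr0 sub0r.
- apply: contra h1 => /eqP e; apply/eqP.
  have -> : 4 * r = 2 * (2 * (r + j%:~R) - 1) + (2 - 4 * j%:~R) by ring.
  by rewrite e mulr0 add0r.
- apply: contra h2 => /eqP e; apply/eqP.
  have -> : 4 * r = 4 * (r + j%:~R) - 1 + (1 - 4 * j%:~R) by ring.
  by rewrite e add0r.
Qed.

(** Stability is asked for only on vectors of degree 0, so that the lemma serves both for subspaces
    of the lowest component and for submodules of the whole module. *)
Lemma lowest_irreducible (N : M -> Prop) v : linear_closed N ->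
  (forall v, N v -> hd bas 0 v -> [/\ N (E v), N (G v) & N (X v)]) ->
  N v -> hd bas 0 v -> v <> 0 -> forall j, N (bas (j, mset0)).
Proof.
move=> [N0 Nl] Nop Nv hv v0.
have NZ a u : N u -> N (a *: u) by move=> h; rewrite -[_ *: _]addr0; exact: Nl.
have hb j : hd bas 0 (bas (j, mset0)) by apply: hd_bas; rewrite /= mdeg0.
pose N' v := N v /\ hd bas 0 v.
have N'l a u w : N' u -> N' w -> N' (a *: u + w).
  by move=> [n1 h1] [n2 h2]; split; [exact: Nl|exact: hd_lin].
have lX : linear X by exact: act_linr.
have X_hd u : hd bas 0 u -> hd bas 0 (X u).
  apply: (hd_lowest (P := fun u => hd bas 0 (X u))) => [|j]; last by rewrite X_bas; exact: hdZ.
  split=> [|a u1 u2 h1 h2]; first by rewrite (lin0 lX); exact: hd0.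
  by rewrite lX; exact: hd_lin.
have [l [a [ul ev]]] : exists (l : seq int) (a : int -> F), uniq l /\
    v = \sum_(j <- l) a j *: bas (j, mset0).
  apply: (hd_lowest (P := fun v => exists (l : seq int) (a : int -> F), uniq l /\
    v = \sum_(j <- l) a j *: bas (j, mset0)) _ _ hv); first exact: closed_uniq_sum.
  by move=> j; exists [:: j], (fun=> 1); rewrite big_seq1 scale1r.
have comp j : j \in l -> N' (a j *: bas (j, mset0)).
  apply: (eigen_component (N := N') (L := X) (l := l)
    (f := fun j => a j *: bas (j, mset0)) (lam := fun j => r + j%:~R - 1)) => //.
  - by split=> //; exact: hd0.
  - by move=> u [nu hu]; split; [have [] := Nop u nu hu|exact: X_hd].
  - by move=> i; rewrite (linZ lX) X_bas !scalerA mulrC.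
  - by move=> i j' _ _ /addIr/addrI/eqP; rewrite eqr_int => /eqP.
  - by rewrite -ev.
have [j0 Nj0] : exists j, N (bas (j, mset0)).
  apply: contrapT => hn; apply: v0; rewrite ev big_seq big1 // => j /comp [nj _].
  have [->|aj] := eqVneq (a j) 0; first by rewrite scale0r.
  case: hn; exists j; rewrite -[bas _]scale1r -(mulVf aj) -scalerA; exact: NZ.
have up j : N (bas (j, mset0)) -> N (bas (j + 1, mset0)).
  move=> /Nop /(_ (hb j)) [/(NZ (beta j)^-1) + _ _].
  by rewrite E_bas scalerA mulVf ?scale1r.
have down j : N (bas (j, mset0)) -> N (bas (j - 1, mset0)).
  move=> /Nop /(_ (hb j)) [_ /(NZ (sqrtC 6 / 8)^-1) + _].
  by rewrite G_bas scalerA mulVf ?scale1r // mulf_neq0 // invr_neq0 // pnatr_eq0.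
have ups (n : nat) : N (bas (j0 + n%:Z, mset0)).
  by elim: n => [|n IH]; rewrite ?addr0 // intS [1 + _]addrC addrA; exact: up.
have downs (n : nat) : N (bas (j0 - n%:Z, mset0)).
  by elim: n => [|n IH]; rewrite ?subr0 // intS [1 + _]addrC opprD addrA; exact: down.
move=> j; have [h|h] := lerP j0 j.
  by rewrite (_ : j = j0 + `|j - j0|%N%:Z); [exact: ups|lia].
by rewrite (_ : j = j0 - `|j0 - j|%N%:Z); [exact: downs|lia].
Qed.

Lemma lowest_smith k : k = - (9 / 4) ->
  smith_irreducible (bp_smith_poly k) (degree_comp 0) E G X Y.
Proof.
move=> hk.
have [lE lG lX lY] : [/\ linear E, linear G, linear X & linear Y].
  split; try exact: act_linr.
  - by move=> a u v; rewrite /Gmop /restr act_linr opprD scalerN.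
  - by move=> a u v; rewrite !Lop_L0 L0M_lin.
have hb j : hd bas 0 (bas (j, mset0)) by apply: hd_bas; rewrite /= mdeg0.
have stable A : linear A -> (forall j, hd bas 0 (A (bas (j, mset0)))) ->
    forall v, hd bas 0 v -> hd bas 0 (A v).
  move=> lA h v; apply: (hd_lowest (P := fun v => hd bas 0 (A v))) => //.
  by split=> [|a u w hu hw]; [rewrite (lin0 lA); exact: hd0|rewrite lA; exact: hd_lin].
have sE := stable _ lE (fun j => eq_ind_r (hd bas 0) (hdZ (beta j) (hb (j + 1))) (E_bas j)).
have sG := stable _ lG (fun j => eq_ind_r (hd bas 0) (hdZ (sqrtC 6 / 8) (hb (j - 1))) (G_bas j)).
have sX := stable _ lX (fun j => eq_ind_r (hd bas 0) (hdZ (r + j%:~R - 1) (hb j)) (X_bas j)).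
have Yv v : hd bas 0 v -> Y v = - (1 / 2) *: v.
  by move=> h; apply/lowest_weight/degree_compE.
have sY v : hd bas 0 v -> hd bas 0 (Y v) by move=> h; rewrite Yv //; exact: hdZ.
have op A : linear A -> (forall v, hd bas 0 v -> hd bas 0 (A v)) -> op_on (degree_comp 0) A.
  by move=> lA sA; split=> [v /degree_compE h|a u v _ _]; [exact/degree_compE/sA|exact: lA].
have YA A : linear A -> (forall v, hd bas 0 v -> hd bas 0 (A v)) ->
    forall v, hd bas 0 v -> Y (A v) = A (Y v).
  by move=> lA sA v h; rewrite !Yv ?(linZ lA) //; exact: sA.
split.
- split; first by have [] := degree_decomposition.
  + by split; exact: op.
  + by move=> v /degree_compE h; split; [exact: (YA _ lE sE)|exact: (YA _ lG sG)|exact: (YA _ lX sX)].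
  + move=> v /degree_compE hv; split.
    * apply: (eq_lowest (A := fun v => X (E v) - E (X v))) hv => // [|j].
        by apply: lin_sub; apply: lin_comp.
      rewrite E_bas X_bas (linZ lE) (linZ lX) E_bas X_bas !scalerA -scalerBl.
      by congr (_ *: _); rewrite intrD; ring.
    * apply: (eq_lowest (A := fun v => X (G v) - G (X v)) (B := fun v => - G v)) hv => [||j].
      - exact: (lin_sub (lin_comp lX lG) (lin_comp lG lX)).
      - by move=> a u w; rewrite !opprK; exact: act_linr.
      rewrite G_bas X_bas (linZ lG) (linZ lX) G_bas X_bas !scalerA -scalerBl -scaleNr.
      by congr (_ *: _); rewrite rmorphB /=; ring.
    * have s6 : sqrtC 6 ^+ 2 = 6 :> F by exact: sqrtCK.
      have := eq_lowest (A := fun v => E (G v) - G (E v))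
        (B := fun v => - (3 *: X (X v)) + (2 * k + 3) *: X v + (k + 3) *: Y v) _ _ _ hv.
      rewrite op_horner2_smith; apply=> [||j].
      - exact: (lin_sub (lin_comp lE lG) (lin_comp lG lE)).
      - apply: lin_add; last exact: lin_scale.
        apply: lin_add; last exact: lin_scale.
        move=> a u w; rewrite !lX scalerDr !scalerA opprD scalerN !scalerA.
        by rewrite [3 * a]mulrC.
      rewrite Yv // E_bas G_bas (linZ lE) (linZ lG) E_bas G_bas X_bas (linZ lX) X_bas.
      have -> : j - 1 + 1 = j by lia.
      have -> : j + 1 - 1 = j by lia.
      rewrite !scalerA -!scaleNr -!scalerDl.
      congr (_ *: _); rewrite /beta hk rmorphB /=.
      move: s6; set c := sqrtC 6; set t := j%:~R => s6.
      (* Both sides are quadratic in [r + t], the left one being a difference of consecutive values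
         of the cubic coefficient; they agree for [c^2 = 6] and [k = - 9/4]. *)
      have -> : c / 8 * (c / 24 * (4 * (r + (t - 1)) * (2 * (r + (t - 1)) - 1) * (4 * (r + (t - 1)) - 1))) +
          - (c / 24 * (4 * (r + t) * (2 * (r + t) - 1) * (4 * (r + t) - 1)) * (c / 8)) =
          c ^+ 2 * (- 16 * (r + t) ^+ 2 + 24 * (r + t) - 10) / 32 by field.
      by rewrite s6; field.
- exact: lowest_nonzero.
move=> N [N0 Nl] NS Nop.
have [[v [Nv v0]]|hn] := pselect (exists v, N v /\ v <> 0); [right|left]; last first.
  by move=> v Nv; apply: contrapT => v0; apply: hn; exists v.
have Nb := lowest_irreducible (conj N0 Nl) (fun v Nv _ => let: And4 a b c _ := Nop v Nv in And3 a b c)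
  Nv (proj1 (degree_compE 0 v) (NS v Nv)) v0.
by move=> w /degree_compE; exact: hd_lowest.
Qed.

Lemma restr_irreducible : va_irreducible restr.
Proof.
split; first by exists (bas (0, mset0)).
move=> N [[N0 Nl] Nact].
have [[v [Nv v0]]|hn] := pselect (exists v, N v /\ v <> 0); [right|left]; last first.
  by move=> v Nv; apply: contrapT => v0; apply: hn; exists v.
have NZ a u : N u -> N (a *: u) by move=> h; rewrite -[_ *: _]addr0; exact: Nl.
have NH n u : N u -> N (H false n u).
  move=> /(Nact (bpJ g) n) /(NZ (- 2)); rewrite /restr phiJ (act_J fkV fkM act_lin act_bas) scalerA.
  by rewrite (_ : - 2 * - (1 / 2) = 1) ?scale1r //; field.
have NE n u : N u -> N (Ef (-1) H S (-1) n u).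
  move=> /(Nact (bpGm g) n) /(NZ (- (sqrtC 6 / 8))^-1).
  rewrite /restr phiGm (act_Gm act_lin act_bas) scalerA mulVf ?scale1r //.
  by rewrite oppr_eq0 mulf_neq0 // invr_neq0 // pnatr_eq0.
have NL u : N u -> N (L0M u).
  move=> Nu; rewrite -Lop_L0 /Lop addrC -scaleNr; apply: Nl; exact: Nact.
have [m [u [Nu hu u0]]] : exists m u, [/\ N u, hd bas m%:Z u & u <> 0].
  have [_ /(_ v) [K [f [hf ev]]] _] := degree_decomposition.
  rewrite -(big_mkord xpredT f) in ev.
  apply: contrapT => hm; apply: v0; rewrite ev big_seq big1 // => i hi.
  apply: contrapT => fi; apply: hm; exists i, (f i); split=> //; last exact/degree_compE.
  apply: (eigen_component (N := N) (L := L0M) (l := index_iota 0 K)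
    (f := f) (lam := fun m => - (1 / 2) + m%:R)) => //.
  + by move=> j; rewrite -Lop_L0; exact: hf.
  + exact: iota_uniq.
  + by move=> j j' _ _ /addrI/eqP; rewrite eqr_nat => /eqP.
  + by rewrite -ev.
have [w Nw [hw w0]] := descent fkM erefl NH NE hu Nu u0.
have Nop x : N x -> hd bas 0 x -> [/\ N (E x), N (G x) & N (X x)].
  move=> Nx _; split; [exact: Nact| |exact: Nact].
  by rewrite -scaleN1r; apply: NZ; exact: Nact.
apply: (lowest_generates fkM erefl N0 Nl NH NE).
exact: (lowest_irreducible (conj N0 Nl) Nop Nw hw w0).
Qed.

End Realization.

Local Close Scope mset_scope.

(** Comparing coefficients at [b] in [L v = a v] gives [c b = a] for every [b] in the support of
    [v]. *)
Lemma fock_diagonalizing (F : numClosedFieldType) :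
  diagonalizing (fun b : fockBasis => << b >> : fock F).
Proof.
move=> L c a v P lL Lb Lv [P0 Pl] Pb.
have coefL b u : (L u)@_b = c b * u@_b.
  apply: (fock_ext (M := F^o) (f := fun u => (L u)@_b) (g := fun u => c b * u@_b)).
  - by move=> k u1 u2; rewrite lL mcoeffD mcoeffZ.
  - by move=> k u1 u2; rewrite mcoeffD mcoeffZ mulrDr mulrCA.
  by move=> b'; rewrite Lb mcoeffZ !mcoeffU; case: eqP => [->|_]; rewrite ?mulr0n ?mulr0.
rewrite (fock_sum v) big_seq; elim/big_rec: _ => // b u hb hu; apply: Pl hu.
apply: Pb; have := coefL b v; rewrite Lv mcoeffZ => /mulIf -> //.
by rewrite mcoeff_neq0.
Qed.

Theorem theorem7p2 (R : realType) (k : complex R) (hk : k = - (9 / 4))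
    (W : vaData (complex R)) (g : bpGens W) (hW : simple_bp k g)
    (phi : W -> Pi0 (complex R)) (hphi : realization g phi) :
  (forall r : complex R,
     graded_module (Mres phi (-1) r) g (Mcomp g phi r) /\
     exists2 v, Mcomp g phi r 0%N v & v <> 0) /\
  (forall r : complex R, ~ (exists n : int, 4 * r = n%:~R) ->
     (smith_irreducible (bp_smith_poly k) (Mcomp g phi r 0%N)
        (Gpop (Mres phi (-1) r) g 0)
        (fun v => - Gmop (Mres phi (-1) r) g 0 v)
        (Jop (Mres phi (-1) r) g 0)
        (Lop (Mres phi (-1) r) g 0) /\
      forall v, Mcomp g phi r 0%N v ->
        Lop (Mres phi (-1) r) g 0 v = - (1 / 2) *: v) /\
     va_irreducible (Mres phi (-1) r)).
Proof.
have [phi_hom _ phi_gens _] := hphi.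
have phiJ := congr1 (@bpJ _ _) phi_gens; have phiT := congr1 (@bpT _ _) phi_gens.
have phiGp := congr1 (@bpGp _ _) phi_gens; have phiGm := congr1 (@bpGm _ _) phi_gens.
pose F : numClosedFieldType := complex R.
have fkV := @fock_space_fock F 0 0.
(* The algebra and its modules share the underlying Fock space, so this one fact serves for both. *)
have V_diag := @fock_diagonalizing F.
have V_lin := @Mact_lin F 0 0.
have V_bas := @Mact_bas F 0 0.
have b0 (b : fockBasis) : << b >> <> 0 :> fock F.
  by move/(congr1 (@mcoeff _ _ b)); rewrite mcoeffUU mcoeff0 => /eqP; rewrite oner_eq0.
split=> [r|r hr].
  have fkM := @fock_space_fock F (-1) r.
  split.
    exact: (restr_graded (V := Pi0 F) fkV V_lin V_bas erefl V_diag fkM V_diag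
      (Mact_lin (-1) r) (Mact_bas (-1) r) (Mact_module (-1) r) phi_hom phiJ phiT).
  exact: (lowest_nonzero (V := Pi0 F) fkV V_bas erefl fkM V_diag b0
    (Mact_lin (-1) r) (Mact_bas (-1) r) phiJ phiT).
have fkM := @fock_space_fock F (-1) r.
split; first split.
- exact: (lowest_smith (V := Pi0 F) fkV V_bas erefl fkM V_diag b0 (Mact_lin (-1) r)
    (Mact_bas (-1) r) phiJ phiT phiGp phiGm hr hk).
- exact: lowest_weight.
- exact: (restr_irreducible (V := Pi0 F) fkV V_bas erefl fkM V_diag b0 (Mact_lin (-1) r)
    (Mact_bas (-1) r) phiJ phiT phiGp phiGm hr).
Qed.
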